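(* Let $a_1,a_2\in\mathbb{R}$ and $\sigma_1,\sigma_2\in\mathbb{R}$ with $\sigma_1\sigma_2>0$, and put $\mu:=a_2-a_1+\sigma_1^2/2-\sigma_2^2/2$. If $\mu>0$, then for every pair of starting points $(x,y)$ with $x>y>0$: (1) the mirror coupling $V=-B$ is not exponentially efficient for $(x,y)$ in Problem (T$+$) (minimisation of $\mathbb{P}_{x,y}(\tau(V)>T)$); (2) the synchronous coupling $V=B$ is not exponentially efficient for $(x,y)$ in Problem (T$-$) (maximisation of $\mathbb{P}_{x,y}(\tau(V)>T)$).
   Context: $(\Omega,\mathcal{F},(\mathcal{F}_t)_{t\ge0},\mathbb{P})$ is a filtered probability space supporting a fixed standard $(\mathcal{F}_t)$-Brownian motion $B=(B_t)_{t\ge 0}$ ($B_0=0$). $\mathcal{V}$ denotes the set of all standard $(\mathcal{F}_t)$-Brownian motions $V=(V_t)_{t\ge0}$ with $V_0=0$ on this space. For $V\in\mathcal{V}$ the geometric Brownian motions $X$ and $Y(V)$ are defined by $$X_t=x+\int_0^tX_s(\sigma_1\,\mathrm{d}B_s+a_1\,\mathrm{d}s),\qquad Y_t(V)=y+\int_0^tY_s(V)(\sigma_2\,\mathrm{d}V_s+a_2\,\mathrm{d}s),$$ and $\mathbb{P}_{x,y}$ indicates that the starting points are $X_0=x$, $Y_0(V)=y$. The coupling time is $\tau(V):=\inf\{t\ge0:\ X_t=Y_t(V)\}$, with $\inf\emptyset:=\infty$. For a choice of sign $\pm$, Problem (T$\pm$) is to attain $\inf_{V\in\mathcal{V}}\pm\mathbb{P}_{x,y}(\tau(V)>T)$,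 and its value function is $F(x,y,t):=\inf_{V\in\mathcal{V}}\pm\mathbb{P}_{x,y}(\tau(V)>t)$, $t\ge0$ (so $\pm F$ is the infimum of the tail probabilities for $+$ and their supremum for $-$). A coupling $V\in\mathcal{V}$ is called (exponentially) efficient for $(x,y)$ in Problem (T$\pm$) if $$\pm\liminf_{t\to\infty}\frac1t\log\mathbb{P}_{x,y}(\tau(V)>t)\ \le\ \pm\liminf_{t\to\infty}\frac1t\log\left(\pm F(x,y,t)\right),$$ with the convention $\log 0=-\infty$. *)

(* Defs.v *)
From HB Require Import structures.
From mathcomp Require Import all_boot all_order all_algebra.
From mathcomp Require Import all_classical all_reals all_analysis.

Set Implicit Arguments.
Unset Strict Implicit.
Unset Printing Implicit Defensive.

Import Order.TTheory GRing.Theory Num.Theory.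
Import numFieldNormedType.Exports.

Local Open Scope classical_set_scope.
Local Open Scope ring_scope.

(* Time is indexed by the whole of R; only the times t >= 0 are ever
   constrained or used. *)
Definition process (R : realType) (T : Type) := R -> T -> R.

Section Processes.
Context {R : realType} {d : measure_display} {T : measurableType d}.
Context (P : probability T R) (F : R -> set_system T).

(* The filtration is not assumed to be complete or right-continuous. *)
Definition filtration : Prop :=
  [/\ forall t : R, 0 <= t -> sigma_algebra setT (F t),
      forall t : R, 0 <= t -> F t `<=` measurable &
      forall s t : R, 0 <= s -> s <= t -> F s `<=` F t].

Definition measurable_wrt (G : set_system T) (Z : T -> R) : Prop :=
  forall A : set R, measurable A -> G (Z @^-1` A).

Definition adapted (Z : process R T) : Prop :=
  forall t : R, 0 <= t -> measurable_wrt (F t) (Z t).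

Definition continuous_paths (Z : process R T) : Prop :=
  forall w, {within `[0, +oo[, continuous (fun t => Z t w)}.

Definition increment (Z : process R T) (s t : R) (w : T) : R :=
  Z t w - Z s w.

(* The second argument of [normal_prob] is the standard deviation. *)
Definition brownian_motion (V : process R T) : Prop :=
  [/\ adapted V, continuous_paths V, forall w, V 0 w = 0,
      forall s t : R, 0 <= s -> s < t -> forall (A : set T) (E : set R),
        F s A -> measurable E ->
        P (A `&` increment V s t @^-1` E) =
        (P A * P (increment V s t @^-1` E))%E &
      forall s t : R, 0 <= s -> s < t -> forall E : set R, measurable E ->
        P (increment V s t @^-1` E) = normal_prob 0 (Num.sqrt (t - s)) E].

(* The process s |-> \sum_(i < n) xi_i 1_{]t_i, t_(i+1)]}(s), with each xi_i
   bounded and F_(t_i)-measurable. *)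
Record simple_process := SimpleProcess {
  sp_size : nat;
  sp_time : nat -> R;
  sp_coef : nat -> T -> R;
  sp_time_ge0 : forall i, 0 <= sp_time i;
  sp_time_le : forall i, sp_time i <= sp_time i.+1;
  sp_coef_bounded : forall i, exists M, forall w, `|sp_coef i w| <= M;
  sp_coef_measurable : forall i, measurable_wrt (F (sp_time i)) (sp_coef i) }.

Definition sp_eval (S : simple_process) : process R T := fun s w =>
  \sum_(i < sp_size S)
    sp_coef S i w * \1_(`]sp_time S i, sp_time S i.+1]%classic) s.

Definition sp_integral (S : simple_process) (V : process R T) : process R T :=
  fun t w => \sum_(i < sp_size S)
    sp_coef S i w *
      (V (Num.min (sp_time S i.+1) t) w - V (Num.min (sp_time S i) t) w).

Definition cvg0_in_probability (Z : nat -> T -> \bar R) : Prop :=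
  forall e : R, 0 < e -> P [set w | (e%:E <= Z n w)%E] @[n --> \oo] --> 0%E.

(* J is a version of the Ito integral \int_0^t H_s dV_s: the limit in
   probability of the integrals of simple processes S_n such that
   \int_0^t (S_n - H)_s^2 ds tends to 0 in probability.  It is meant for
   integrands H that are adapted with continuous paths. *)
Definition is_ito_integral (V H : process R T) (t : R) (J : T -> R) : Prop :=
  measurable_fun setT J /\
  exists S : nat -> simple_process,
    cvg0_in_probability (fun n w =>
      \int[lebesgue_measure]_(s in `[0%R, t])
        ((sp_eval (S n) s w - H s w) ^+ 2)%:E)%E /\
    cvg0_in_probability (fun n w => `|sp_integral (S n) V t w - J w|%:E).

(* Z is a solution of Z_t = z + \int_0^t Z_s (sigma dV_s + a ds). *)
Definition geometric_brownian_motion (V : process R T) (sigma a z : R)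
    (Z : process R T) : Prop :=
  [/\ adapted Z, continuous_paths Z &
      forall t : R, 0 <= t -> exists2 J : T -> R,
        is_ito_integral V (fun s w => Z s w * sigma) t J &
        {ae P, forall w, Z t w =
          z + (J w + \int[lebesgue_measure]_(s in `[0, t]) (Z s w * a))}].

Definition coupling_time (X Y : process R T) (w : T) : \bar R :=
  ereal_inf (EFin @` [set t | 0 <= t /\ X t w = Y t w]).

Definition tail_probability (X Y : process R T) (t : R) : \bar R :=
  P [set w | (t%:E < coupling_time X Y w)%E].

End Processes.

(* Tplus: minimisation of the tail; Tminus: maximisation of the tail. *)
Variant problem := Tplus | Tminus.

Section Efficiency.
Context {R : realType} {d : measure_display} {T : measurableType d}.
Context (P : probability T R) (F : R -> set_system T).
Context (X : process R T) (Y : process R T -> process R T).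
Local Open Scope ereal_scope.

Definition pm (p : problem) (u : \bar R) : \bar R :=
  match p with Tplus => u | Tminus => - u end.

Definition value_function (p : problem) (t : R) : \bar R :=
  ereal_inf [set pm p (tail_probability P X (Y V) t)
            | V in brownian_motion P F].

(* liminf_(t -> oo) (1/t) log (f t), where [lne 0 = -oo]. *)
Definition exponential_rate (f : R -> \bar R) : \bar R :=
  limf_einf (fun t : R => (t^-1)%:E * lne (f t)) (pinfty_nbhs R).

Definition efficient (p : problem) (V : process R T) : Prop :=
  pm p (exponential_rate (tail_probability P X (Y V))) <=
  pm p (exponential_rate (fun t => pm p (value_function p t))).

End Efficiency.

(* Main.v *)
Require Import Defs.
From HB Require Import structures.
From mathcomp Require Import all_boot all_order all_algebra.
From mathcomp Require Import all_classical all_reals all_analysis.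
From mathcomp Require Import measurable_realfun ring lra.
Import Order.TTheory GRing.Theory Num.Theory.
Import numFieldNormedType.Exports.
Local Open Scope classical_set_scope.
Local Open Scope ring_scope.

Set Implicit Arguments.
Unset Strict Implicit.
Unset Printing Implicit Defensive.

(** The logarithmic gap [D_t = ln X_t - ln Y_t(V)] is
    [ln x - ln y + sigma1 B_t - sigma2 V_t - mu t], a Brownian motion with drift
    [- mu < 0], and the coupling time is its first zero.  Its volatility is
    [s = sigma1 + sigma2] for the mirror coupling and [r = sigma1 - sigma2] for
    the synchronous one, and [r ^+ 2 < s ^+ 2] because [sigma1 * sigma2 > 0].
    Survival up to time [t] costs about [expR (- mu ^+ 2 * t / (2 * v ^+ 2))] when the
    volatility is [v], so the mirror coupling has a strictly larger rate than
    the synchronous one.  Then the mirror coupling does worse than [V = B] in the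
    minimisation problem, and the synchronous one does worse than [V = - B] in the
    maximisation problem: neither attains the rate of the value function.

    Two one-sided estimates suffice.  For [V = B], survival forces [D_t > 0], and
    the exponential Markov inequality with parameter [mu / s ^+ 2] gives a rate
    strictly below [- mu ^+ 2 / (2 * s ^+ 2)]  ([synchronous_rate]).  For [V = - B],
    every [kap > mu ^+ 2 / (2 * s ^+ 2)] is an attainable cost: the time axis is cut
    into blocks of a large length [h]; during each block the path climbs at the
    speed of the line that it has to stay above, without deep excursions
    ([block_prob], [drifted_survival], [mirror_rate]).  Deep excursions are excluded
    by a first-passage bound ([passage]) in place of the reflection principle.

    The formula for [D_t] has to be derived from the definition of a geometric
    Brownian motion by a stochastic integral equation, the integral being a
    limit in probability along unspecified simple processes.  A maximal
    inequality for elementary integrals ([lenglart], [elem_lenglart]) shows that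
    left-point Riemann sums converge to the integral, uniformly on the grid
    ([riem_int_unif]).  Hence [Z] is close to its Euler sums ([euler_close]).
    Multiplied by the inverse of the expected solution, these sums are constant
    up to noises whose total variance tends to 0 ([step_noise],
    [euler_identity]); this is Ito's formula for the one function that is
    needed.  So the discounted process is constant ([gbm_explicit]). *)

(** * Gaussian integrals *)

Import HBNNSimple.

Section gauss.
Context {R : realType}.
Notation mu := (@lebesgue_measure R).
Local Open Scope ereal_scope.

(** The formula holds for simple functions by linearity; both sides pass to the
    limit along an increasing approximation of [f]. *)
Lemma ge0_integral_normal_prob (m s : R) (f : R -> \bar R) :
  measurable_fun setT f -> (forall x, 0 <= f x) ->
  \int[normal_prob m s]_x f x = \int[mu]_x (f x * (normal_pdf m s x)%:E).
Proof.
move=> mf f0.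
have mp : measurable_fun setT (fun x : R => (normal_pdf m s x)%:E).
  by apply/measurable_EFinP; exact: measurable_normal_pdf.
have p0 x : 0 <= (normal_pdf m s x)%:E by rewrite lee_fin normal_pdf_ge0.
pose g := nnsfun_approx measurableT mf. pose h n : R -> R := g n.
have mh n : measurable_fun setT (h n) by exact: (measurable_funP (g n)).
have nh n x : 0 <= (h n x)%:E by rewrite lee_fin /h.
have ndh x : {homo (fun n => (h n x)%:E) : a b / (a <= b)%N >-> a <= b}.
  by move=> a b ab; rewrite lee_fin; exact/lefP/nd_nnsfun_approx.
have mhE n : measurable_fun setT (fun x => (h n x)%:E) by exact/measurable_EFinP.
have E n : \int[normal_prob m s]_x (h n x)%:E
    = \int[mu]_x ((h n x)%:E * (normal_pdf m s x)%:E).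
  have q0 (r x : R) : 0 <= (r * \1_(h n @^-1` [set r]) x)%:E.
    rewrite lee_fin indicE; have [|_] := boolP (_ \in _); last by rewrite mulr0.
    by rewrite inE /= => <-; rewrite mulr1 /h.
  have mq (r : R) : measurable_fun setT (fun x : R => (r * \1_(h n @^-1` [set r]) x)%:E).
    by apply/measurable_EFinP; exact: measurable_funM.
  have mqp (r : R) : measurable_fun setT (fun x : R => (r * \1_(h n @^-1` [set r]) x)%:E * (normal_pdf m s x)%:E).
    by apply: emeasurable_funM.
  have mi (r : R) : measurable_fun setT (fun x : R => (\1_(h n @^-1` [set r]) x)%:E : \bar R).
    by apply/measurable_EFinP; exact: measurable_indic.
  have mip (r : R) : measurable_fun setT (fun x : R => (\1_(h n @^-1` [set r]) x)%:E * (normal_pdf m s x)%:E).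
    by apply: emeasurable_funM.
  have hE x : (h n x)%:E = \sum_(r \in range (h n)) (r * \1_(h n @^-1` [set r]) x)%:E.
    by rewrite /h [in LHS]fimfunE -fsumEFin.
  transitivity (\int[normal_prob m s]_x
      (\sum_(r \in range (h n)) (r * \1_(h n @^-1` [set r]) x)%:E)).
    by apply: eq_integral => x _; rewrite hE.
  transitivity (\int[mu]_x (\sum_(r \in range (h n))
      ((r * \1_(h n @^-1` [set r]) x)%:E * (normal_pdf m s x)%:E))); last first.
    by apply: eq_integral => x _; rewrite hE ge0_mule_fsuml.
  rewrite ge0_integral_fsum//.
  rewrite ge0_integral_fsum//; last by move=> r x _; rewrite mule_ge0.
  apply: eq_fsbigr => r; rewrite inE => -[x0 _ hx0].
  have r0 : (0 <= r%:E) by rewrite lee_fin -hx0 /h.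
  transitivity (\int[normal_prob m s]_x (r%:E * (\1_(h n @^-1` [set r]) x)%:E)).
    by apply: eq_integral => x _; rewrite EFinM.
  transitivity (\int[mu]_x (r%:E * ((\1_(h n @^-1` [set r]) x)%:E *
      (normal_pdf m s x)%:E))); last first.
    by apply: eq_integral => x _; rewrite EFinM muleA.
  rewrite ge0_integralZl//; last exact: mi.
  rewrite ge0_integralZl//; last 2 first.
    exact: mip.
    by move=> y _; rewrite mule_ge0// lee_fin.
  congr (_ * _).
  have mA : measurable (h n @^-1` [set r]).
    exact: (measurable_funPTI (g n)).
  transitivity (normal_prob m s (h n @^-1` [set r])).
    rewrite integral_indic//; congr (normal_prob m s _); exact: setIT.
  rewrite /normal_prob [LHS]integral_mkcond.
  apply: eq_integral => y _; rewrite patchE indicE.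
  by case: ifP => _; rewrite ?mul1e ?mul0e.
have hcvg x : (h n x)%:E @[n --> \oo] --> f x.
  exact: (cvg_nnsfun_approx measurableT mf (fun x _ => f0 x)).
transitivity (limn (fun n => \int[normal_prob m s]_x (h n x)%:E)).
  rewrite -monotone_convergence//.
  apply: eq_integral => x _; apply/esym; exact: (cvg_lim _ (hcvg x)).
have mhp n : measurable_fun setT (fun x : R => (h n x)%:E * (normal_pdf m s x)%:E).
  by apply: emeasurable_funM => //; exact/measurable_EFinP.
rewrite (_ : (fun _ => _) = (fun n => \int[mu]_x ((h n x)%:E * (normal_pdf m s x)%:E))); last first.
  by apply/funext => n; exact: E.
rewrite -monotone_convergence//; last 2 first.
- by move=> n x _; rewrite mule_ge0.
- by move=> x _ a b ab; rewrite lee_wpmul2r// ndh.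
apply: eq_integral => x _; apply/cvg_lim => //.
apply: cvgeZr => //; exact: hcvg.
Qed.

End gauss.

Section gauss_moments.
Context {R : realType}.
Variable s : R.
Hypothesis s0 : 0 < s.
Let Q := normal_prob 0 s.

(** Completing the square: [expR (l * y)] tilts the centred normal density into
    the one of mean [l * s ^+ 2]. *)
Lemma normal_mgfE (l : R) :
  (\int[normal_prob 0 s]_y (expR (l * y))%:E = (expR (l ^+ 2 * s ^+ 2 / 2))%:E)%E.
Proof.
have sn0 : s != 0 by rewrite gt_eqF.
rewrite ge0_integral_normal_prob//; last first.
  apply/measurable_EFinP; apply: measurableT_comp => //; exact: measurable_funM.
transitivity (\int[lebesgue_measure]_y
   ((expR (l ^+ 2 * s ^+ 2 / 2))%:E * (normal_pdf (l * s ^+ 2) s y)%:E))%E.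
  apply: eq_integral => y _; rewrite -!EFinM; congr (_%:E).
  rewrite !normal_pdfE// /normal_fun mulrCA [RHS]mulrCA; congr (_ * _).
  rewrite -!expRD; congr expR; rewrite subr0 -mulr_natr.
  by field.
rewrite ge0_integralZl//.
- by rewrite integral_normal_pdf mule1.
- apply/measurable_EFinP; exact: measurable_normal_pdf.
- by move=> y _; rewrite lee_fin normal_pdf_ge0.
Qed.

Lemma measurable_polyexp (k : nat) (l : R) :
  measurable_fun [set: R] (fun y : R => y ^+ k * expR (l * y)).
Proof.
apply: measurable_funM => //.
by apply: measurableT_comp => //; exact: measurable_funM.
Qed.

Lemma integrable_mgf (l : R) :
  (normal_prob 0 s).-integrable setT (EFin \o (fun y : R => expR (l * y))).
Proof.
apply/integrableP; split.
  apply/measurable_EFinP; apply: measurableT_comp => //; exact: measurable_funM.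
under eq_integral do rewrite /= ger0_norm ?expR_ge0//.
by rewrite /= normal_mgfE ltry.
Qed.

(** From [`|y| ^+ k <= k`! * expR `|y|]; the bound is uniform over bounded sets of
    [l], as differentiation under the integral sign requires. *)
Lemma polyexp_bound (k : nat) (l c y : R) : `|l| + 1 <= c ->
  `|y ^+ k * expR (l * y)| <= k`!%:R * (expR (c * y) + expR (- c * y)).
Proof.
move=> lc.
have y0 : 0 <= `|y| by [].
have k0 : 0 < k`!%:R :> R by rewrite ltr0n fact_gt0.
have A : `|y| ^+ k <= k`!%:R * expR `|y|.
  case: k k0 => [|k] k0.
    by rewrite expr0 mul1r -expR0 ler_expR.
  rewrite mulrC -ler_pdivrMr//.
  apply: le_trans (expR_ge1Dxn k y0).
  by rewrite lerDr.
have Bd : expR (l * y) <= expR (`|l| * `|y|).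
  by rewrite ler_expR -normrM ler_norm.
have C : expR `|y| * expR (`|l| * `|y|) <= expR (c * `|y|).
  by rewrite -expRD ler_expR; have := ler_wpM2r y0 lc; lra.
have D : expR (c * `|y|) <= expR (c * y) + expR (- c * y).
  have [y1|y1] := leP 0 y.
    by rewrite ger0_norm// lerDl expR_ge0.
  by rewrite ltr0_norm// mulrN mulNr lerDr expR_ge0.
rewrite normrM normrX (ger0_norm (expR_ge0 _)).
apply: (@le_trans _ _ (k`!%:R * expR `|y| * expR (`|l| * `|y|))).
  by apply: ler_pM => //; rewrite ?exprn_ge0 ?expR_ge0.
rewrite -mulrA ler_wpM2l ?(ltW k0)//.
exact: le_trans C D.
Qed.

Lemma integrable_polyexp_bound (a c : R) :
  (normal_prob 0 s).-integrable setT
    (EFin \o (fun y : R => a * (expR (c * y) + expR (- c * y)))).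
Proof.
rewrite (_ : _ \o _ = (fun y : R => a%:E * ((EFin \o (fun y : R => expR (c * y))) \+ (EFin \o (fun y : R => expR (- c * y)))) y)%E); last first.
  by apply/funext => y /=; rewrite EFinM EFinD.
apply: integrableZl => //.
by apply: integrableD => //; exact: integrable_mgf.
Qed.

Lemma integrable_polyexp (k : nat) (l : R) :
  (normal_prob 0 s).-integrable setT (EFin \o (fun y : R => y ^+ k * expR (l * y))).
Proof.
apply: (le_integrable _ _ _ (integrable_polyexp_bound k`!%:R (`|l| + 1))) => //.
  by apply/measurable_EFinP; exact: measurable_polyexp.
move=> y _ /=; rewrite lee_fin.
apply: le_trans (polyexp_bound _ _ _) _ => //.
by rewrite ler_norm.
Qed.

Let normal_moment (k : nat) (l : R) : R := (\int[normal_prob 0 s]_y (y ^+ k * expR (l * y)))%R.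

(** Every moment against [expR (l * y)] is the derivative in [l] of the preceding
    one, so that they all follow from the moment generating function. *)
Lemma is_derive_normal_moment (k : nat) (l : R) : is_derive l 1 (normal_moment k) (normal_moment k.+1 l).
Proof.
pose f (l y : R) := y ^+ k * expR (l * y).
have der (x y : R) : is_derive x 1 (f ^~ y) (y ^+ k.+1 * expR (x * y)).
  rewrite /f.
  have E : is_derive x 1 (fun x : R => x * y) y.
    by apply: is_derive_eq; rewrite scaler0 add0r /GRing.scale/= mulr1.
  apply: is_derive_eq.
  rewrite /GRing.scale/= exprS; ring.
have dE x y : partial1of2 f x y = y ^+ k.+1 * expR (x * y).
  by rewrite partial1of2E; apply: derive_val.
pose c := `|l| + 1 + 1.
have Il : l \in `]l - 1, l + 1[ by rewrite in_itv/=; apply/andP; split; lra.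
have bd x y : x \in `]l - 1, l + 1[ -> setT y -> `|partial1of2 f x y| <= k.+1`!%:R * (expR (c * y) + expR (- c * y)).
  rewrite in_itv/= => /andP[x1 x2] _; rewrite dE; apply: polyexp_bound.
  rewrite /c lerD2r; have := ler_normD l (x - l); rewrite addrC subrK => /le_trans; apply.
  rewrite lerD2l ler_norml; apply/andP; split; lra.
have D1 : derivable (normal_moment k) l 1.
  apply: (derivable_under_integral _ Il _ _ _ (integrable_polyexp_bound k.+1`!%:R c) bd) => //.
  by move=> x _; exact: integrable_polyexp.
have D2 : (normal_moment k)^`()%classic l = normal_moment k.+1 l.
  rewrite (differentiation_under_integral _ Il _ _ _ (integrable_polyexp_bound k.+1`!%:R c) bd) //.
  - by rewrite /normal_moment; apply: eq_Rintegral => y _; rewrite dE.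
  - by move=> x _; exact: integrable_polyexp.
by apply: DeriveDef; [exact: D1 | rewrite -derive1E; exact: D2].
Qed.

Lemma normal_mgf0 (l : R) : normal_moment 0 l = expR (l ^+ 2 * s ^+ 2 / 2).
Proof.
rewrite /normal_moment /Rintegral; under eq_integral do rewrite expr0 mul1r.
by rewrite normal_mgfE.
Qed.

Lemma normal_mgf1 (l : R) : normal_moment 1 l = l * s ^+ 2 * expR (l ^+ 2 * s ^+ 2 / 2).
Proof.
have <- : (normal_moment 0)^`()%classic l = normal_moment 1 l.
  by rewrite derive1E; apply: derive_val; exact: is_derive_normal_moment.
rewrite (_ : normal_moment 0 = (fun l => expR (l ^+ 2 * s ^+ 2 / 2))); last first.
  by apply/funext => x; rewrite normal_mgf0.
rewrite derive1E; apply: derive_val; apply: is_derive_eq.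
rewrite /GRing.scale/=. by field.
Qed.

Lemma normal_mgf2 (l : R) :
  normal_moment 2 l = (s ^+ 2 + l ^+ 2 * s ^+ 4) * expR (l ^+ 2 * s ^+ 2 / 2).
Proof.
have <- : (normal_moment 1)^`()%classic l = normal_moment 2 l.
  by rewrite derive1E; apply: derive_val; exact: is_derive_normal_moment.
rewrite (_ : normal_moment 1 = (fun l => l * s ^+ 2 * expR (l ^+ 2 * s ^+ 2 / 2))); last first.
  by apply/funext => x; rewrite normal_mgf1.
rewrite derive1E; apply: derive_val; apply: is_derive_eq.
rewrite /GRing.scale/=. by field.
Qed.

End gauss_moments.

(** * Independence and conditioning on a sub-sigma-algebra *)

Section wrt.
Context {R : realType} {d : measure_display} {T : measurableType d}.
Context (P : probability T R) (G : set_system T).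
Hypothesis sG : sigma_algebra setT G.
Hypothesis subG : G `<=` measurable.

(** The retyped domain gives access to the closure properties of measurable
    functions. *)
Lemma measurable_wrtP (Z : T -> R) : measurable_wrt G Z <->
  measurable_fun setT (Z : g_sigma_algebraType G -> R).
Proof.
split=> [mZ _ A mA|mZ A mA].
  by rewrite setTI /measurable/= sigma_algebra_id//; exact: mZ.
by have := mZ measurableT A mA; rewrite setTI /measurable/= sigma_algebra_id.
Qed.

Lemma measurable_wrtW (Z : T -> R) : measurable_wrt G Z -> measurable_fun setT Z.
Proof. by move=> mZ _ A mA; rewrite setTI; apply/subG/mZ. Qed.

Lemma measurable_id_wrt : measurable_fun setT (fun w : T => (w : g_sigma_algebraType G)).
Proof.
move=> _ A; rewrite setTI /measurable/= sigma_algebra_id// => /subG.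
by rewrite preimage_id.
Qed.

Local Open Scope ereal_scope.

(** Independence means that the joint law of [w], seen in the sigma-algebra [G],
    and of [W] is the product of [P] and [Q]; Tonelli does the rest. *)
Lemma freezing (W : T -> R) (Q : probability (measurableTypeR R) R)
  (f : (g_sigma_algebraType G * measurableTypeR R)%type -> \bar R) :
  measurable_fun setT W ->
  (forall A E, G A -> measurable E -> P (A `&` W @^-1` E) = P A * Q E) ->
  measurable_fun setT f -> (forall x, 0 <= f x) ->
  \int[P]_w f (w, W w) = \int[P]_w \int[Q]_y f (w, y).
Proof.
move=> mW PQ mf f0.
pose TG := g_sigma_algebraType G.
pose idX := isMeasurableFun.Build _ _ _ _ _ measurable_id_wrt.
pose idP : {mfun T >-> TG} := HB.pack (fun w : T => w : TG) idX.
have mphi : measurable_fun setT (fun w : T => (idP w, W w : measurableTypeR R)).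
  by apply/measurable_fun_pairP; split => //; exact: measurable_id_wrt.
pose phiX := isMeasurableFun.Build _ _ _ _ _ mphi.
pose phi : {mfun T >-> (TG * measurableTypeR R)%type} := HB.pack (fun w : T => (idP w, W w : measurableTypeR R)) phiX.
have E X : measurable X -> (distribution P idP \x Q) X = distribution P phi X.
  apply: product_measure_unique => A B mA mB.
  rewrite /distribution /pushforward -PQ//=.
  by move: mA; rewrite /measurable/= sigma_algebra_id.
transitivity (\int[distribution P phi]_z f z).
  by rewrite ge0_integral_distribution.
transitivity (\int[distribution P idP \x Q]_z f z).
  by apply: eq_measure_integral => A mA _; exact/esym/E.
rewrite fubini_tonelli1//.
rewrite ge0_integral_distribution//; first exact: measurable_fun_fubini_tonelli_F.
by move=> w; rewrite integral_ge0.
Qed.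

(** The cross term vanishes after conditioning on [G]; the inequality is one of
    extended reals, and both sides may be infinite. *)
Lemma sqr_freezing (W M c : T -> R) (xi : R -> R) (Q : probability (measurableTypeR R) R) (v : R) :
  measurable_fun setT W ->
  (forall A E, G A -> measurable E -> P (A `&` W @^-1` E) = P A * Q E) ->
  measurable_wrt G M -> measurable_wrt G c ->
  measurable_fun setT xi ->
  Q.-integrable setT (EFin \o xi) ->
  \int[Q]_y (xi y)%:E = 0 -> \int[Q]_y ((xi y) ^+ 2)%:E <= v%:E ->
  \int[P]_w ((M w + c w * xi (W w)) ^+ 2)%:E <= \int[P]_w ((M w ^+ 2 + c w ^+ 2 * v)%:E).
Proof.
move=> mW PQ /measurable_wrtP mM /measurable_wrtP mc mxi ixi xi1 xi2.
have mM' : measurable_fun setT M by apply: measurable_wrtW; apply/measurable_wrtP.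
have mc' : measurable_fun setT c by apply: measurable_wrtW; apply/measurable_wrtP.
pose f (z : (g_sigma_algebraType G * measurableTypeR R)%type) := ((M z.1 + c z.1 * xi z.2) ^+ 2)%:E.
have v0 : (0 <= v)%R.
  rewrite -lee_fin; apply: le_trans xi2; apply: integral_ge0 => y _.
  by rewrite lee_fin sqr_ge0.
have mf : measurable_fun setT f.
  apply/measurable_EFinP; apply: measurable_funX; apply: measurable_funD.
    by apply: measurableT_comp.
  by apply: measurable_funM; apply: measurableT_comp.
have f0 z : 0 <= f z by rewrite lee_fin sqr_ge0.
rewrite (freezing (f := f) mW PQ)//.
- have ixi2 : Q.-integrable setT (fun y => ((xi y) ^+ 2)%:E).
    apply/integrableP; split.
      by apply/measurable_EFinP; apply: measurable_funX.
    under eq_integral do rewrite /= ger0_norm ?sqr_ge0//.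
    by apply: le_lt_trans xi2 _; rewrite ltry.
  apply: ge0_le_integral => //.
  + by move=> w _; apply: integral_ge0 => y _; rewrite lee_fin sqr_ge0.
  + have mF : measurable_fun setT (fun w : g_sigma_algebraType G => \int[Q]_y f (w, y)).
      exact: measurable_fun_fubini_tonelli_F.
    exact: (measurableT_comp mF measurable_id_wrt).
  + apply/measurable_EFinP; apply: measurable_funD; first exact: measurable_funX.
    by apply: measurable_funM => //; exact: measurable_funX.
  + move=> w _.
    rewrite [leLHS](_ : _ = \int[Q]_y (((M w ^+ 2)%:E + (2 * M w * c w)%:E * (xi y)%:E) +
       (c w ^+ 2)%:E * ((xi y) ^+ 2)%:E)); last first.
      by apply: eq_integral => y _; rewrite /f/= -!EFinM -!EFinD; congr (_%:E); ring.
    rewrite integralD//=; last 2 first.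
      apply: integrableD => //.
        by apply: finite_measure_integrable_cst.
      exact: integrableZl.
      exact: integrableZl.
    rewrite integralD//=; last 2 first.
        by apply: finite_measure_integrable_cst.
      exact: integrableZl.
    rewrite integralZl// integralZl// xi1 mule0 adde0 integral_cst//=.
    rewrite probability_setT mule1 EFinD leeD2l// (EFinM _ v).
    by rewrite lee_wpmul2l// lee_fin sqr_ge0.
Qed.

End wrt.

(** * Sets of small outer probability *)

Section small.
Context {R : realType} {d : measure_display} {T : measurableType d}.
Context (P : probability T R).

(** Outer probability at most [r].  Events that involve a continuum of times are
    covered by measurable ones, so their measurability is never an issue. *)
Definition small (A : set T) (r : R) : Prop :=
  exists B, [/\ measurable B, A `<=` B & (P B <= r%:E)%E].

Lemma small_sub A B r : A `<=` B -> small B r -> small A r.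
Proof. by move=> AB [C [mC BC PC]]; exists C; split => // w /AB /BC. Qed.

Lemma small_le A r s : r <= s -> small A r -> small A s.
Proof. by move=> rs [C [mC AC PC]]; exists C; split => //; rewrite (le_trans PC)// lee_fin. Qed.

Lemma smallU A B r s : small A r -> small B s -> small (A `|` B) (r + s).
Proof.
move=> [C [mC AC PC]] [D [mD BD PD]]; exists (C `|` D); split.
- exact: measurableU.
- by apply: setUSS.
- by rewrite (le_trans (measureU2 _ _ _))// EFinD leeD.
Qed.

Lemma small0 r : 0 <= r -> small set0 r.
Proof. by move=> r0; exists set0; split => //; rewrite measure0 lee_fin. Qed.

Lemma small_finite (A : nat -> set T) (n : nat) r :
  (forall k, (k < n)%N -> small (A k) r) ->
  small [set w | exists2 k, (k < n)%N & A k w] (n%:R * r).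
Proof.
elim: n => [|n IH] h.
  by rewrite mul0r; apply: small_sub (small0 (lexx 0)) => w [].
rewrite mulrSr mulrDl mul1r.
apply: small_sub (smallU (IH _) (h n (ltnSn n))); last first.
  by move=> k kn; apply: h; rewrite ltnS ltnW.
move=> w [k]; rewrite ltnS leq_eqVlt => /orP[/eqP->|kn] Ak; first by right.
by left; exists k.
Qed.

Lemma smallE A r : measurable A -> small A r <-> (P A <= r%:E)%E.
Proof.
move=> mA; split=> [[B [mB AB PB]]|PA]; last by exists A; split.
by rewrite (le_trans _ PB)// le_measure// inE.
Qed.

Lemma small_negligible A : (forall r, 0 < r -> small A r) -> P.-negligible A.
Proof.
move=> h.
have /choice[B hB] : forall n : nat, exists B, [/\ measurable B, A `<=` B & (P B <= (n.+1%:R^-1)%:E)%E].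
  by move=> n; apply: h; rewrite invr_gt0.
exists (\bigcap_n B n); split.
- by apply: bigcap_measurable => // n _; have [] := hB n.
- apply/eqP; rewrite -measure_le0; apply/lee_addgt0Pr => e e0; rewrite add0e.
  have [n hn] := ltr_add_invr e0.
  have [mB _ PB] := hB n.
  apply: (@le_trans _ _ (P (B n))).
    apply: le_measure; rewrite ?inE//.
    + by apply: bigcap_measurable => // k _; have [] := hB k.
    + exact: bigcap_inf.
  by rewrite (le_trans PB)// lee_fin ltW// -[ltLHS]add0r.
- by move=> w Aw n _; have [_ AB _] := hB n; exact: AB.
Qed.

Lemma negligible_small A r : 0 <= r -> P.-negligible A -> small A r.
Proof. by move=> r0 [B [mB PB AB]]; exists B; split => //; rewrite PB lee_fin. Qed.

Lemma cvg0_small (A : nat -> set T) r : 0 < r ->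
  (forall n, measurable (A n)) ->
  P (A n) @[n --> \oo] --> 0%E ->
  exists N, forall n, (N <= n)%N -> small (A n) r.
Proof.
move=> r0 mA /fine_cvgP[hf /cvgrPdist_lt/(_ _ r0)].
move=> [N1 _ hN1]; have [N2 _ hN2] := hf.
exists (maxn N1 N2) => n; rewrite geq_max => /andP[n1 n2].
apply/smallE => //; have := hN1 n n1; rewrite /= sub0r normrN ger0_norm ?fine_ge0//.
by move=> /ltW; rewrite -lee_fin fineK//; exact: hN2.
Qed.

Lemma small_decreasing (A : nat -> set T) r : 0 < r ->
  (forall n, measurable (A n)) -> (forall n, A n.+1 `<=` A n) ->
  (forall w, ~ (forall n, A n w)) ->
  exists n, small (A n) r.
Proof.
move=> r0 mA dA A0.
have : P (A n) @[n --> \oo] --> P (\bigcap_n A n).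
  apply: nonincreasing_cvg_mu => //.
  - by rewrite (le_lt_trans (probability_le1 _ _))// ltry.
  - by apply: bigcap_measurable => // k _; exact: mA.
  - by apply/nonincreasing_seqP => n; apply/subsetPset/dA.
rewrite (_ : \bigcap_n _ = set0) ?measure0; last first.
  by apply/seteqP; split => // w h; case: (A0 w) => n; exact: h.
move=> /(cvg0_small r0 mA)[N hN]; exists N; exact: hN.
Qed.

Lemma chebyshev_sqr (Z : T -> R) (a e : R) : measurable_fun setT Z -> 0 < e ->
  (\int[P]_w ((Z w) ^+ 2)%:E <= a%:E)%E ->
  small [set w | e <= `|Z w|] (a / e ^+ 2).
Proof.
move=> mZ e0 h.
have mA : measurable [set w | e <= `|Z w|].
  rewrite -[X in measurable X]setTI.
  have mb : measurable_fun setT (fun w => e <= `|Z w|).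
    by apply: measurable_fun_ler => //; exact: measurableT_comp.
  exact: (mb measurableT [set true]).
apply/smallE => //.
rewrite EFinM -lee_pdivrMr ?invr_gt0 ?exprn_gt0// invrK muleC.
apply: le_trans h.
rewrite -[X in P X]setIT -integral_indic// -ge0_integralZl//; last 2 first.
- by apply/measurable_EFinP; exact: measurable_indic.
- by rewrite lee_fin sqr_ge0.
apply: ge0_le_integral => //.
- by move=> w _; rewrite mule_ge0// lee_fin sqr_ge0.
- by apply: measurable_funeM; apply/measurable_EFinP; exact: measurable_indic.
- by apply/measurable_EFinP; exact: measurable_funX.
- move=> w _; rewrite indicE; have [|_] := boolP (_ \in _); last first.
    by rewrite mule0 lee_fin sqr_ge0.
  rewrite inE/= mule1 lee_fin => h.
  by rewrite -[leRHS]real_normK ?num_real// ler_pXn2r ?nnegrE// ltW.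
Qed.

End small.

Section wrt_closure.
Context {R : realType} {d : measure_display} {T : measurableType d}.
Context (G : set_system T).
Hypothesis sG : sigma_algebra setT G.
Implicit Types Z : T -> R.

Lemma measurable_wrt_cst (a : R) : measurable_wrt G (fun _ => a).
Proof. by apply/(measurable_wrtP sG). Qed.

Lemma measurable_wrtD Z1 Z2 : measurable_wrt G Z1 -> measurable_wrt G Z2 ->
  measurable_wrt G (fun w => Z1 w + Z2 w).
Proof. by move=> /(measurable_wrtP sG) h1 /(measurable_wrtP sG) h2; apply/(measurable_wrtP sG); exact: measurable_funD. Qed.

Lemma measurable_wrtB Z1 Z2 : measurable_wrt G Z1 -> measurable_wrt G Z2 ->
  measurable_wrt G (fun w => Z1 w - Z2 w).
Proof. by move=> /(measurable_wrtP sG) h1 /(measurable_wrtP sG) h2; apply/(measurable_wrtP sG); exact: measurable_funB. Qed.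

Lemma measurable_wrtM Z1 Z2 : measurable_wrt G Z1 -> measurable_wrt G Z2 ->
  measurable_wrt G (fun w => Z1 w * Z2 w).
Proof. by move=> /(measurable_wrtP sG) h1 /(measurable_wrtP sG) h2; apply/(measurable_wrtP sG); exact: measurable_funM. Qed.

Lemma measurable_wrt_comp (f : R -> R) Z : measurable_fun setT f -> measurable_wrt G Z ->
  measurable_wrt G (fun w => f (Z w)).
Proof. by move=> mf /(measurable_wrtP sG) h1; apply/(measurable_wrtP sG); exact: measurableT_comp. Qed.

Lemma measurable_wrt_sum I (s : seq I) (Z : I -> T -> R) : (forall i, measurable_wrt G (Z i)) ->
  measurable_wrt G (fun w => \sum_(i <- s) Z i w).
Proof.
move=> h; apply/(measurable_wrtP sG); apply: measurable_sum => i.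
by apply/measurable_wrtP.
Qed.

Lemma measurable_wrt_if (b : T -> bool) Z1 Z2 :
  measurable_fun setT (b : g_sigma_algebraType G -> bool) ->
  measurable_wrt G Z1 -> measurable_wrt G Z2 ->
  measurable_wrt G (fun w => if b w then Z1 w else Z2 w).
Proof. by move=> mb /(measurable_wrtP sG) h1 /(measurable_wrtP sG) h2; apply/(measurable_wrtP sG); exact: measurable_fun_ifT. Qed.

Lemma measurable_wrt_ler Z1 Z2 : measurable_wrt G Z1 -> measurable_wrt G Z2 ->
  measurable_fun setT ((fun w => Z1 w <= Z2 w) : g_sigma_algebraType G -> bool).
Proof. by move=> /(measurable_wrtP sG) h1 /(measurable_wrtP sG) h2; exact: measurable_fun_ler. Qed.

Lemma measurable_wrt_ltr Z1 Z2 : measurable_wrt G Z1 -> measurable_wrt G Z2 ->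
  measurable_fun setT ((fun w => Z1 w < Z2 w) : g_sigma_algebraType G -> bool).
Proof. by move=> /(measurable_wrtP sG) h1 /(measurable_wrtP sG) h2; exact: measurable_fun_ltr. Qed.

End wrt_closure.

(** * A maximal inequality for discrete stochastic integrals *)

Section lenglart.
Context {R : realType} {d : measure_display} {T : measurableType d}.
Context (P : probability T R) (F : R -> set_system T).
Hypothesis hF : filtration F.

Lemma filtration_sigma t : 0 <= t -> sigma_algebra setT (F t).
Proof. by have [h _ _] := hF; exact: h. Qed.

Lemma measurable_wrt_le s t (Z : T -> R) : 0 <= s -> s <= t ->
  measurable_wrt (F s) Z -> measurable_wrt (F t) Z.
Proof. by have [_ _ h] := hF => s0 st mZ A mA; apply: (h s t) => //; exact: mZ. Qed.

Lemma measurable_wrt_fun t (Z : T -> R) : 0 <= t ->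
  measurable_wrt (F t) Z -> measurable_fun setT Z.
Proof. by have [_ h _] := hF => t0 /measurable_wrtW; apply; exact: h. Qed.

Variable V : process R T.
Hypothesis hV : brownian_motion P F V.

Section noise.
Variables (n : nat) (u : nat -> R) (c : nat -> T -> R) (xi : nat -> R -> R) (v : nat -> R).
Hypothesis hu0 : 0 <= u 0.
Hypothesis hu : forall i, (i < n)%N -> u i < u i.+1.
Hypothesis hc : forall i, (i < n)%N -> measurable_wrt (F (u i)) (c i).
Hypothesis mxi : forall i, (i < n)%N -> measurable_fun setT (xi i).
Hypothesis ixi : forall i, (i < n)%N ->
  (normal_prob 0 (Num.sqrt (u i.+1 - u i))).-integrable setT (EFin \o xi i).
Hypothesis xi1 : forall i, (i < n)%N ->
  (\int[normal_prob 0 (Num.sqrt (u i.+1 - u i))]_y (xi i y)%:E = 0)%E.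
Hypothesis xi2 : forall i, (i < n)%N ->
  (\int[normal_prob 0 (Num.sqrt (u i.+1 - u i))]_y (xi i y ^+ 2)%:E <= (v i)%:E)%E.

Let W i : T -> R := increment V (u i) (u i.+1).

Definition noise_sum (c : nat -> T -> R) k w : R := \sum_(i < k) c i w * xi i (W i w).

Lemma grid_ge0 i : (i <= n)%N -> 0 <= u i.
Proof.
elim: i => // i IH i_n; apply: (le_trans (IH (ltnW i_n))).
exact/ltW/hu.
Qed.

Lemma grid_le i j : (i <= j)%N -> (j <= n)%N -> u i <= u j.
Proof.
elim: j => [|j IH]; first by rewrite leqn0 => /eqP->.
rewrite leq_eqVlt => /orP[/eqP->//|ij] jn.
by apply: (le_trans (IH ij (ltnW jn))); exact/ltW/hu.
Qed.

Let mW i : (i < n)%N -> measurable_wrt (F (u i.+1)) (W i).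
Proof.
move=> i_n; have [aV _ _ _ _] := hV.
have h0 := grid_ge0 (ltnW i_n); have h1 := grid_ge0 i_n.
apply: (measurable_wrtB (filtration_sigma h1)); first exact: aV.
by apply: (measurable_wrt_le h0 (ltW (hu i_n))); exact: aV.
Qed.

Let W_indep i : (i < n)%N -> forall A E, F (u i) A -> measurable E ->
  (P (A `&` W i @^-1` E) = P A * normal_prob 0 (Num.sqrt (u i.+1 - u i)) E)%E.
Proof.
move=> i_n A E FA mE; have [_ _ _ hI hN] := hV.
by rewrite hI// ?grid_ge0 ?hu ?(ltnW i_n)// hN ?grid_ge0 ?hu ?(ltnW i_n).
Qed.

Lemma measurable_noise_sum (c' : nat -> T -> R) k :
  (forall i, (i < n)%N -> measurable_wrt (F (u i)) (c' i)) ->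
  (k <= n)%N -> measurable_wrt (F (u k)) (noise_sum c' k).
Proof.
move=> hc'; elim: k => [|k IH] kn.
  rewrite /noise_sum; under eq_fun do rewrite big_ord0.
  exact: (measurable_wrt_cst (filtration_sigma hu0)).
have h0 := grid_ge0 (ltnW kn); have h1 := grid_ge0 kn.
rewrite /noise_sum; under eq_fun do rewrite big_ord_recr/=.
apply: (measurable_wrtD (filtration_sigma h1)).
  by apply: (measurable_wrt_le h0 (ltW (hu kn))); apply: IH; exact: ltnW.
apply: (measurable_wrtM (filtration_sigma h1)).
  by apply: (measurable_wrt_le h0 (ltW (hu kn))); exact: hc'.
apply: (measurable_wrt_comp (filtration_sigma h1)); [exact: mxi|exact: mW].
Qed.

Lemma noise_var_ge0 i : (i < n)%N -> 0 <= v i.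
Proof.
move=> i_n; rewrite -lee_fin; apply: le_trans (xi2 i_n).
by apply: integral_ge0 => y _; rewrite lee_fin sqr_ge0.
Qed.

(** Orthogonality of the summands, by induction on their number. *)
Lemma noise_sum_L2 (c' : nat -> T -> R) k :
  (forall i, (i < n)%N -> measurable_wrt (F (u i)) (c' i)) ->
  (k <= n)%N ->
  (\int[P]_w ((noise_sum c' k w) ^+ 2)%:E <=
   \int[P]_w (\sum_(i < k) c' i w ^+ 2 * v i)%:E)%E.
Proof.
move=> hc'; elim: k => [|k IH] kn.
  under eq_integral do rewrite /noise_sum big_ord0 expr0n.
  by under [leRHS]eq_integral do rewrite big_ord0.
have h0 := grid_ge0 (ltnW kn).
have [_ hFm _] := hF.
have mN := measurable_noise_sum hc' (ltnW kn).
have mc' := hc' _ kn.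
have mN' := measurable_wrt_fun h0 mN.
have mc'' := measurable_wrt_fun h0 mc'.
have vk := noise_var_ge0 kn.
under eq_integral do rewrite /noise_sum big_ord_recr/=.
apply: (le_trans (sqr_freezing (filtration_sigma h0) (hFm _ h0)
  (measurable_wrt_fun (grid_ge0 kn) (mW kn)) (W_indep kn) mN mc' (mxi kn) (ixi kn) (xi1 kn) (xi2 kn))).
have mS : measurable_fun setT (fun w => \sum_(i < k) c' i w ^+ 2 * v i).
  apply: measurable_sum => i; apply: measurable_funM => //; apply: measurable_funX.
  have ik : (i < n)%N by apply: ltn_trans (ltn_ord i) kn.
  exact: (measurable_wrt_fun (grid_ge0 (ltnW ik)) (hc' _ ik)).
have S0 w : 0 <= \sum_(i < k) c' i w ^+ 2 * v i.
  apply: sumr_ge0 => i _; rewrite mulr_ge0 ?sqr_ge0// noise_var_ge0//.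
  by apply: ltn_trans (ltn_ord i) kn.
under eq_integral do rewrite EFinD.
under [leRHS]eq_integral do rewrite big_ord_recr/= EFinD.
rewrite ge0_integralD//; last 4 first.
- by move=> w _; rewrite lee_fin sqr_ge0.
- by apply/measurable_EFinP; exact: measurable_funX.
- by move=> w _; rewrite lee_fin mulr_ge0 ?sqr_ge0.
- by apply/measurable_EFinP; apply: measurable_funM => //; exact: measurable_funX.
rewrite ge0_integralD//; last 4 first.
- by move=> w _; rewrite lee_fin.
- by apply/measurable_EFinP.
- by move=> w _; rewrite lee_fin mulr_ge0 ?sqr_ge0.
- by apply/measurable_EFinP; apply: measurable_funM => //; exact: measurable_funX.
by rewrite leeD2r// IH// ltnW.
Qed.

(** A Lenglart inequality.  The coefficients are switched off as soon as the
    accumulated variance would exceed [delta] or the sum has reached [e]; this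
    decision is known at the start of each step.  The stopped sum has second
    moment at most [delta], and on the event considered it keeps the value at
    which [e] was first reached, so Chebyshev at the last time controls the
    maximum. *)
Lemma lenglart (delta e : R) : 0 <= delta -> 0 < e ->
  small P [set w | \sum_(i < n) c i w ^+ 2 * v i <= delta /\
                   exists2 k, (k <= n)%N & e <= `|noise_sum c k w|] (delta / e ^+ 2).
Proof.
move=> d0 e0.
(* The variance includes the step to come, whose coefficient is already known. *)
pose act i w := (\sum_(j < i.+1) c j w ^+ 2 * v j <= delta) &&
  all (fun j => `|noise_sum c j w| < e) (iota 0 i.+1).
pose c' i w := if act i w then c i w else 0.
have mc' i : (i < n)%N -> measurable_wrt (F (u i)) (c' i).
  move=> i_n; have h0 := grid_ge0 (ltnW i_n).
  have sg := filtration_sigma h0.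
  apply: (measurable_wrt_if sg); last 2 first.
  - exact: hc.
  - exact: (measurable_wrt_cst sg).
  apply: measurable_and.
    apply: (measurable_wrt_ler sg); last exact: (measurable_wrt_cst sg).
    apply: (measurable_wrt_sum sg) => j.
    apply: (measurable_wrtM sg); last exact: (measurable_wrt_cst sg).
    have ji : (j <= i)%N by rewrite -ltnS.
    have jn : (j < n)%N by exact: leq_ltn_trans ji i_n.
    apply: (measurable_wrt_comp sg (f := fun x => x ^+ 2)); first exact: exprn_measurable.
    by apply: (measurable_wrt_le (grid_ge0 (ltnW jn)) (grid_le ji (ltnW i_n))); exact: hc.
  have : all (fun j => j <= i)%N (iota 0 i.+1).
    by apply/allP => j; rewrite mem_iota ltnS.
  elim: (iota 0 i.+1) => [|j s IH] /=; first by move=> _; exact: measurable_cst.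
  move=> /andP[ji hs]; apply: measurable_and; last exact: IH.
  have jn : (j < n)%N by exact: leq_ltn_trans ji i_n.
  apply: (measurable_wrt_ltr sg); last exact: (measurable_wrt_cst sg).
  apply: (measurable_wrt_comp sg (f := fun x => `|x|)); first exact: normr_measurable.
  apply: (measurable_wrt_le (grid_ge0 (ltnW jn)) (grid_le ji (ltnW i_n))).
  by apply: measurable_noise_sum => //; exact: ltnW.
have S' k w : (k <= n)%N -> \sum_(i < k) c' i w ^+ 2 * v i <= delta.
  elim: k => [|k IH] kn; first by rewrite big_ord0.
  rewrite big_ord_recr/= {2}/c'; case: ifPn => [/andP[h _]|_]; last first.
    by rewrite expr0n mul0r addr0 IH// ltnW.
  apply: le_trans h; rewrite [leRHS]big_ord_recr/= lerD2r.
  apply: ler_sum => i _; rewrite ler_wpM2r ?noise_var_ge0//.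
    exact: ltn_trans (ltn_ord i) kn.
  by rewrite /c'; case: ifP => // _; rewrite expr0n sqr_ge0.
have L2 : (\int[P]_w ((noise_sum c' n w) ^+ 2)%:E <= delta%:E)%E.
  apply: le_trans (noise_sum_L2 mc' (leqnn n)) _.
  rewrite -[leRHS]mule1 -(@probability_setT _ _ _ P) -integral_cst//.
  apply: ge0_le_integral => //.
  - move=> w _; rewrite lee_fin; apply: sumr_ge0 => i _.
    by rewrite mulr_ge0 ?sqr_ge0 ?noise_var_ge0.
  - apply/measurable_EFinP; apply: measurable_sum => i; apply: measurable_funM => //.
    apply: measurable_funX.
    exact: (measurable_wrt_fun (grid_ge0 (ltnW (ltn_ord i))) (mc' _ (ltn_ord i))).
  - by move=> w _; rewrite lee_fin S'.
apply: small_sub (chebyshev_sqr _ e0 L2); last first.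
  exact: (measurable_wrt_fun (grid_ge0 (leqnn n)) (measurable_noise_sum mc' (leqnn n))).
move=> w /= [Sd hk].
have /ex_minnP[k /andP[kn ek] kmin] : exists k, (k <= n)%N && (e <= `|noise_sum c k w|).
  by have [k kn ek] := hk; exists k; rewrite kn.
have E1 j : (j <= k)%N -> noise_sum c' j w = noise_sum c j w.
  move=> jk; rewrite /noise_sum; apply: eq_bigr => i _; rewrite /c' ifT//.
  have ik : (i < k)%N by exact: leq_trans (ltn_ord i) jk.
  have i_n : (i < n)%N by exact: leq_trans ik kn.
  apply/andP; split.
    apply: le_trans Sd; rewrite -(subnK i_n) addnC big_split_ord/= lerDl.
    apply: sumr_ge0 => l _; rewrite mulr_ge0 ?sqr_ge0// noise_var_ge0//.
    by rewrite -ltn_subRL ltn_ord.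
  apply/allP => l; rewrite mem_iota add0n ltnS => /andP[_ li].
  rewrite ltNge; apply/negP => el.
  have := kmin l; rewrite el (leq_trans li (ltnW i_n)) => /(_ isT).
  by rewrite leqNgt (leq_ltn_trans li ik).
have E2 j : (k <= j)%N -> noise_sum c' j w = noise_sum c k w.
  elim: j => [|j IH]; first by rewrite leqn0 => /eqP k0; rewrite -k0 E1.
  rewrite leq_eqVlt => /orP[/eqP <-|kj]; first by rewrite E1.
  rewrite /noise_sum big_ord_recr/= -/(noise_sum c' j w) IH// /c' ifF ?mul0r ?addr0//.
  apply/negP => /andP[_ /allP/(_ k)]; rewrite mem_iota /= add0n => /(_ kj).
  by rewrite ltNge ek.
by rewrite E2.
Qed.

End noise.
End lenglart.

(** * Continuous adapted paths *)

Lemma half_slack (R : realType) (q a1 a2 a3 a4 a5 : R) :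
  a1 < (q - a3) / 2 -> a2 < (q - a3) / 2 -> a4 <= a3 + a2 -> a5 <= a1 + a4 -> a5 < q.
Proof. lra. Qed.

Section paths.
Context {R : realType} {d : measure_display} {T : measurableType d}.
Context (P : probability T R) (F : R -> set_system T).
Hypothesis hF : filtration F.
Variable H : process R T.
Hypothesis aH : adapted F H.
Hypothesis cH : continuous_paths H.

Lemma path_eps w (u e : R) : 0 <= u -> 0 < e ->
  exists2 del, 0 < del & forall v, 0 <= v -> `|v - u| < del -> `|H v w - H u w| < e.
Proof.
move=> u0 e0; have h := (subspace_continuousP _ _).1 (@cH w).
have := h u; rewrite /= in_itv/= u0 => /(_ isT) /cvgrPdist_lt/(_ e e0).
rewrite near_withinE => /nbhs_ballP[del /= del0 hd].
exists del => // v v0 vu; rewrite distrC; apply: hd => /=; last by rewrite in_itv/= v0.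
by rewrite /ball/= distrC.
Qed.

Lemma path_unif w (t e : R) : 0 < e -> exists2 del, 0 < del &
  forall u v, 0 <= u <= t -> 0 <= v <= t -> `|u - v| < del -> `|H u w - H v w| < e.
Proof.
move=> e0.
have cpt : compact `[0, t] by exact: segment_compact.
move: cpt => /compact_near_coveringP /(_ _ (0^'+ : set_system R)
  (fun del u => forall v, 0 <= u <= t -> 0 <= v <= t -> `|u - v| < del -> `|H u w - H v w| < e)) /=.
move=> h.
have : \forall del \near 0^'+, forall u v, 0 <= u <= t -> 0 <= v <= t ->
    `|u - v| < del -> `|H u w - H v w| < e.
  have : \forall del \near 0^'+, `[0, t]
     `<=` (fun u : R => forall v : R, 0 <= u <= t -> 0 <= v <= t ->
        `|u - v| < del -> `|H u w - H v w| < e).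
    apply: h => x; rewrite in_itv/= => /andP[x0 xt].
    have e20 : 0 < e / 2 by rewrite divr_gt0.
    have [del del0 hd] := path_eps w x0 e20.
    have d20 : 0 < del / 2 by rewrite divr_gt0.
    near=> u dd => v /= /andP[u0 ut] /andP[v0 vt] uv.
    have ux : `|u - x| < del / 2.
      by rewrite distrC; near: u; exact: (nbhsx_ballx x _ d20).
    have dd2 : dd < del / 2 by near: dd; exact: nbhs_right_lt.
    have h1 : `|H u w - H x w| < e / 2 by apply: hd => //; apply: lt_trans ux _; lra.
    have h2 : `|H v w - H x w| < e / 2.
      apply: hd => //.
      have := ler_distD u v x; rewrite (distrC v u); lra.
    have := ler_distD (H x w) (H u w) (H v w); rewrite (distrC (H x w)); lra.
  move=> h2; near=> del => u v ut vt; apply: (near h2 del) => //.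
move=> hn; near (0 : R)^'+ => del; exists del.
  by near: del; exact: nbhs_right_gt.
by apply: (near hn del).
Unshelve. all: by end_near. Qed.

Lemma grid_approx (t u del : R) : 0 < t -> 0 <= u <= t -> 0 < del ->
  exists N0, forall N, (N0 <= N)%N -> exists2 k, (k <= N.+1)%N & `|k%:R * (t / N.+1%:R) - u| < del.
Proof.
move=> t0 /andP[u0 ut] d0.
exists (Num.trunc (t / del)) => N hN.
have N0 : 0 < N.+1%:R :> R by rewrite ltr0n.
have tN : t / N.+1%:R < del.
  rewrite ltr_pdivrMr// mulrC -ltr_pdivrMr//.
  apply: lt_le_trans (truncnS_gt _) _.
  by rewrite ler_nat ltnS.
have q0 : 0 < t / N.+1%:R by rewrite divr_gt0.
pose q := t / N.+1%:R.
have uq : 0 <= u / q by rewrite divr_ge0// ltW.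
have /andP[k1 k2] := truncn_itv uq.
exists (Num.trunc (u / q)).
  rewrite -(ler_nat R); apply: le_trans k1 _.
  by rewrite ler_pdivrMr// /q mulrC mulfVK ?gt_eqF.
rewrite -/q ltr_norml; apply/andP; split.
  by move: k2; rewrite ltr_pdivrMr// -natr1 mulrDl mul1r => k2; rewrite -/q in tN; lra.
move: k1; rewrite ler_pdivlMr// => k1; rewrite -/q in tN; lra.
Qed.

Lemma path_bounded w (t : R) : 0 <= t -> exists K, forall u, 0 <= u <= t -> `|H u w| <= K.
Proof.
move=> t0.
have sub : [set` `[0, t]] `<=` [set` `[0 : R, +oo[] by move=> u /=; rewrite !in_itv/= => /andP[-> _].
have cw : {within `[0, t], continuous (fun u => H u w)} by apply: continuous_subspaceW sub (@cH w).
have cN : {within `[0, t], continuous (fun u => `|H u w|)}.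
  by move=> x; apply: cvg_norm; exact: cw.
have [c _ hc] := EVT_max t0 cN.
by exists `|H c w| => u hu; apply: hc; rewrite in_itv.
Qed.

Let mH t : 0 <= t -> measurable_fun setT (H t).
Proof. by move=> t0; apply: (measurable_wrt_fun hF t0); exact: aH. Qed.

(** Every path is bounded on [[0, t]], so the events that the path exceeds [m] at
    some grid point decrease to the empty set; continuity extends the bound from
    the grid points to all times. *)
Lemma path_tight (t r : R) : 0 < t -> 0 < r ->
  exists2 K, 0 < K & small P [set w | exists2 u, 0 <= u <= t & K < `|H u w|] r.
Proof.
move=> t0 r0.
pose g N k : R := k%:R * (t / N.+1%:R).
have g0 N k : 0 <= g N k by rewrite mulr_ge0// divr_ge0// ltW.
pose A (m : nat) := \bigcup_N \bigcup_(k in [set k | (k <= N.+1)%N]) [set w | m%:R < `|H (g N k) w|].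
have mA m : measurable (A m).
  apply: bigcupT_measurable => N; apply: bigcup_measurable => k _.
  have mb : measurable_fun setT (fun w => m%:R < `|H (g N k) w|).
    by apply: measurable_fun_ltr => //; apply: measurableT_comp => //; exact: mH.
  by have := mb measurableT [set true] I; rewrite setTI.
have gt N k : (k <= N.+1)%N -> g N k <= t.
  by move=> kN; rewrite /g mulrA ler_pdivrMr ?ltr0n// mulrC ler_wpM2l ?(ltW t0)// ler_nat.
have [m hm] : exists m, small P (A m) r.
  apply: small_decreasing => //.
    move=> m w [N _ [k kN /= h]]; exists N => //; exists k => //=.
    by apply: lt_trans h; rewrite ltr_nat.
  move=> w hA; have [K hK] := path_bounded w (ltW t0).
  have [N _ [k kN /=]] := hA (Num.trunc K).+1.
  apply/negP; rewrite -leNgt; apply: le_trans (hK _ _) _; first by rewrite g0 gt.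
  exact/ltW/truncnS_gt.
exists m.+1%:R => //.
apply: small_sub hm => w [u hu Ku].
have [u0 ut] := andP hu.
have e0 : 0 < `|H u w| - m.+1%:R by rewrite subr_gt0.
have [del del0 hd] := path_eps w u0 e0.
have [N /(_ N (leqnn N))[k kN kd]] := grid_approx t0 hu del0.
exists N => //; exists k => //=.
have := hd (g N k) (g0 N k) kd.
have := ler_distD (H (g N k) w) (H u w) 0; rewrite !subr0 distrC.
have : (m%:R : R) < m.+1%:R by rewrite ltr_nat.
lra.
Qed.

(** As for [path_tight], with uniform continuity of each path in place of
    boundedness. *)
Lemma path_modulus (t e r : R) : 0 < t -> 0 < e -> 0 < r ->
  exists2 del, 0 < del & small P [set w | exists u v,
    [/\ 0 <= u <= t, 0 <= v <= t, `|u - v| < del & e < `|H u w - H v w|]] r.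
Proof.
move=> t0 e0 r0.
pose g N k : R := k%:R * (t / N.+1%:R).
have g0 N k : 0 <= g N k by rewrite mulr_ge0// divr_ge0// ltW.
pose A (m : nat) := \bigcup_N \bigcup_(k in [set k | (k <= N.+1)%N])
  \bigcup_(l in [set l | (l <= N.+1)%N /\ `|g N k - g N l| < m.+1%:R^-1]) [set w | e < `|H (g N k) w - H (g N l) w|].
have mA m : measurable (A m).
  apply: bigcupT_measurable => N; apply: bigcup_measurable => k _; apply: bigcup_measurable => l _.
  have mb : measurable_fun setT (fun w => e < `|H (g N k) w - H (g N l) w|).
    by apply: measurable_fun_ltr => //; apply: measurableT_comp => //; apply: measurable_funB; exact: mH.
  by have := mb measurableT [set true] I; rewrite setTI.
have gt N k : (k <= N.+1)%N -> g N k <= t.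
  by move=> kN; rewrite /g mulrA ler_pdivrMr ?ltr0n// mulrC ler_wpM2l ?(ltW t0)// ler_nat.
have [m hm] : exists m, small P (A m) r.
  apply: small_decreasing => //.
    move=> m w [N _ [k kN [l [lN lk] /= h]]]; exists N => //; exists k => //=; exists l => //=; split => //.
    by apply: lt_trans lk _; rewrite ltf_pV2 ?posrE// ltr_nat.
  move=> w hA; have [del del0 hd] := path_unif w t e0.
  have [N _ [k kN [l [lN lk] /= h]]] := hA (Num.trunc del^-1).
  have : `|H (g N k) w - H (g N l) w| < e.
    apply: hd; rewrite ?g0 ?gt//; apply: lt_trans lk _.
    rewrite -[ltRHS]invrK ltf_pV2 ?posrE ?invr_gt0//; exact: truncnS_gt.
  by move: h; lra.
exists m.+1%:R^-1 => //.
apply: small_sub hm => w [u [v [hu hv uv Huv]]].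
have [u0 ut] := andP hu; have [v0 vt] := andP hv.
have e1 : 0 < (`|H u w - H v w| - e) / 2 by rewrite divr_gt0// subr_gt0.
have [d1 d10 hd1] := path_eps w u0 e1.
have [d2 d20 hd2] := path_eps w v0 e1.
pose d3 := (m.+1%:R^-1 - `|u - v|) / 2.
have d30 : 0 < d3 by rewrite divr_gt0// subr_gt0.
pose dd := Num.min (Num.min d1 d2) d3.
have dd0 : 0 < dd by rewrite !lt_min d10 d20 d30.
have [N1 hN1] := grid_approx t0 hu dd0; have [N2 hN2] := grid_approx t0 hv dd0.
have [k kN] := hN1 _ (leq_maxl N1 N2); rewrite !lt_min => /andP[/andP[ku1 ku2] ku3].
have [l lN] := hN2 _ (leq_maxr N1 N2); rewrite !lt_min => /andP[/andP[lv1 lv2] lv3].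
rewrite -!/(g _ _) in ku1 ku2 ku3 lv1 lv2 lv3.
have h1 := hd1 _ (g0 _ _) ku1; have h2 := hd2 _ (g0 _ _) lv2.
exists (maxn N1 N2) => //; exists k => //; exists l.
  split => //.
  have := ler_distD u (g (maxn N1 N2) k) (g (maxn N1 N2) l).
  have := ler_distD v u (g (maxn N1 N2) l); rewrite (distrC v).
  exact: half_slack ku3 lv3.
rewrite /=.
have := ler_distD (H (g (maxn N1 N2) k) w) (H u w) (H v w); rewrite (distrC (H u w) (H (g _ _) w)).
have := ler_distD (H (g (maxn N1 N2) l) w) (H (g (maxn N1 N2) k) w) (H v w).
move: h1 h2; lra.
Qed.

End paths.

(** * Elementary processes and their integrals *)

Section grid.
Context {R : realType}.

(** A common refinement of finitely many times. *)
Lemma sorted_grid (pts : seq R) (s : R) : 0 <= s ->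
  (forall x, x \in pts -> 0 <= x <= s) ->
  exists (m : nat) (u : nat -> R), [/\ u 0 = 0, u m = s,
    forall i, (i < m)%N -> u i < u i.+1 &
    forall x, x \in pts -> exists2 i, (i <= m)%N & u i = x].
Proof.
move=> s0 hp.
pose p := sort <=%R (undup (0 :: s :: pts)).
have mp x : (x \in p) = (x \in 0 :: s :: pts) by rewrite mem_sort mem_undup.
have sp : sorted <%R p by rewrite sort_lt_sorted undup_uniq.
have bd x : x \in p -> 0 <= x <= s.
  rewrite mp !inE => /or3P[/eqP->|/eqP->|/hp//]; first by rewrite lexx.
  by rewrite s0 lexx.
pose u i := nth s p i.
have p0 : (0 < size p)%N.
  have h0 : 0 \in p by rewrite mp inE eqxx.
  by move: h0; case: (p).
have lt_u i j : (i < size p)%N -> (j < size p)%N -> (u i < u j) = (i < j)%N.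
  by move=> hi hj; rewrite /u (lt_sorted_ltn_nth s sp) ?inE.
have mem_u x : x \in p -> exists2 i, (i <= (size p).-1)%N & u i = x.
  move=> xp; exists (index x p); last by rewrite /u nth_index.
  by rewrite -ltnS prednK// index_mem.
exists (size p).-1, u; split.
- have [i hi ui] : exists2 i, (i <= (size p).-1)%N & u i = 0.
    by apply: mem_u; rewrite mp inE eqxx.
  apply/eqP; rewrite eq_le; apply/andP; split.
    rewrite -ui leNgt lt_u ?ltn0//; by rewrite -(prednK p0) ltnS.
  by have /bd/andP[] : u 0 \in p by apply: mem_nth.
- have [i hi ui] : exists2 i, (i <= (size p).-1)%N & u i = s.
    by apply: mem_u; rewrite mp !inE eqxx orbT.
  have pm : ((size p).-1 < size p)%N by rewrite prednK.
  apply/eqP; rewrite eq_le; apply/andP; split.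
    by have /bd/andP[] : u (size p).-1 \in p by apply: mem_nth.
  rewrite -ui leNgt lt_u// -?leqNgt//; by rewrite -(prednK p0) ltnS.
- move=> i hi; rewrite lt_u// -(prednK p0) ltnS//; exact: ltnW.
- by move=> x xp; apply: mem_u; rewrite mp !inE xp !orbT.
Qed.

(** When no grid interval contains [a] in its interior, [Num.min a (u j)] moves by
    whole grid steps. *)
Lemma gap_telescope (m : nat) (u : nat -> R) (a : R) (f : R -> R) j :
  u 0 = 0 -> (forall i, (i < m)%N -> u i < u i.+1) -> 0 <= a ->
  (forall i, (i < m)%N -> a < u i.+1 -> a <= u i) -> (j <= m)%N ->
  f (Num.min a (u j)) = f 0 + \sum_(i < j) (u i.+1 <= a)%R%:R * (f (u i.+1) - f (u i)).
Proof.
move=> u0 hu a0 ga; elim: j => [|j IH] jm; first by rewrite big_ord0 addr0 u0 min_r.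
rewrite big_ord_recr/= addrA -IH ?(ltnW jm)//.
have [h|h] := leP (u j.+1) a.
  rewrite min_r ?mul1r ?subrKC//.
  by apply: le_trans h; exact/ltW/hu.
by rewrite mul0r addr0 min_l//; exact: ga.
Qed.

End grid.

Section elementary.
Context {R : realType} {d : measure_display} {T : measurableType d}.
Context (P : probability T R) (F : R -> set_system T).
Hypothesis hF : filtration F.

(** The triple [(xi, a, b)] stands for the process [xi * 1_(]a, b])].  Lists of
    such terms with unrelated intervals are closed under sums, whereas step
    processes on a fixed partition are not. *)
Definition term : Type := ((T -> R) * R * R)%type.
Definition elem_eval (l : seq term) (s : R) (w : T) : R :=
  \sum_(x <- l) x.1.1 w * \1_(`]x.1.2, x.2]%classic) s.
Definition elem_int (l : seq term) (V : process R T) (t : R) (w : T) : R :=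
  \sum_(x <- l) x.1.1 w * (V (Num.min x.2 t) w - V (Num.min x.1.2 t) w).
Definition predictable_term (x : term) : Prop :=
  [/\ 0 <= x.1.2, x.1.2 <= x.2 & measurable_wrt (F x.1.2) x.1.1].

Lemma indic_itv_oc (a b v : R) : a <= b ->
  \1_(`]a, b]%classic) v = (v <= b)%R%:R - (v <= a)%R%:R :> R.
Proof.
move=> ab; rewrite indicE; have -> : (v \in `]a, b]%classic) = (a < v <= b).
  by apply/idP/idP; rewrite inE/= in_itv.
have [va|av] := leP v a; first by rewrite (le_trans va ab) subrr.
by rewrite subr0.
Qed.

Lemma measurable_elem_eval (l : seq term) (w : T) :
  measurable_fun setT (fun v : R => elem_eval l v w).
Proof. by apply: measurable_sum => x; apply: measurable_funM => //. Qed.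

Variables (m : nat) (u : nat -> R).
Hypothesis u0 : u 0 = 0.
Hypothesis hu : forall i, (i < m)%N -> u i < u i.+1.

(** If no end point of the list lies inside a grid interval, the integral becomes
    a sum of increments against coefficients known at the start of each step, to
    which [lenglart] applies. *)
Lemma elem_int_grid l V j w : (forall x, List.In x l -> predictable_term x) ->
  (forall x, List.In x l -> (forall i, (i < m)%N -> x.1.2 < u i.+1 -> x.1.2 <= u i) /\
                            (forall i, (i < m)%N -> x.2 < u i.+1 -> x.2 <= u i)) ->
  (j <= m)%N ->
  elem_int l V (u j) w = \sum_(i < j) elem_eval l (u i.+1) w * increment V (u i) (u i.+1) w.
Proof.
move=> ok gap jm; rewrite /elem_int /elem_eval.
elim: l ok gap => [|x l IH] ok gap.
  by rewrite big_nil big1// => i _; rewrite big_nil mul0r.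
rewrite big_cons IH; last 2 first.
- by move=> y yl; apply: ok; right.
- by move=> y yl; apply: gap; right.
under [RHS]eq_bigr do rewrite big_cons mulrDl.
rewrite [RHS]big_split/=; congr (_ + _).
have [a0 ab _] := ok x (or_introl erefl); have [ga gb] := gap x (or_introl erefl).
have b0 : 0 <= x.2 by exact: le_trans ab.
rewrite (gap_telescope (fun v => V v w) u0 hu a0 ga jm).
rewrite (gap_telescope (fun v => V v w) u0 hu b0 gb jm).
rewrite [X in _ * X](_ : _ = \sum_(i < j) ((u i.+1 <= x.2)%R%:R - (u i.+1 <= x.1.2)%R%:R) * (V (u i.+1) w - V (u i) w)); last first.
  by rewrite opprD addrACA subrr add0r -sumrB; apply: eq_bigr => i _; rewrite mulrBl.
by rewrite mulr_sumr; apply: eq_bigr => i _; rewrite indic_itv_oc// mulrA.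
Qed.

Lemma elem_eval_cst l i v w : (forall x, List.In x l -> predictable_term x) ->
  (forall x, List.In x l -> (forall i, (i < m)%N -> x.1.2 < u i.+1 -> x.1.2 <= u i) /\
                            (forall i, (i < m)%N -> x.2 < u i.+1 -> x.2 <= u i)) ->
  (i < m)%N -> u i < v -> v <= u i.+1 -> elem_eval l v w = elem_eval l (u i.+1) w.
Proof.
move=> ok gap im uv vu; rewrite /elem_eval; elim: l ok gap => [|x l IH] ok gap.
  by rewrite !big_nil.
rewrite !big_cons IH; last 2 first.
- by move=> y yl; apply: ok; right.
- by move=> y yl; apply: gap; right.
have [a0 ab _] := ok x (or_introl erefl); have [ga gb] := gap x (or_introl erefl).
have key a : (forall i, (i < m)%N -> a < u i.+1 -> a <= u i) -> (v <= a) = (u i.+1 <= a).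
  move=> g; apply/idP/idP => [va|]; last by exact: le_trans.
  rewrite leNgt; apply/negP => /(g i im) h; move: uv; rewrite ltNge.
  by rewrite (le_trans va h).
by rewrite !indic_itv_oc// (key _ ga) (key _ gb).
Qed.

Lemma measurable_elem_grid l i : (forall x, List.In x l -> predictable_term x) ->
  (forall x, List.In x l -> (forall i, (i < m)%N -> x.1.2 < u i.+1 -> x.1.2 <= u i) /\
                            (forall i, (i < m)%N -> x.2 < u i.+1 -> x.2 <= u i)) ->
  (i < m)%N -> measurable_wrt (F (u i)) (elem_eval l (u i.+1)).
Proof.
move=> ok gap im.
have ui0 : 0 <= u i by apply: (grid_ge0 _ hu) => //; [rewrite u0|exact: ltnW].
have sg := filtration_sigma hF ui0.
rewrite /elem_eval; elim: l ok gap => [|x l IH] ok gap.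
  by under eq_fun do rewrite big_nil; exact: (measurable_wrt_cst sg).
under eq_fun do rewrite big_cons; apply: (measurable_wrtD sg); last first.
  by apply: IH => y yl; [apply: ok; right|apply: gap; right].
have [a0 ab mx] := ok x (or_introl erefl); have [ga gb] := gap x (or_introl erefl).
have [h|h] := leP (u i.+1) x.1.2.
  rewrite indic_itv_oc// h (le_trans h ab) subrr.
  by under eq_fun do rewrite mulr0; exact: (measurable_wrt_cst sg).
apply: (measurable_wrtM sg); last exact: (measurable_wrt_cst sg).
by apply: (measurable_wrt_le hF a0 _ mx); exact: ga.
Qed.

Lemma integral_elem_grid l w j : (forall x, List.In x l -> predictable_term x) ->
  (forall x, List.In x l -> (forall i, (i < m)%N -> x.1.2 < u i.+1 -> x.1.2 <= u i) /\
                            (forall i, (i < m)%N -> x.2 < u i.+1 -> x.2 <= u i)) ->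
  (j <= m)%N ->
  (\int[lebesgue_measure]_(v in `[0%R, u j]) ((elem_eval l v w) ^+ 2)%:E =
   (\sum_(i < j) elem_eval l (u i.+1) w ^+ 2 * (u i.+1 - u i))%:E)%E.
Proof.
move=> ok gap; elim: j => [|j IH] jm.
  by rewrite u0 big_ord0 set_itv1 integral_set1.
have uj0 : 0 <= u j by apply: (grid_ge0 _ hu) => //; [rewrite u0|exact: ltnW].
have uj := hu jm.
have -> : [set` `[0, u j.+1]] = [set` `[0, u j]] `|` [set` `]u j, u j.+1]].
  apply/seteqP; split=> v /=; rewrite !in_itv/=.
    by move=> /andP[v0 vu]; case: (leP v (u j)) => h; [left|right]; rewrite ?v0//= vu.
  move=> [/andP[-> /le_trans ->//]|/andP[h ->]]; first exact: ltW.
  by rewrite andbT (le_trans uj0 (ltW h)).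
rewrite ge0_integral_setU//=; last 3 first.
- apply/measurable_EFinP; apply: measurable_funX.
  by apply: measurable_funTS; exact: measurable_elem_eval.
- by move=> v _; rewrite lee_fin sqr_ge0.
- apply/disj_setPS => v [/=]; rewrite !in_itv/= => /andP[_ h1] /andP[h2 _].
  by move: h1; rewrite leNgt h2.
rewrite IH ?(ltnW jm)// big_ord_recr/= EFinD; congr (_ + _)%E.
under eq_integral => v.
  rewrite inE/= in_itv/= => /andP[v1 v2].
  rewrite (elem_eval_cst w ok gap jm v1 v2); over.
rewrite integral_cst//= lebesgue_measure_itv/= lte_fin uj.
by rewrite EFinM.
Qed.

End elementary.

Lemma In_map_mem (A : Type) (I : eqType) (f : A -> I) (x : A) (l : seq A) :
  List.In x l -> f x \in [seq f y | y <- l].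
Proof.
elim: l => //= y l IH [->|/IH h]; first by rewrite mem_head.
by rewrite inE h orbT.
Qed.

Section elementary_lenglart.
Context {R : realType} {d : measure_display} {T : measurableType d}.
Context (P : probability T R) (F : R -> set_system T).
Hypothesis hF : filtration F.
Variable V : process R T.
Hypothesis hV : brownian_motion P F V.

Lemma integral_normal_id (s : R) : 0 < s ->
  (normal_prob 0 s).-integrable setT (EFin \o (fun y : R => y)) /\
  (\int[normal_prob 0 s]_y y%:E = 0)%E /\
  (\int[normal_prob 0 s]_y (y ^+ 2)%:E = (s ^+ 2)%:E)%E.
Proof.
move=> s0.
have E1 : (fun y : R => y ^+ 1 * expR (0 * y)) = (fun y => y).
  by apply/funext => y; rewrite mul0r expR0 mulr1 expr1.
have E2 : (fun y : R => y ^+ 2 * expR (0 * y)) = (fun y => y ^+ 2).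
  by apply/funext => y; rewrite mul0r expR0 mulr1.
have i1 := integrable_polyexp s0 1 0; have i2 := integrable_polyexp s0 2 0.
have m1 := normal_mgf1 s0 0; have m2 := normal_mgf2 s0 0.
rewrite E1 in i1 m1; rewrite E2 in i2 m2.
split; first exact: i1.
split.
  move: m1; rewrite /Rintegral !mul0r => m1.
  by rewrite -[LHS]fineK ?m1//; exact: integrable_fin_num i1.
move: m2; rewrite /Rintegral expr0n /= !mul0r addr0 expR0 mulr1 => m2.
by rewrite -[LHS]fineK ?m2//; exact: integrable_fin_num i2.
Qed.

(** [lenglart] on a grid that contains the end points of all the terms and the
    observation times [ts]. *)
Lemma elem_lenglart (l : seq (@term R d T)) (ts : seq R) (s del e : R) :
  (forall x, List.In x l -> predictable_term F x) -> 0 <= s ->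
  (forall x, x \in ts -> 0 <= x <= s) -> 0 <= del -> 0 < e ->
  small P [set w | (\int[lebesgue_measure]_(v in `[0%R, s]) ((elem_eval l v w) ^+ 2)%:E <= del%:E)%E
     /\ exists2 x, x \in ts & e <= `|elem_int l V x w|] (del / e ^+ 2).
Proof.
move=> ok s0 hts del0 e0.
pose bps := [seq Num.min x.2 s | x <- l] ++ [seq Num.min x.1.2 s | x <- l].
have hpts x : x \in bps ++ ts -> 0 <= x <= s.
  rewrite !mem_cat => /orP[|/hts//].
  have aux (f : @term R d T -> R) (hf : forall y, List.In y l -> 0 <= f y) :
     x \in [seq Num.min (f y) s | y <- l] -> 0 <= x <= s.
    have : forall y, List.In y l -> 0 <= f y by [].
    elim: (l) => //= y l' IH h; rewrite inE => /orP[/eqP->|]; last first.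
      by apply: IH => z hz; apply: h; right.
    by rewrite le_min s0 (h y (or_introl erefl)) ge_min lexx orbT.
  move=> /orP[]; apply: aux => y /ok[h1 h2 _] //; exact: le_trans h2.
have [m [u [u0 um hu hmem]]] := sorted_grid s0 hpts.
have gapP a : 0 <= a -> Num.min a s \in bps ++ ts ->
    forall i, (i < m)%N -> a < u i.+1 -> a <= u i.
  move=> a0 /hmem[i0 i0m ui0] i im au.
  have uis : u i.+1 <= s by rewrite -um; apply: (grid_le hu).
  have as_ : a <= s by apply: le_trans uis; exact: ltW.
  move: ui0; rewrite min_l// => ui0.
  rewrite -ui0; apply: (grid_le hu) => //; last exact: ltnW.
  rewrite leqNgt; apply/negP => ii0.
  by move: au; rewrite -ui0 ltNge (grid_le hu).
have gap x : List.In x l -> (forall i, (i < m)%N -> x.1.2 < u i.+1 -> x.1.2 <= u i) /\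
                            (forall i, (i < m)%N -> x.2 < u i.+1 -> x.2 <= u i).
  move=> xl; have [h1 h2 _] := ok x xl; split; apply: gapP => //.
  - by rewrite !mem_cat (In_map_mem (fun x : @term R d T => Num.min x.1.2 s))// orbT.
  - exact: le_trans h2.
  - by rewrite !mem_cat (In_map_mem (fun x : @term R d T => Num.min x.2 s)).
have s2 i : (i < m)%N -> 0 < Num.sqrt (u i.+1 - u i) by move=> im; rewrite sqrtr_gt0 subr_gt0 hu.
have := @lenglart _ _ _ P F hF V hV m u (fun i => elem_eval l (u i.+1)) (fun _ y => y)
  (fun i => u i.+1 - u i) _ hu _ _ _ _ _ del e del0 e0.
move=> /(_ _ _ _ _ _ _)/small_sub; apply.
- move=> w [hI [x xts ex]]; split.
    by move: hI; rewrite -um (integral_elem_grid u0 hu w ok gap (leqnn m)) lee_fin.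
  have xp : x \in bps ++ ts by rewrite mem_cat xts orbT.
  have [j jm uj] := hmem x xp.
  by exists j => //; rewrite /noise_sum -(elem_int_grid u0 hu V w ok gap jm) uj.
- by rewrite u0.
- by move=> i im; exact: (measurable_elem_grid hF u0 hu ok gap im).
- by move=> i im; exact: measurable_id.
- by move=> i im; exact: (integral_normal_id (s2 i im)).1.
- by move=> i im; exact: (integral_normal_id (s2 i im)).2.1.
- move=> i im; rewrite (integral_normal_id (s2 i im)).2.2 sqr_sqrtr//.
  by rewrite subr_ge0 ltW ?hu.
Qed.

End elementary_lenglart.

(** * The Ito integral of a continuous adapted process as a limit of Riemann sums *)

Section riemann.
Context {R : realType} {d : measure_display} {T : measurableType d}.
Context (P : probability T R) (F : R -> set_system T).
Hypothesis hF : filtration F.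
Notation tm := (@term R d T).

Definition step_terms (n : nat) (xi : nat -> T -> R) (tau : nat -> R) : seq tm :=
  [seq (xi i, tau i, tau i.+1) | i <- iota 0 n].

Lemma step_terms_eval n xi tau s w : elem_eval (step_terms n xi tau) s w =
  \sum_(i < n) xi i w * \1_(`]tau i, tau i.+1]%classic) s.
Proof.
by rewrite /elem_eval big_map -{1}(subn0 n) -/(index_iota 0 n) big_mkord.
Qed.

Lemma step_terms_int n xi tau V s w : elem_int (step_terms n xi tau) V s w =
  \sum_(i < n) xi i w * (V (Num.min (tau i.+1) s) w - V (Num.min (tau i) s) w).
Proof.
by rewrite /elem_int big_map -{1}(subn0 n) -/(index_iota 0 n) big_mkord.
Qed.

Lemma step_terms_ok n xi tau : (forall i, 0 <= tau i) -> (forall i, tau i <= tau i.+1) ->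
  (forall i, measurable_wrt (F (tau i)) (xi i)) ->
  forall x, List.In x (step_terms n xi tau) -> predictable_term F x.
Proof.
move=> h1 h2 h3 x; rewrite /step_terms; elim: (iota 0 n) => //= i s IH [<-|/IH//].
by split => /=; [exact: h1|exact: h2|exact: h3].
Qed.

Definition neg_terms (l : seq tm) : seq tm := [seq ((fun w => - x.1.1 w), x.1.2, x.2) | x <- l].

Lemma neg_terms_eval l s w : elem_eval (neg_terms l) s w = - elem_eval l s w.
Proof. by rewrite /elem_eval big_map -sumrN; apply: eq_bigr => x _ /=; rewrite mulNr. Qed.

Lemma neg_terms_int l V s w : elem_int (neg_terms l) V s w = - elem_int l V s w.
Proof. by rewrite /elem_int big_map -sumrN; apply: eq_bigr => x _ /=; rewrite mulNr. Qed.

Lemma neg_terms_ok l : (forall x, List.In x l -> predictable_term F x) ->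
  forall x, List.In x (neg_terms l) -> predictable_term F x.
Proof.
elim: l => //= y l IH h x [<-|]; last by apply: IH => z hz; apply: h; right.
have [h1 h2 h3] := h y (or_introl erefl); split => //=.
apply: (measurable_wrt_comp (filtration_sigma hF h1) (f := fun x => - x)) => //.
exact: oppr_measurable.
Qed.

Lemma cat_terms_eval l1 l2 s w : elem_eval (l1 ++ l2 : seq tm) s w = elem_eval l1 s w + elem_eval l2 s w.
Proof. by rewrite /elem_eval big_cat. Qed.

Lemma cat_terms_int l1 l2 V s w : elem_int (l1 ++ l2 : seq tm) V s w = elem_int l1 V s w + elem_int l2 V s w.
Proof. by rewrite /elem_int big_cat. Qed.

Lemma cat_terms_ok (l1 l2 : seq tm) : (forall x, List.In x l1 -> predictable_term F x) ->
  (forall x, List.In x l2 -> predictable_term F x) -> (forall x, List.In x (l1 ++ l2) -> predictable_term F x).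
Proof. by move=> h1 h2 x /List.in_app_iff [/h1|/h2]. Qed.

Variable H : process R T.
Hypothesis aH : adapted F H.
Hypothesis cH : continuous_paths H.
Variable t : R.
Hypothesis t0 : 0 < t.

Definition unif (N k : nat) : R := k%:R * (t / N.+1%:R).

Lemma unif_ge0 N k : 0 <= unif N k.
Proof. by rewrite mulr_ge0// divr_ge0// ltW. Qed.

Lemma unifS N k : unif N k.+1 = unif N k + t / N.+1%:R.
Proof. by rewrite /unif -natr1 mulrDl mul1r. Qed.

Lemma unif_mesh N : 0 < t / N.+1%:R.
Proof. by rewrite divr_gt0. Qed.

Lemma unif_lt N k : unif N k < unif N k.+1.
Proof. by rewrite unifS ltrDl unif_mesh. Qed.

Lemma unif_mono N i j : (i <= j)%N -> unif N i <= unif N j.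
Proof. by move=> ij; rewrite /unif ler_wpM2r ?ler_nat// ltW// unif_mesh. Qed.

Lemma unif_last N : unif N N.+1 = t.
Proof. by rewrite /unif mulrC divfK. Qed.

Lemma unif_le N k : (k <= N.+1)%N -> unif N k <= t.
Proof. by move=> h; rewrite -(unif_last N) unif_mono. Qed.

(** The left-point step approximation of [H] on the uniform grid. *)
Definition riem N : seq tm := step_terms N.+1 (fun k => H (unif N k)) (unif N).

Lemma riem_predictable N x : List.In x (riem N) -> predictable_term F x.
Proof.
apply: step_terms_ok => i; first exact: unif_ge0.
- exact/ltW/unif_lt.
- by apply: aH; exact: unif_ge0.
Qed.

Lemma riem_eval N v w : 0 < v <= t ->
  exists k, [/\ (k <= N)%N, unif N k < v, v <= unif N k.+1 & elem_eval (riem N) v w = H (unif N k) w].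
Proof.
move=> /andP[v0 vt].
have ex : exists j, v <= unif N j by exists N.+1; rewrite unif_last.
have [j vj jmin] := ex_minnP ex.
case: j vj jmin => [|k] vj jmin; first by move: vj; rewrite /unif mul0r leNgt v0.
have kv : unif N k < v.
  by rewrite ltNge; apply/negP => /jmin; rewrite ltnn.
have kN : (k < N.+1)%N by apply: jmin; rewrite unif_last.
exists k; split => //.
rewrite step_terms_eval (bigD1 (Ordinal kN))//= big1 => [|i ik].
  rewrite addr0 indicE mem_set ?mulr1//= in_itv/= kv vj//.
rewrite indicE memNset ?mulr0//= in_itv/= => /andP[iv vi].
case/negP: ik; apply/eqP/val_inj => /=; apply/eqP; rewrite eqn_leq; apply/andP; split.
  rewrite leqNgt; apply/negP => ki; move: iv; rewrite ltNge.
  by rewrite (le_trans vj)// unif_mono.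
by have := jmin _ vi; rewrite ltnS.
Qed.

Lemma riem_int N k V w : (k <= N.+1)%N ->
  elem_int (riem N) V (unif N k) w = \sum_(i < k) H (unif N i) w * increment V (unif N i) (unif N i.+1) w.
Proof.
move=> kN; rewrite step_terms_int -(subnKC kN) big_split_ord/= [X in _ + X]big1 ?addr0.
  apply: eq_bigr => i _; rewrite !min_l ?unif_mono//; exact: ltnW.
move=> i _; rewrite !min_r ?unif_mono ?leq_addr ?subrr ?mulr0//.
by rewrite -addnS leq_addr.
Qed.

Lemma riem_close N v w rho del : 0 < v <= t -> t / N.+1%:R < del ->
  ~ (exists u v, [/\ 0 <= u <= t, 0 <= v <= t, `|u - v| < del & rho < `|H u w - H v w|]) ->
  `|elem_eval (riem N) v w - H v w| <= rho.
Proof.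
move=> hv Nd hn; have [k [kN kv vk ->]] := riem_eval N w hv.
have /andP[v0 vt] := hv.
rewrite leNgt; apply/negP => h; apply: hn; exists (unif N k), v; split => //.
- by rewrite unif_ge0 unif_le// ltnW.
- by rewrite (ltW v0).
- rewrite ltr0_norm ?subr_lt0// opprB; move: vk Nd; rewrite unifS.
  by move: (t / _) (unif N k) => q g; lra.
Qed.

Lemma riem_cvg v w : 0 < v <= t -> elem_eval (riem N) v w @[N --> \oo] --> H v w.
Proof.
move=> hv; apply/cvgrPdist_le => e e0.
have [del del0 hd] := path_unif cH w t e0.
have tdel : 0 < t / del by rewrite divr_gt0.
exists (Num.trunc (t / del)) => // N /= hN.
rewrite distrC; apply: (riem_close hv (del := del)).
  rewrite ltr_pdivrMr// mulrC -ltr_pdivrMr//.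
  by apply: lt_le_trans (truncnS_gt _) _; rewrite ler_nat ltnS.
by move=> [u [v' [hu hv' uv]]]; rewrite ltNge (ltW (hd _ _ hu hv' uv)).
Qed.

Lemma measurable_indic_snd (A : set R) : measurable A ->
  measurable_fun setT (fun z : (T * measurableTypeR R)%type => \1_A (z.2 : R) : R).
Proof.
move=> mA; have m : measurable_fun [set: measurableTypeR R] (\1_A : measurableTypeR R -> R).
  exact: measurable_indic.
exact: (measurableT_comp m measurable_snd).
Qed.

Lemma measurable_joint_eval (l : seq tm) : (forall x, List.In x l -> predictable_term F x) ->
  measurable_fun setT (fun z : (T * measurableTypeR R)%type => elem_eval l (z.2 : R) z.1).
Proof.
elim: l => [|x l IH] ok.
  by rewrite /elem_eval; under eq_fun do rewrite big_nil; exact: measurable_cst.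
rewrite /elem_eval; under eq_fun do rewrite big_cons.
apply: measurable_funD; last by apply: IH => y yl; apply: ok; right.
have [h1 h2 h3] := ok x (or_introl erefl).
apply: measurable_funM.
  by apply: (measurableT_comp (measurable_wrt_fun hF h1 h3)); exact: measurable_fst.
exact: measurable_indic_snd.
Qed.

Definition sq_error_density (l : seq tm) (s : R) (z : (T * measurableTypeR R)%type) : R :=
  (elem_eval l (z.2 : R) z.1 - H z.2 z.1) ^+ 2 * \1_(`]0, s]%classic) (z.2 : R).

Lemma sq_error_density_ge0 l s z : 0 <= sq_error_density l s z.
Proof. by rewrite mulr_ge0 ?sqr_ge0. Qed.

(** [H] is jointly measurable on [[0, t]] as the pointwise limit of its step
    approximations. *)
Lemma measurable_sq_error_density (l : seq tm) s : (forall x, List.In x l -> predictable_term F x) -> s <= t ->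
  measurable_fun setT (sq_error_density l s).
Proof.
move=> ok st.
have mi : measurable_fun setT (fun z : (T * measurableTypeR R)%type => \1_(`]0, s]%classic) (z.2 : R) : R).
  exact: measurable_indic_snd.
apply: (measurable_fun_cvg (h := fun N z => (elem_eval l (z.2 : R) z.1 - elem_eval (riem N) (z.2 : R) z.1) ^+ 2 * \1_(`]0, s]%classic) (z.2 : R))).
  move=> N; apply: measurable_funM => //; apply: measurable_funX; apply: measurable_funB.
    exact: measurable_joint_eval.
  by apply: measurable_joint_eval; exact: riem_predictable.
move=> [w v] _ /=; rewrite /sq_error_density/= indicE.
have [|_] := boolP (v \in _); last by under eq_fun do rewrite mulr0; rewrite mulr0; exact: cvg_cst.
rewrite inE/= in_itv/= => /andP[v0 vs]; rewrite mulr1; under eq_fun do rewrite mulr1.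
apply: cvgM; apply: cvgB; (try exact: cvg_cst); apply: riem_cvg; by rewrite v0 (le_trans vs).
Qed.

Definition sq_error (l : seq tm) (s : R) (w : T) : \bar R :=
  (\int[lebesgue_measure]_v (sq_error_density l s (w, v))%:E)%E.

Lemma measurable_sq_error l s : (forall x, List.In x l -> predictable_term F x) -> s <= t ->
  measurable_fun setT (sq_error l s).
Proof.
move=> ok st.
have mf : measurable_fun setT (EFin \o sq_error_density l s) by apply/measurable_EFinP; exact: measurable_sq_error_density.
have f0 z : (0 <= (EFin \o sq_error_density l s) z)%E by rewrite lee_fin sq_error_density_ge0.
have := @measurable_fun_fubini_tonelli_F _ _ T (measurableTypeR R) R (@lebesgue_measure R) (EFin \o sq_error_density l s) mf f0.
exact.
Qed.

Lemma measurable_sq_error_density_snd l s w : (forall x, List.In x l -> predictable_term F x) -> s <= t ->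
  measurable_fun setT (fun v : R => sq_error_density l s (w, v)).
Proof.
move=> ok st; exact: (measurableT_comp (measurable_sq_error_density ok st) (pair1_measurable w)).
Qed.

Lemma integral_oc (g : R -> R) (s : R) :
  measurable_fun setT (fun v : R => g v * \1_(`]0, s]%classic) v) ->
  (\int[lebesgue_measure]_(v in `[0%R, s]) (g v)%:E =
   \int[lebesgue_measure]_v (g v * \1_(`]0, s]%classic) v)%:E)%E.
Proof.
move=> mg; rewrite -integral_itv_obnd_cbnd; last first.
  apply/measurable_EFinP.
  apply: (@eq_measurable_fun _ _ _ _ _ (fun v : R => g v * \1_(`]0, s]%classic) v)); last exact: measurable_funTS.
  by move=> v vs; rewrite indicE vs mulr1.
rewrite integral_mkcond; apply: eq_integral => v _; rewrite patchE indicE.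
by case: ifP => _; rewrite ?mulr1 ?mulr0.
Qed.

Lemma integral_sq_errorE l s w : (forall x, List.In x l -> predictable_term F x) -> s <= t ->
  (\int[lebesgue_measure]_(v in `[0%R, s]) ((elem_eval l v w - H v w) ^+ 2)%:E)%E = sq_error l s w.
Proof.
move=> ok st; rewrite (integral_oc (g := fun v => (elem_eval l v w - H v w) ^+ 2))//.
exact: (measurable_sq_error_density_snd w ok st).
Qed.

Lemma integral_riem_diff N l s w rho kap :
  0 <= s <= t -> (forall x, List.In x l -> predictable_term F x) -> 0 <= kap ->
  (forall v, 0 < v <= s -> `|elem_eval (riem N) v w - H v w| <= rho) ->
  (sq_error l s w <= kap%:E)%E ->
  (\int[lebesgue_measure]_(v in `[0%R, s]) ((elem_eval (riem N ++ neg_terms l) v w) ^+ 2)%:E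
    <= (2 * (rho ^+ 2 * s + kap))%:E)%E.
Proof.
move=> /andP[s0 st] ok kap0 hr he.
have mE : measurable_fun setT (fun v : R => elem_eval (riem N ++ neg_terms l) v w ^+ 2 * \1_(`]0, s]%classic) v).
  by apply: measurable_funM => //; apply: measurable_funX; exact: measurable_elem_eval.
rewrite (integral_oc (g := fun v => (elem_eval (riem N ++ neg_terms l) v w) ^+ 2))//.
have m1 : measurable_fun setT (fun v : R => (2 * rho ^+ 2 * \1_(`]0, s]%classic) v)%:E).
  by apply/measurable_EFinP; apply: measurable_funM.
have m2 : measurable_fun setT (fun v : R => (2 * sq_error_density l s (w, v))%:E).
  by apply/measurable_EFinP; apply: measurable_funM => //; exact: measurable_sq_error_density_snd.
apply: (@le_trans _ _ (\int[lebesgue_measure]_v ((2 * rho ^+ 2 * \1_(`]0, s]%classic) v)%:E + (2 * sq_error_density l s (w, v))%:E))%E).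
  apply: ge0_le_integral => //.
  - by move=> v _; rewrite lee_fin mulr_ge0 ?sqr_ge0.
  - exact/measurable_EFinP.
  - exact: emeasurable_funD.
  - move=> v _; rewrite -EFinD lee_fin cat_terms_eval neg_terms_eval /sq_error_density/= indicE.
    have [|_] := boolP (v \in _); last by rewrite !mulr0 addr0.
    rewrite inE/= in_itv/= => hv; rewrite !mulr1.
    have := hr v hv; move: (elem_eval (riem N) v w) (elem_eval l v w) (H v w) => a b c hab.
    have h1 : (a - c) ^+ 2 <= rho ^+ 2.
      by rewrite -[leLHS]real_normK ?num_real// ler_pXn2r ?nnegrE// (le_trans _ hab).
    have : 0 <= (a - c + (b - c)) ^+ 2 by rewrite sqr_ge0.
    by move: h1; nra.
rewrite ge0_integralD//; last 2 first.
- by move=> v _; rewrite lee_fin mulr_ge0// mulr_ge0// sqr_ge0.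
- by move=> v _; rewrite lee_fin mulr_ge0// sq_error_density_ge0.
rewrite [leRHS](_ : _ = (2 * rho ^+ 2 * s)%:E + (2 * kap)%:E)%E; last first.
  by rewrite -EFinD; congr (_%:E); ring.
apply: leeD.
  under eq_integral do rewrite EFinM.
  rewrite ge0_integralZl//; last 2 first.
  - by apply/measurable_EFinP; exact: measurable_indic.
  - by rewrite lee_fin mulr_ge0 ?sqr_ge0.
  rewrite integral_indic//= setIT lebesgue_measure_itv/= lte_fin.
  by case: ltP => [_|/(conj s0)/andP/le_anti<-]; rewrite ?oppr0 ?adde0 -?EFinM ?mulr0 ?mule0.
under eq_integral do rewrite EFinM.
rewrite ge0_integralZl//; last 2 first.
- by apply/measurable_EFinP; exact: measurable_sq_error_density_snd.
- by move=> v _; rewrite lee_fin sq_error_density_ge0.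
by rewrite EFinM lee_pmul2l.
Qed.

Variable V : process R T.
Hypothesis hV : brownian_motion P F V.

Lemma measurable_elem_int (l : seq tm) s : (forall x, List.In x l -> predictable_term F x) -> 0 <= s ->
  measurable_fun setT (elem_int l V s).
Proof.
move=> ok s0; rewrite /elem_int; elim: l ok => [|x l IH] ok.
  by under eq_fun do rewrite big_nil; exact: measurable_cst.
under eq_fun do rewrite big_cons.
apply: measurable_funD; last by apply: IH => y yl; apply: ok; right.
have [h1 h2 h3] := ok x (or_introl erefl); have [aV _ _ _ _] := hV.
apply: measurable_funM; first exact: (measurable_wrt_fun hF h1).
have h0 a : 0 <= a -> measurable_fun setT (V (Num.min a s)).
  move=> a0; have ms : 0 <= Num.min a s by rewrite le_min a0.
  by apply: (measurable_wrt_fun hF ms); exact: aV.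
apply: measurable_funB; apply: h0 => //; exact: le_trans h2.
Qed.

Definition sp_terms (S : simple_process F) : seq tm :=
  step_terms (sp_size S) (sp_coef S) (sp_time S).

Lemma sp_terms_ok S x : List.In x (sp_terms S) -> predictable_term F x.
Proof.
by apply: step_terms_ok; [exact: sp_time_ge0|exact: sp_time_le|exact: sp_coef_measurable].
Qed.

(** One element of the defining sequence of the Ito integral, as a list of terms. *)
Lemma ito_approx (s : R) (J : T -> R) (e kap r : R) : 0 <= s <= t ->
  is_ito_integral P F V H s J -> 0 < e -> 0 < kap -> 0 < r ->
  exists S : simple_process F,
    small P [set w | (kap%:E <= sq_error (sp_terms S) s w)%E] r /\
    small P [set w | e <= `|elem_int (sp_terms S) V s w - J w| ] r.
Proof.
move=> /andP[s0 st] [mJ [S [S1 S2]]] e0 k0 r0.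
have hE n w : (\int[lebesgue_measure]_(v in `[0%R, s]) ((sp_eval (S n) v w - H v w) ^+ 2)%:E)%E
    = sq_error (sp_terms (S n)) s w.
  rewrite -(integral_sq_errorE w (@sp_terms_ok _) st); apply: eq_integral => v _.
  by rewrite /sp_terms step_terms_eval.
have hI n w : sp_integral (S n) V s w = elem_int (sp_terms (S n)) V s w.
  by rewrite /sp_terms step_terms_int.
have m1 n : measurable [set w | (kap%:E <= \int[lebesgue_measure]_(v in `[0%R, s]) ((sp_eval (S n) v w - H v w) ^+ 2)%:E)%E].
  rewrite (_ : mkset _ = [set: T] `&` [set w | (kap%:E <= sq_error (sp_terms (S n)) s w)%E]).
    by apply: emeasurable_fun_c_infty => //; exact: (measurable_sq_error (@sp_terms_ok _) st).
  by rewrite setTI; apply/seteqP; split=> w /=; rewrite hE.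
have m2 n : measurable [set w | (e%:E <= `|sp_integral (S n) V s w - J w|%:E)%E].
  have mI := measurable_elem_int (@sp_terms_ok (S n)) s0.
  have mb : measurable_fun setT (fun w => e <= `|elem_int (sp_terms (S n)) V s w - J w|).
    apply: measurable_fun_ler => //; apply: measurableT_comp => //; exact: measurable_funB.
  rewrite (_ : mkset _ = [set: T] `&` (fun w => e <= `|elem_int (sp_terms (S n)) V s w - J w|) @^-1` [set true]).
    exact: mb.
  by rewrite setTI; apply/seteqP; split=> w /=; rewrite lee_fin hI.
have [N1 hN1] := cvg0_small r0 m1 (S1 kap k0).
have [N2 hN2] := cvg0_small r0 m2 (S2 e e0).
exists (S (maxn N1 N2)); split.
- by apply: small_sub (hN1 _ (leq_maxl N1 N2)) => w /=; rewrite hE.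
- by apply: small_sub (hN2 _ (leq_maxr N1 N2)) => w /=; rewrite lee_fin hI.
Qed.

(** Two elementary processes that are close to [H] in integrated square are close
    to each other, so by [elem_lenglart] their integrals are close: the Riemann
    sums have the same limit as the defining sequence of the Ito integral. *)
Lemma riem_int_cvg (s : R) (J : T -> R) (e r : R) : 0 <= s <= t ->
  is_ito_integral P F V H s J -> 0 < e -> 0 < r ->
  exists N0, forall N, (N0 <= N)%N ->
    small P [set w | e <= `|elem_int (riem N) V s w - J w|] r.
Proof.
move=> hs hJ e0 r0; have /andP[s0 st] := hs.
have e20 : 0 < e / 2 by rewrite divr_gt0.
have [del del0 delE] : exists2 del, 0 < del & del / (e / 2) ^+ 2 = r / 4.
  exists (r / 4 * (e / 2) ^+ 2); first by rewrite mulr_gt0 ?exprn_gt0// divr_gt0.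
  by rewrite mulfK// gt_eqF// exprn_gt0.
have delt0 : 0 <= del / (4 * t) by rewrite divr_ge0 ?mulr_ge0 ?(ltW del0) ?(ltW t0).
pose kap := del / 4; have kap0 : 0 < kap by rewrite divr_gt0.
pose rho := Num.sqrt (del / (4 * t)).
have rho0 : 0 < rho by rewrite sqrtr_gt0 divr_gt0// mulr_gt0.
have r40 : 0 < r / 4 by rewrite divr_gt0.
have [md md0 hm] := path_modulus P hF aH cH t0 rho0 r40.
have [S [S1 S2]] := ito_approx hs hJ e20 kap0 r40.
exists (Num.trunc (t / md)) => N hN.
have mesh : t / N.+1%:R < md.
  rewrite ltr_pdivrMr// mulrC -ltr_pdivrMr//.
  by apply: lt_le_trans (truncnS_gt _) _; rewrite ler_nat ltnS.
have ok : forall x, List.In x (riem N ++ neg_terms (sp_terms S)) -> predictable_term F x.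
  by apply: cat_terms_ok; [exact: riem_predictable|apply: neg_terms_ok; exact: sp_terms_ok].
have hts x : x \in [:: s] -> 0 <= x <= s by rewrite inE => /eqP->; rewrite s0 lexx.
have L := elem_lenglart hF hV ok s0 hts (ltW del0) e20.
apply: small_le (_ : r / 4 + (r / 4 + (r / 4 + del / (e / 2) ^+ 2)) <= _) _.
  by rewrite delE; lra.
apply: small_sub (smallU hm (smallU S1 (smallU S2 L))) => w; rewrite {1}/mkset => hw.
have [h1|h1] := pselect (exists u v, [/\ 0 <= u <= t, 0 <= v <= t, `|u - v| < md & rho < `|H u w - H v w|]).
  by left.
right; have [h2|h2] := leP kap%:E (sq_error (sp_terms S) s w); first by left.
right; have [h3|h3] := leP (e / 2) `|elem_int (sp_terms S) V s w - J w|; first by left.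
right; split.
  apply: le_trans (integral_riem_diff (N := N) (rho := rho) (kap := kap) hs (@sp_terms_ok S) (ltW kap0) _ (ltW h2)) _.
    move=> v /andP[v0 vs]; apply: (riem_close _ mesh h1).
    by rewrite v0 (le_trans vs st).
  rewrite lee_fin /rho sqr_sqrtr//.
  have h4 : del / (4 * t) * s <= del / (4 * t) * t.
    by rewrite ler_wpM2l.
  have h5 : del / (4 * t) * t = del / 4 by field; rewrite gt_eqF.
  by move: h4; rewrite h5 /kap; lra.
exists s; first by rewrite inE.
rewrite cat_terms_int neg_terms_int.
have := ler_distD (elem_int (sp_terms S) V s w) (elem_int (riem N) V s w) (J w).
by move: h3 hw; lra.
Qed.

(** [J s] is given separately for each [s], so [riem_int_cvg] has no uniformity.
    A much finer grid [M] is close to [J] at the finitely many points of grid [N],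
    and the maximal inequality [elem_lenglart] compares the grids [N] and [M] at
    all these points at once. *)
Lemma riem_int_unif (J : R -> T -> R) (e r : R) :
  (forall s, 0 <= s <= t -> is_ito_integral P F V H s (J s)) -> 0 < e -> 0 < r ->
  exists N0, forall N, (N0 <= N)%N ->
    small P [set w | exists2 k, (k <= N.+1)%N & e <= `|elem_int (riem N) V (unif N k) w - J (unif N k) w|] r.
Proof.
move=> hJ e0 r0.
have e20 : 0 < e / 2 by rewrite divr_gt0.
have [del del0 delE] : exists2 del, 0 < del & del / (e / 2) ^+ 2 = r / 4.
  exists (r / 4 * (e / 2) ^+ 2); first by rewrite mulr_gt0 ?exprn_gt0// divr_gt0.
  by rewrite mulfK// gt_eqF// exprn_gt0.
have delt0 : 0 <= del / (4 * t) by rewrite divr_ge0 ?mulr_ge0 ?(ltW del0) ?(ltW t0).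
pose rho := Num.sqrt (del / (4 * t)).
have rho0 : 0 < rho by rewrite sqrtr_gt0 divr_gt0// mulr_gt0.
have r40 : 0 < r / 4 by rewrite divr_gt0.
have [md md0 hm] := path_modulus P hF aH cH t0 rho0 r40.
exists (Num.trunc (t / md)) => N hN.
have meshP M : (Num.trunc (t / md) <= M)%N -> t / M.+1%:R < md.
  move=> hM; rewrite ltr_pdivrMr// mulrC -ltr_pdivrMr//.
  by apply: lt_le_trans (truncnS_gt _) _; rewrite ler_nat ltnS.
pose r' := r / 4 / N.+2%:R.
have r'0 : 0 < r' by rewrite divr_gt0.
have /choice[M0 hM0] : forall k, exists N0, (k <= N.+1)%N -> forall M, (N0 <= M)%N ->
    small P [set w | e / 2 <= `|elem_int (riem M) V (unif N k) w - J (unif N k) w|] r'.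
  move=> k; have [kN|kN] := leqP k N.+1; last by exists 0%N.
  have hk : 0 <= unif N k <= t by rewrite unif_ge0 unif_le.
  by have [M hM] := riem_int_cvg hk (hJ _ hk) e20 r'0; exists M.
pose M := maxn N (\max_(k < N.+2) M0 k).
have hM k : (k < N.+2)%N -> small P [set w | e / 2 <= `|elem_int (riem M) V (unif N k) w - J (unif N k) w|] r'.
  move=> kN; apply: hM0 => //.
  by rewrite leq_max (leq_bigmax (Ordinal kN)) orbT.
have ok : forall x, List.In x (riem N ++ neg_terms (riem M)) -> predictable_term F x.
  by apply: cat_terms_ok; [exact: riem_predictable|apply: neg_terms_ok; exact: riem_predictable].
pose ts := [seq unif N k | k <- iota 0 N.+2].
have hts x : x \in ts -> 0 <= x <= t.
  move=> /mapP[k]; rewrite mem_iota add0n ltnS => /andP[_ kN] ->.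
  by rewrite unif_ge0 unif_le.
have L := elem_lenglart hF hV ok (ltW t0) hts (ltW del0) e20.
apply: small_le (_ : r / 4 + (N.+2%:R * r' + del / (e / 2) ^+ 2) <= _) _.
  by rewrite delE /r' (mulrC N.+2%:R) divfK ?pnatr_eq0//; lra.
apply: small_sub (smallU hm (smallU (small_finite hM) L)) => w [k kN hw].
have [h1|h1] := pselect (exists u v, [/\ 0 <= u <= t, 0 <= v <= t, `|u - v| < md & rho < `|H u w - H v w|]).
  by left.
right; have [h3|h3] := leP (e / 2) `|elem_int (riem M) V (unif N k) w - J (unif N k) w|.
  by left; exists k.
right; split.
  have hMd : (Num.trunc (t / md) <= M)%N by rewrite leq_max hN.
  apply: le_trans (@integral_riem_diff N (riem M) t w rho (del / 4) _ (@riem_predictable M) _ _ _) _.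
  - by rewrite lexx ltW.
  - by rewrite divr_ge0 ?(ltW del0).
  - by move=> v hv; apply: (riem_close hv (meshP _ hN) h1).
  - apply: (@le_trans _ _ (\int[lebesgue_measure]_v (rho ^+ 2 * \1_(`]0, t]%classic) v)%:E)%E).
      apply: ge0_le_integral => //.
      + by move=> v _; rewrite lee_fin sq_error_density_ge0.
      + by apply/measurable_EFinP; exact: (measurable_sq_error_density_snd w (@riem_predictable M) (lexx t)).
      + by apply/measurable_EFinP; apply: measurable_funM.
      + move=> v _; rewrite lee_fin /sq_error_density/= indicE.
        have [|_] := boolP (v \in _); last by rewrite !mulr0.
        rewrite inE/= in_itv/= => hv; rewrite !mulr1.
        have := riem_close hv (meshP _ hMd) h1 => h.
        by rewrite -[leLHS]real_normK ?num_real// ler_pXn2r ?nnegrE// ltW.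
    under eq_integral do rewrite EFinM.
    rewrite ge0_integralZl//; last 2 first.
    + by apply/measurable_EFinP; exact: measurable_indic.
    + by rewrite lee_fin sqr_ge0.
    rewrite integral_indic//= setIT lebesgue_measure_itv/= lte_fin t0 oppr0 adde0 -EFinM lee_fin.
    rewrite /rho sqr_sqrtr//.
    have -> : del / (4 * t) * t = del / 4 by field; rewrite gt_eqF.
    by [].
  - rewrite lee_fin /rho sqr_sqrtr//.
    have -> : del / (4 * t) * t = del / 4 by field; rewrite gt_eqF.
    by lra.
exists (unif N k); first by apply/mapP; exists k => //; rewrite mem_iota add0n.
rewrite cat_terms_int neg_terms_int.
have := ler_distD (elem_int (riem M) V (unif N k) w) (elem_int (riem N) V (unif N k) w) (J (unif N k) w).
by move: h3 hw; lra.
Qed.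

End riemann.

(** * Moments of the one-step noises *)

Section step_moments.
Context {R : realType}.

Lemma expR_quad (x : R) : `|x| <= 2^-1 -> expR x <= 1 + x + 2 * x ^+ 2.
Proof.
rewrite ler_norml => /andP[x1 x2].
have h : 1 - x <= expR (- x) by rewrite -[X in 1 + X]/(- x); exact: expR_ge1Dx.
have e0 := expR_gt0 x.
have h2 : expR x * (1 - x) <= 1.
  apply: le_trans (ler_wpM2l (ltW e0) h) _.
  by rewrite expRN divff ?gt_eqF.
rewrite -(@ler_pM2r _ (1 - x)); last by lra.
apply: le_trans h2 _.
have -> : (1 + x + 2 * x ^+ 2) * (1 - x) = 1 + x ^+ 2 * (1 - 2 * x) by ring.
rewrite lerDl mulr_ge0 ?sqr_ge0//; lra.
Qed.

Lemma expR_sub1_norm (x : R) : `|x| <= 2^-1 -> `|expR x - 1| <= 2 * `|x|.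
Proof.
move=> xb; have e1 := expR_ge1Dx x; have e2 := expR_quad xb.
have x2 : x ^+ 2 <= 2^-1 * `|x|.
  by rewrite -[x ^+ 2]real_normK ?num_real// expr2 ler_wpM2r.
have := ler_norm x; have := ler_norm (- x); rewrite normrN => h1 h2.
by rewrite ler_norml; apply/andP; split; lra.
Qed.

(** The first-order terms of [expR x] and [1 - x] cancel, which is what makes
    the drift of the discounted scheme of order D ^ 2 below. *)
Lemma expR_mul1B_norm (x : R) : `|x| <= 2^-1 -> `|expR x * (1 - x) - 1| <= 2 * x ^+ 2.
Proof.
move=> xb; have /andP[x1 x2] : - 2^-1 <= x <= 2^-1 by rewrite -ler_norml.
have e1 := expR_ge1Dx x; have e2 := expR_quad xb; have x20 := sqr_ge0 x.
have lo : 1 - x ^+ 2 <= expR x * (1 - x).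
  have -> : 1 - x ^+ 2 = (1 + x) * (1 - x) by ring.
  by rewrite ler_wpM2r//; lra.
have hi : expR x * (1 - x) <= 1 + x ^+ 2 * (1 - 2 * x).
  have -> : 1 + x ^+ 2 * (1 - 2 * x) = (1 + x + 2 * x ^+ 2) * (1 - x) by ring.
  by rewrite ler_wpM2r//; lra.
have : x ^+ 2 * (1 - 2 * x) <= x ^+ 2 * 2 by rewrite ler_wpM2l//; lra.
by rewrite ler_norml => h; apply/andP; split; lra.
Qed.

Lemma expR_mul1B_perturbed (y q : R) : `|y| <= 2^-1 -> 0 <= q -> 0 <= 1 - y + q ->
  expR y * (1 - y + q) <= 1 + 2 * y ^+ 2 + 2 * q.
Proof.
move=> yb q0 b0; have /andP[y1 y2] : - 2^-1 <= y <= 2^-1 by rewrite -ler_norml.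
apply: le_trans (ler_wpM2r b0 (expR_quad yb)) _.
have -> : (1 + y + 2 * y ^+ 2) * (1 - y + q) =
   1 + y ^+ 2 * (1 - 2 * y) + (1 + y + 2 * y ^+ 2) * q by ring.
have h1 : 1 + y + 2 * y ^+ 2 <= 2 by nra.
have h2 := ler_wpM2r q0 h1.
have : y ^+ 2 * (1 - 2 * y) <= y ^+ 2 * 2 by rewrite ler_wpM2l ?sqr_ge0//; lra.
lra.
Qed.

(** The four quantities are the means and second moments of the two noises of
    [step_noise], evaluated by [polyexp_moments].  In the last two the terms of
    first order in [D] cancel. *)
Lemma step_bounds (sg a : R) : exists C D0 : R, [/\ 0 < C, 0 < D0 &
  forall D, 0 < D -> D <= D0 ->
   let x := (sg ^+ 2 - a) * D in let y := (3 * sg ^+ 2 - 2 * a) * D in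
   [/\ `|expR x - 1| <= C * D,
       expR y - 2 * expR x + 1 <= C * D,
       `|expR x * (1 - x) - 1| <= C * D ^+ 2 &
       expR y * ((1 + a * D - 2 * sg ^+ 2 * D) ^+ 2 + sg ^+ 2 * D)
         - 2 * (expR x * (1 - x)) + 1 <= C * D ^+ 2]].
Proof.
pose p := sg ^+ 2 - a; pose p2 := 3 * sg ^+ 2 - 2 * a; pose q := (a - 2 * sg ^+ 2) ^+ 2.
have q0 : 0 <= q by exact: sqr_ge0.
have s0 : 0 <= sg ^+ 2 by exact: sqr_ge0.
have p20 : 0 <= p ^+ 2 by exact: sqr_ge0.
have p220 : 0 <= p2 ^+ 2 by exact: sqr_ge0.
have np : 0 <= `|p| by []. have np2 : 0 <= `|p2| by [].
pose C := 2 * `|p| + sg ^+ 2 + 2 * p2 ^+ 2 + 4 * p ^+ 2 + 2 * q + 1.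
pose D0 := (2 * (`|p| + `|p2| + 1))^-1.
have dpos : 0 < 2 * (`|p| + `|p2| + 1) by lra.
exists C, D0; split; [by rewrite /C; lra|by rewrite invr_gt0|] => D Dpos DD0 x y.
have hD : 2 * (`|p| + `|p2| + 1) * D <= 1.
  by rewrite mulrC -ler_pdivlMr// mul1r.
have D1 : D <= 2^-1 by nra.
have xb : `|x| <= 2^-1 by rewrite /x normrM (gtr0_norm Dpos) -/p; nra.
have yb : `|y| <= 2^-1 by rewrite /y normrM (gtr0_norm Dpos) -/p2; nra.
have xx : x ^+ 2 = p ^+ 2 * D ^+ 2 by rewrite /x -/p exprMn.
have yy : y ^+ 2 = p2 ^+ 2 * D ^+ 2 by rewrite /y -/p2 exprMn.
have DD : D ^+ 2 <= D by rewrite expr2; nra.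
have D20 : 0 <= D ^+ 2 by exact: sqr_ge0.
have D00 := ltW Dpos.
have b1 := expR_sub1_norm xb; have b3 := expR_mul1B_norm xb.
split.
- apply: le_trans b1 _; rewrite /x normrM (gtr0_norm Dpos) -/p mulrA.
  by rewrite ler_wpM2r// /C; lra.
- have e1 := expR_ge1Dx x; have e2 := expR_quad yb.
  apply: (@le_trans _ _ (y - 2 * x + 2 * y ^+ 2)); first by clear -e1 e2; lra.
  have -> : y - 2 * x = sg ^+ 2 * D by rewrite /y /x; ring.
  apply: (@le_trans _ _ ((sg ^+ 2 + 2 * p2 ^+ 2) * D)).
    by rewrite yy [leRHS]mulrDl lerD2l mulrA ler_wpM2l// mulr_ge0.
  by rewrite ler_wpM2r// /C; lra.
- apply: le_trans b3 _; rewrite xx mulrA ler_wpM2r// /C; lra.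
- have BE : (1 + a * D - 2 * sg ^+ 2 * D) ^+ 2 + sg ^+ 2 * D = 1 - y + q * D ^+ 2.
    by rewrite /y /q; ring.
  have B0 : 0 <= 1 - y + q * D ^+ 2.
    by rewrite -BE addr_ge0 ?sqr_ge0// mulr_ge0.
  have b4 := expR_mul1B_perturbed yb (mulr_ge0 q0 D20) B0; rewrite BE.
  apply: (@le_trans _ _ (2 * y ^+ 2 + 2 * (q * D ^+ 2) + 4 * x ^+ 2)).
    by move: b3; rewrite ler_norml => /andP[b3 _]; clear -b3 b4; lra.
  rewrite [leLHS](_ : _ = (2 * p2 ^+ 2 + 2 * q + 4 * p ^+ 2) * D ^+ 2).
    by rewrite ler_wpM2r// /C; lra.
  by rewrite xx yy; ring.
Qed.

Notation Q s := (normal_prob 0 s).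

Lemma normal_integralE (s : R) (f : R -> R) : (Q s).-integrable setT (EFin \o f) ->
  (\int[Q s]_y (f y)%:E = (\int[Q s]_y f y)%:E)%E.
Proof. by move=> h; rewrite /Rintegral fineK//; exact: integrable_fin_num h. Qed.

(** An affine function times an exponential, minus one: both noises of
    [step_noise] have this form. *)
Lemma polyexp_moments (s l al be : R) : 0 < s ->
  let phi y := (al + be * y) * expR (l * y) - 1 in
  let M1 := (al + be * (l * s ^+ 2)) * expR (l ^+ 2 * s ^+ 2 / 2) in
  let M2 := (al ^+ 2 + 2 * al * be * (2 * l * s ^+ 2) + be ^+ 2 * (s ^+ 2 + 4 * l ^+ 2 * s ^+ 4))
     * expR (2 * l ^+ 2 * s ^+ 2) in
  [/\ measurable_fun setT phi,
   (Q s).-integrable setT (EFin \o phi),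
   (\int[Q s]_y (phi y)%:E = (M1 - 1)%:E)%E,
   (Q s).-integrable setT (EFin \o (fun y => phi y ^+ 2)) &
   (\int[Q s]_y (phi y ^+ 2)%:E = (M2 - 2 * M1 + 1)%:E)%E].
Proof.
move=> s0 phi M1 M2.
have i0 l' := integrable_polyexp s0 0 l'.
have i1 l' := integrable_polyexp s0 1 l'.
have i2 l' := integrable_polyexp s0 2 l'.
have ic (c : R) : (Q s).-integrable setT (EFin \o (fun _ : R => c)).
  exact: finite_measure_integrable_cst.
have iZ (c : R) (f : R -> R) : (Q s).-integrable setT (EFin \o f) ->
    (Q s).-integrable setT (EFin \o (fun y => c * f y)).
  by move=> h; apply: (integrableZl _ _ h).
have iD (f g : R -> R) : (Q s).-integrable setT (EFin \o f) -> (Q s).-integrable setT (EFin \o g) ->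
    (Q s).-integrable setT (EFin \o (fun y => f y + g y)).
  by move=> hf hg; apply: (integrableD _ hf hg).
pose P0 l' y : R := y ^+ 0 * expR (l' * y).
pose P1 l' y : R := y ^+ 1 * expR (l' * y).
pose P2 l' y : R := y ^+ 2 * expR (l' * y).
have E1 : phi = (fun y => (al * P0 l y + be * P1 l y) + -1).
  by apply/funext => y; rewrite /phi /P0 /P1 expr0 expr1; ring.
have E2 : (fun y => phi y ^+ 2) = (fun y => (al ^+ 2 * P0 (2 * l) y + (2 * al * be) * P1 (2 * l) y
     + be ^+ 2 * P2 (2 * l) y) + (-2 * al * P0 l y + -2 * be * P1 l y) + 1).
  apply/funext => y; rewrite /phi /P0 /P1 /P2 expr0 expr1.
  have -> : 2 * l * y = l * y + l * y by ring.
  rewrite expRD; ring.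
have s2 : 2 * l ^+ 2 * s ^+ 2 = (2 * l) ^+ 2 * s ^+ 2 / 2 by field.
have K0 c l' : (Q s).-integrable setT (EFin \o (fun y => c * P0 l' y)) by exact/iZ/i0.
have K1 c l' : (Q s).-integrable setT (EFin \o (fun y => c * P1 l' y)) by exact/iZ/i1.
have K2 c l' : (Q s).-integrable setT (EFin \o (fun y => c * P2 l' y)) by exact/iZ/i2.
have J1 : (Q s).-integrable setT (EFin \o (fun y => al * P0 l y + be * P1 l y)) by exact: (iD).
have I1 : (Q s).-integrable setT (EFin \o phi) by rewrite E1; exact: (iD).
have J2 : (Q s).-integrable setT (EFin \o (fun y => al ^+ 2 * P0 (2 * l) y + (2 * al * be) * P1 (2 * l) y)) by exact: (iD).
have J3 : (Q s).-integrable setT (EFin \o (fun y => al ^+ 2 * P0 (2 * l) y + (2 * al * be) * P1 (2 * l) y + be ^+ 2 * P2 (2 * l) y)) by exact: (iD).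
have J4 : (Q s).-integrable setT (EFin \o (fun y => -2 * al * P0 l y + -2 * be * P1 l y)) by exact: (iD).
have J5 : (Q s).-integrable setT (EFin \o (fun y => (al ^+ 2 * P0 (2 * l) y + (2 * al * be) * P1 (2 * l) y + be ^+ 2 * P2 (2 * l) y) + (-2 * al * P0 l y + -2 * be * P1 l y))) by exact: (iD).
have I2 : (Q s).-integrable setT (EFin \o (fun y => phi y ^+ 2)).
  by rewrite E2; exact: (iD).
have m0 l' := normal_mgf0 s0 l'; have m1 l' := normal_mgf1 s0 l'; have m2 l' := normal_mgf2 s0 l'.
have R0 c l' : \int[Q s]_y (c * P0 l' y) = c * expR (l' ^+ 2 * s ^+ 2 / 2).
  transitivity (c * \int[Q s]_y P0 l' y); last by rewrite /P0 m0.
  by apply: RintegralZl => //; exact: (i0).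
have R1 c l' : \int[Q s]_y (c * P1 l' y) = c * (l' * s ^+ 2 * expR (l' ^+ 2 * s ^+ 2 / 2)).
  transitivity (c * \int[Q s]_y P1 l' y); last by rewrite /P1 m1.
  by apply: RintegralZl => //; exact: (i1).
have R2 c l' : \int[Q s]_y (c * P2 l' y) = c * ((s ^+ 2 + l' ^+ 2 * s ^+ 4) * expR (l' ^+ 2 * s ^+ 2 / 2)).
  transitivity (c * \int[Q s]_y P2 l' y); last by rewrite /P2 m2.
  by apply: RintegralZl => //; exact: (i2).
have RC (c : R) : \int[Q s]_y c = c.
  transitivity (c * fine (Q s setT)); first exact: Rintegral_cst.
  by rewrite (_ : Q s setT = 1%E) ?mulr1//; exact: probability_setT.
split => //.
- rewrite /phi; apply: measurable_funB => //; apply: measurable_funM.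
    by apply: measurable_funD => //; exact: measurable_funM.
  by apply: measurableT_comp => //; exact: measurable_funM.
- rewrite normal_integralE//; congr (_%:E); rewrite E1 RintegralD// RintegralD//.
  rewrite R0 R1 RC /M1; ring.
- rewrite normal_integralE//; congr (_%:E); rewrite E2 RintegralD// RintegralD// RintegralD// RintegralD// RintegralD//.
  rewrite !R0 !R1 !R2 RC /M1 /M2 s2; ring.
Qed.

End step_moments.

Section noise_bound.
Context {R : realType}.
Notation Q s := (normal_prob 0 s).

(** At a centred normal variable of variance [D], [phi] has a mean of size at most
    [m0] and a variance at most [v]. *)
Definition centred_bound (D : R) (phi : R -> R) (m0 v : R) : Prop :=
  exists2 m : R, `|m| <= m0 &
  [/\ measurable_fun setT (fun y => phi y - m),
      (Q (Num.sqrt D)).-integrable setT (EFin \o (fun y => phi y - m)),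
      (\int[Q (Num.sqrt D)]_y (phi y - m)%:E = 0)%E &
      (\int[Q (Num.sqrt D)]_y ((phi y - m) ^+ 2)%:E <= v%:E)%E].

Lemma centred_boundP (D : R) (phi : R -> R) (m m2 m0 v : R) :
  measurable_fun setT phi ->
  (Q (Num.sqrt D)).-integrable setT (EFin \o phi) ->
  (\int[Q (Num.sqrt D)]_y (phi y)%:E = m%:E)%E ->
  (Q (Num.sqrt D)).-integrable setT (EFin \o (fun y => phi y ^+ 2)) ->
  (\int[Q (Num.sqrt D)]_y (phi y ^+ 2)%:E = m2%:E)%E ->
  `|m| <= m0 -> m2 <= v -> centred_bound D phi m0 v.
Proof.
move=> mphi i1 e1 i2 e2 hm hv; exists m => //.
have ic (c : R) : (Q (Num.sqrt D)).-integrable setT (EFin \o (fun _ : R => c)).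
  exact: finite_measure_integrable_cst.
have IC (c : R) : (\int[Q (Num.sqrt D)]_y c%:E = c%:E)%E.
  transitivity (c%:E * Q (Num.sqrt D) setT)%E; first exact: integral_cst.
  by rewrite (_ : Q (Num.sqrt D) setT = 1%E) ?mule1//; exact: probability_setT.
split.
- by apply: measurable_funB.
- exact: (integrableB _ i1 (ic m)).
- transitivity (\int[Q (Num.sqrt D)]_y ((phi y)%:E - m%:E))%E; first by apply: eq_integral.
  rewrite (integralB _ i1 (ic m))//= IC e1 subee//.
- have iZ : (Q (Num.sqrt D)).-integrable setT (EFin \o (fun y => (-2 * m) * phi y)).
    exact: (integrableZl _ _ i1).
  have iD : (Q (Num.sqrt D)).-integrable setT (EFin \o (fun y => phi y ^+ 2 + (-2 * m) * phi y)).
    exact: (integrableD _ i2 iZ).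
  rewrite [leLHS](_ : _ = \int[Q (Num.sqrt D)]_y ((phi y ^+ 2 + (-2 * m) * phi y)%:E + (m ^+ 2)%:E))%E; last first.
    by apply: eq_integral => y _; rewrite -EFinD; congr (_%:E); ring.
  rewrite (integralD _ iD (ic _))//= IC.
  rewrite (_ : (\int[Q (Num.sqrt D)]_x (phi x ^+ 2 + -2 * m * phi x)%:E)%E = (m2 + -2 * m * m)%:E); last first.
    transitivity (\int[Q (Num.sqrt D)]_y ((phi y ^+ 2)%:E + ((-2 * m) * phi y)%:E))%E.
      by apply: eq_integral => y _; rewrite -EFinD; congr (_%:E); ring.
    rewrite (integralD _ i2 iZ)//= e2.
    rewrite (_ : (\int[Q (Num.sqrt D)]_x (-2 * m * phi x)%:E)%E = (-2 * m * m)%:E).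
      by rewrite -EFinD; congr (_%:E); ring.
    transitivity (\int[Q (Num.sqrt D)]_y ((-2 * m)%:E * (phi y)%:E))%E; first by apply: eq_integral.
    by rewrite (integralZl _ i1)//= e1.
  rewrite -EFinD lee_fin; apply: le_trans hv.
  have := sqr_ge0 m; rewrite expr2; lra.
Qed.

(** Over a step of length [D] with Brownian increment [y], the first function is
    the relative increment of the discount factor, and the second one that of the
    discount factor times an Euler step of the equation.  As in the formula of Ito,
    the latter is [- sg ^+ 2 / 2 * (y ^+ 2 - D)] to leading order, which has mean
    zero and a variance of order [D ^+ 2]. *)
Lemma step_noise (sg a : R) : exists C D0 : R, [/\ 0 < C, 0 < D0 &
  forall D, 0 < D -> D <= D0 ->
    centred_bound D (fun y => expR (- sg * y - (a - sg ^+ 2 / 2) * D) - 1) (C * D) (C * D) /\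
    centred_bound D (fun y => expR (- sg * y - (a - sg ^+ 2 / 2) * D) * (1 + a * D + sg * y) - 1)
      (C * D ^+ 2) (C * D ^+ 2)].
Proof.
have [C [D0 [C0 D00 hb]]] := step_bounds sg a.
exists C, D0; split => // D Dp DD0.
have [b1 b2 b3 b4] := hb D Dp DD0.
have s0 : 0 < Num.sqrt D by rewrite sqrtr_gt0.
have sD : Num.sqrt D ^+ 2 = D by rewrite sqr_sqrtr// ltW.
have sD4 : Num.sqrt D ^+ 4 = D ^+ 2 by rewrite -[in RHS]sD -exprM.
pose b := (a - sg ^+ 2 / 2) * D.
set x := (sg ^+ 2 - a) * D in b1 b2 b3 b4.
set y0 := (3 * sg ^+ 2 - 2 * a) * D in b2 b4.
have ex : expR (- b) * expR ((- sg) ^+ 2 * D / 2) = expR x.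
  by rewrite -expRD; congr expR; rewrite /b /x; field.
have ey : expR (- b) ^+ 2 * expR (2 * (- sg) ^+ 2 * D) = expR y0.
  by rewrite -expRM_natl -expRD; congr expR; rewrite /b /y0; field.
split.
- have := polyexp_moments (- sg) (expR (- b)) 0 s0.
  rewrite /= sD sD4 => -[h1 h2 h3 h4 h5].
  have E : (fun y : R => expR (- sg * y - (a - sg ^+ 2 / 2) * D) - 1) =
           (fun y => (expR (- b) + 0 * y) * expR (- sg * y) - 1).
    by apply/funext => y; rewrite mul0r addr0 -expRD (addrC (- b)).
  rewrite E; apply: (centred_boundP h1 h2 h3 h4 h5).
    rewrite (_ : _ - 1 = expR x - 1)// -ex; ring.
  rewrite (_ : _ + 1 = expR y0 - 2 * expR x + 1)// -ey -ex; ring.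
- have := polyexp_moments (- sg) ((1 + a * D) * expR (- b)) (sg * expR (- b)) s0.
  rewrite /= sD sD4 => -[h1 h2 h3 h4 h5].
  have E : (fun y : R => expR (- sg * y - (a - sg ^+ 2 / 2) * D) * (1 + a * D + sg * y) - 1) =
           (fun y => ((1 + a * D) * expR (- b) + sg * expR (- b) * y) * expR (- sg * y) - 1).
    by apply/funext => y; rewrite expRD -/b; ring.
  rewrite E; apply: (centred_boundP h1 h2 h3 h4 h5).
    rewrite (_ : _ - 1 = expR x * (1 - x) - 1)// -ex /x; ring.
  rewrite (_ : _ + 1 = expR y0 * ((1 + a * D - 2 * sg ^+ 2 * D) ^+ 2 + sg ^+ 2 * D)
         - 2 * (expR x * (1 - x)) + 1)// -ey -ex /x; ring.
Qed.

Context {d : measure_display} {T : measurableType d}.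
Context (P : probability T R) (F : R -> set_system T).
Hypothesis hF : filtration F.
Variable V : process R T.
Hypothesis hV : brownian_motion P F V.

(** [lenglart] for the centred noise; the means contribute at most [n * m0 * kap]. *)
Lemma noise_bound (n : nat) (u : nat -> R) (c : nat -> T -> R) (phi : R -> R) (D m0 v kap e : R) :
  0 <= u 0 -> 0 < D -> (forall i, u i.+1 - u i = D) ->
  (forall i, measurable_wrt (F (u i)) (c i)) -> 0 <= m0 -> 0 <= v -> 0 < kap -> 0 < e ->
  centred_bound D phi m0 v ->
  small P [set w | (forall i, (i < n)%N -> `|c i w| <= kap) /\
     e + n%:R * m0 * kap <= `|\sum_(i < n) c i w * phi (increment V (u i) (u i.+1) w)|]
    (n%:R * kap ^+ 2 * v / e ^+ 2).
Proof.
move=> u0 D0 uD hc m00 v0 k0 e0 [m hm [h1 h2 h3 h4]].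
have hu i : (i < n)%N -> u i < u i.+1 by move=> _; rewrite -subr_gt0 uD.
have := @lenglart _ _ _ P F hF V hV n u c (fun _ y => phi y - m) (fun _ => v) u0 hu
  (fun i _ => hc i) _ _ _ _ (n%:R * kap ^+ 2 * v) e _ e0.
move=> /(_ _ _ _ _ _)/small_sub; apply.
- move=> w [hk hw]; split.
    rewrite -mulr_suml ler_wpM2r//.
    apply: (@le_trans _ _ (\sum_(i < n) kap ^+ 2)); last by rewrite sumr_const card_ord mulr_natl.
    apply: ler_sum => i _; rewrite -[leLHS]real_normK ?num_real// ler_pXn2r ?nnegrE ?hk//.
    exact: ltW.
  exists n => //; rewrite /noise_sum.
  under eq_bigr do rewrite mulrBr.
  rewrite sumrB -mulr_suml.
  have h5 : `|(\sum_(i < n) c i w) * m| <= n%:R * m0 * kap.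
    rewrite normrM mulrAC; apply: ler_pM => //.
    apply: le_trans (ler_norm_sum _ _ _) _.
    apply: (@le_trans _ _ (\sum_(i < n) kap)); last by rewrite sumr_const card_ord mulr_natl.
    by apply: ler_sum => i _; exact: hk.
  move: hw h5; set A := \sum_(i < n) _ * phi _; set B := _ * m => hw h5.
  have := lerB_normD A (- B); rewrite normrN; lra.
- by move=> i _; exact: h1.
- by move=> i _; rewrite uD; exact: h2.
- by move=> i _; rewrite uD; exact: h3.
- by move=> i _; rewrite uD; exact: h4.
- by rewrite mulr_ge0// mulr_ge0// sqr_ge0.
Qed.

End noise_bound.

(** * The Euler sums of a geometric Brownian motion *)

Section gbm.
Context {R : realType} {d : measure_display} {T : measurableType d}.
Context (P : probability T R) (F : R -> set_system T).
Hypothesis hF : filtration F.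
Variable V : process R T.
Hypothesis hV : brownian_motion P F V.

Lemma continuous_pathsM (X Y : process R T) : continuous_paths X -> continuous_paths Y ->
  continuous_paths (fun t w => X t w * Y t w).
Proof. by move=> cX cY w x; apply: cvgM; [exact: cX|exact: cY]. Qed.

Lemma adaptedM (X Y : process R T) : adapted F X -> adapted F Y ->
  adapted F (fun t w => X t w * Y t w).
Proof.
by move=> aX aY t t0; apply: (measurable_wrtM (filtration_sigma hF t0)); [exact: aX|exact: aY].
Qed.

Lemma continuous_paths_cstM (X : process R T) (c : R) : continuous_paths X ->
  continuous_paths (fun t w => X t w * c).
Proof. by move=> cX w x; apply: cvgM; [exact: cX|exact: cvg_cst]. Qed.

Lemma adapted_cstM (X : process R T) (c : R) : adapted F X -> adapted F (fun t w => X t w * c).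
Proof.
move=> aX t t0; apply: (measurable_wrtM (filtration_sigma hF t0)); first exact: aX.
exact: (measurable_wrt_cst (filtration_sigma hF t0)).
Qed.

Definition exp_process (al be : R) : process R T := fun t w => expR (al * V t w + be * t).

Lemma continuous_exp_process al be : continuous_paths (exp_process al be).
Proof.
have [_ cV _ _ _] := hV.
move=> w x; apply: continuous_comp; last exact: continuous_expR.
apply: cvgD; first by apply: cvgM; [exact: cvg_cst|exact: cV].
have : {within `[(0 : R), +oo[, continuous (fun y : R => be * y)}.
  by apply: continuous_subspaceT => y; exact: mulrl_continuous.
by apply.
Qed.

Lemma adapted_exp_process al be : adapted F (exp_process al be).
Proof.
have [aV _ _ _ _] := hV.
move=> t t0; have sg := filtration_sigma hF t0.
apply: (measurable_wrt_comp sg (f := expR)); first exact: measurable_expR.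
apply: (measurable_wrtD sg); last exact: (measurable_wrt_cst sg).
by apply: (measurable_wrtM sg); [exact: (measurable_wrt_cst sg)|exact: aV].
Qed.

Variables (t : R).
Hypothesis t0 : 0 < t.

(** Proved with the bound [rho] times the length of the interval, which the
    induction on [k] preserves. *)
Lemma drift_riemann (h : R -> R) (rho del : R) N k :
  {within `[0, +oo[, continuous h} ->
  (forall u v, 0 <= u <= t -> 0 <= v <= t -> `|u - v| < del -> `|h u - h v| <= rho) ->
  t / N.+1%:R < del -> (k <= N.+1)%N ->
  `|(\int[lebesgue_measure]_(s in `[0, unif t N k]) h s)%R - \sum_(i < k) h (unif t N i) * (t / N.+1%:R)|
    <= rho * unif t N k.
Proof.
move=> ch hh mesh; elim: k => [|k IH] kN.
  by rewrite big_ord0 subr0 /unif mul0r mulr0 set_itv1 Rintegral_set1 normr0.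
pose D := t / N.+1%:R; have D0 : 0 < D by exact: unif_mesh.
have kN' := ltnW kN.
have uk := unif_lt t0 N k; have u0 := unif_ge0 t0 N k; have ut := unif_le t0 kN.
have ic (b : R) : lebesgue_measure.-integrable `[0, b] (EFin \o h).
  apply: continuous_compact_integrable; first exact: segment_compact.
  by apply: continuous_subspaceW ch => x /=; rewrite !in_itv/= => /andP[-> _].
have ioc : lebesgue_measure.-integrable `]unif t N k, unif t N k.+1] (EFin \o h).
  apply: integrableS (ic (unif t N k.+1)) => // x /=; rewrite !in_itv/= => /andP[h1 ->].
  by rewrite andbT (le_trans u0 (ltW h1)).
have icst (c : R) : lebesgue_measure.-integrable `]unif t N k, unif t N k.+1] (EFin \o (fun _ : R => c)).
  have icc : lebesgue_measure.-integrable `[unif t N k, unif t N k.+1] (EFin \o (fun _ : R => c)).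
    apply: continuous_compact_integrable; first exact: segment_compact.
    by apply: continuous_subspaceT => x; exact: cvg_cst.
  apply: integrableS icc => // x /=; rewrite !in_itv/= => /andP[h1 ->].
  by rewrite andbT ltW.
have split_int : (\int[lebesgue_measure]_(s in `[0, unif t N k.+1]) h s)%R =
   (\int[lebesgue_measure]_(s in `[0, unif t N k]) h s)%R +
   (\int[lebesgue_measure]_(s in `]unif t N k, unif t N k.+1]) h s)%R.
  have := @Rintegral_itvB R h (BLeft 0) (BRight (unif t N k.+1)) (unif t N k) (ic _).
  rewrite !bnd_simp => /(_ u0 (ltW uk)) <-; by rewrite addrC subrK.
have hD c : (\int[lebesgue_measure]_(s in `]unif t N k, unif t N k.+1]) c)%R = c * D.
  rewrite Rintegral_cst//; congr (_ * _).
  have E := lebesgue_measure_itv `]unif t N k, unif t N k.+1].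
  transitivity (fine ((unif t N k.+1)%:E - (unif t N k)%:E)%E).
    by congr fine; apply: etrans E _; rewrite /= lte_fin uk.
  by rewrite -EFinB /= unifS /D addrC addKr.
have bd s : `]unif t N k, unif t N k.+1]%classic s -> `|h s - h (unif t N k)| <= rho.
  rewrite /= in_itv/= => /andP[s1 s2]; apply: hh.
  - by rewrite (le_trans u0 (ltW s1)) (le_trans s2 ut).
  - by rewrite u0 unif_le.
  - rewrite gtr0_norm ?subr_gt0//; move: s2 mesh; rewrite unifS; move: (t / _) => q; lra.
have lo : (h (unif t N k) - rho) * D <= (\int[lebesgue_measure]_(s in `]unif t N k, unif t N k.+1]) h s)%R.
  rewrite -hD; apply: le_Rintegral => // s /bd; rewrite ler_norml => /andP[]; lra.
have hi : (\int[lebesgue_measure]_(s in `]unif t N k, unif t N k.+1]) h s)%R <= (h (unif t N k) + rho) * D.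
  rewrite -hD; apply: le_Rintegral => // s /bd.
  by rewrite ler_norml => /andP[_]; rewrite lerBlDl.
rewrite split_int big_ord_recr/= opprD addrACA.
move: lo hi; move: (\int[lebesgue_measure]_(s in `]unif t N k, unif t N k.+1]) h s)%R => I1 lo hi.
apply: le_trans (ler_normD _ _) _; rewrite unifS mulrDr lerD ?IH//.
move: lo hi D0; rewrite -/D ler_norml; move: (h _) => p; clear => lo hi D0; apply/andP; split; lra.
Qed.

Variables (sg a z : R) (Z : process R T).
Hypothesis hZ : geometric_brownian_motion P F V sg a z Z.

(** The coefficients are the values of [Z] itself, so that this is the Riemann sum
    of the equation of [Z], and not a recursion. *)
Definition euler N k w : R := z + \sum_(i < k)
   Z (unif t N i) w * (sg * increment V (unif t N i) (unif t N i.+1) w + a * (t / N.+1%:R)).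

(** The stochastic part is [riem_int_unif]; the drift is an ordinary Riemann sum of
    a path with a small modulus of continuity. *)
Lemma euler_close (e r : R) : 0 < e -> 0 < r ->
  exists N0, forall N, (N0 <= N)%N ->
    small P [set w | exists2 k, (k <= N.+1)%N & e <= `|Z (unif t N k) w - euler N k w|] r.
Proof.
move=> e0 r0; have [aZ cZ eqZ] := hZ.
have aH := adapted_cstM sg aZ; have cH := @continuous_paths_cstM Z sg cZ.
have /choice[J hJ] : forall s : R, exists J : T -> R, 0 <= s -> is_ito_integral P F V (fun s w => Z s w * sg) s J /\
    {ae P, forall w, Z s w = z + (J w + (\int[lebesgue_measure]_(v in `[0, s]) (Z v w * a))%R)}.
  move=> s; have [s0|s0] := leP 0 s; last first.
    by exists (fun _ => 0) => h; move: s0; rewrite ltNge h.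
  by have [J h1 h2] := eqZ s s0; exists J => _; split.
have e20 : 0 < e / 2 by rewrite divr_gt0.
have r30 : 0 < r / 3 by rewrite divr_gt0.
have hJ1 s : 0 <= s <= t -> is_ito_integral P F V (fun s w => Z s w * sg) s (J s).
  by move=> /andP[s0 _]; have [] := hJ s s0.
have [N1 hN1] := riem_int_unif hF aH cH t0 hV hJ1 e20 r30.
have a10 : 0 < `|a| + 1 by rewrite ltr_pwDr.
have [rho rho0 rhoE] : exists2 rho, 0 < rho & (`|a| + 1) * rho * t = e / 4.
  exists (e / (4 * ((`|a| + 1) * t))); first by rewrite divr_gt0 ?mulr_gt0.
  by field; rewrite !gt_eqF.
have [del del0 hm] := path_modulus P hF aZ cZ t0 rho0 r30.
exists (maxn N1 (Num.trunc (t / del))) => N; rewrite geq_max => /andP[hNa hNb].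
have mesh : t / N.+1%:R < del.
  rewrite ltr_pdivrMr// mulrC -ltr_pdivrMr//.
  by apply: lt_le_trans (truncnS_gt _) _; rewrite ler_nat ltnS.
have hneg k : (k < N.+2)%N -> small P [set w | ~ (Z (unif t N k) w = z + (J (unif t N k) w + (\int[lebesgue_measure]_(v in `[0, unif t N k]) (Z v w * a))%R))] (r / 3 / N.+2%:R).
  move=> _; apply: negligible_small; first by rewrite ltW// divr_gt0.
  by have [_] := hJ _ (unif_ge0 t0 N k).
apply: small_le (_ : N.+2%:R * (r / 3 / N.+2%:R) + (r / 3 + r / 3) <= _) _.
  by rewrite (mulrC N.+2%:R) divfK ?pnatr_eq0//; lra.
apply: small_sub (smallU (small_finite hneg) (smallU (hN1 N hNa) hm)) => w [k kN hw].
have [h1|h1] := pselect (Z (unif t N k) w = z + (J (unif t N k) w + (\int[lebesgue_measure]_(v in `[0, unif t N k]) (Z v w * a))%R)); last by left; exists k.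
right; have [h2|h2] := leP (e / 2) `|elem_int (riem (fun s w => Z s w * sg) t N) V (unif t N k) w - J (unif t N k) w|.
  by left; exists k.
right; apply: contrapT => hno.
have hd := @drift_riemann (fun s => Z s w * a) (`|a| * rho) del N k (@continuous_paths_cstM Z a cZ w) _ mesh kN.
have {}hd := hd _.
have hda : `|(\int[lebesgue_measure]_(s in `[0, unif t N k]) (Z s w * a))%R -
     \sum_(i < k) Z (unif t N i) w * a * (t / N.+1%:R)| <= e / 4.
  apply: le_trans (hd _) _.
    move=> u v hu hv uv; rewrite -mulrBl normrM mulrC ler_wpM2l//.
    by rewrite leNgt; apply/negP => h; apply: hno; exists u, v.
  apply: (@le_trans _ _ ((`|a| + 1) * rho * t)).
    apply: ler_pM; rewrite ?mulr_ge0 ?(ltW rho0) ?(unif_ge0 t0) ?unif_le ?(ltW t0)//.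
    by rewrite ler_wpM2r ?(ltW rho0)// lerDl.
  by rewrite rhoE.
move: hw; rewrite h1 /euler; apply/negP; rewrite -ltNge.
move: h2; rewrite (riem_int (fun s w => Z s w * sg) t0)// => h2.
set A := J _ w in h2 *; set I0 := (\int[_]_(_ in _) _)%R in hda *.
set S1 := \sum_(i < k) _ in h2; set S2 := \sum_(i < k) _ in hda.
rewrite (_ : \sum_(i < k) _ = S1 + S2); last first.
  by rewrite -big_split/=; apply: eq_bigr => i _; ring.
have -> : z + (A + I0) - (z + (S1 + S2)) = - (S1 - A) + (I0 - S2) by ring.
apply: le_lt_trans (ler_normD _ _) _; rewrite normrN; move: h2 hda e0; clear; lra.
Qed.

End gbm.

(** * The explicit form of a geometric Brownian motion *)

Section identification.
Context {R : realType} {d : measure_display} {T : measurableType d}.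
Context (P : probability T R) (F : R -> set_system T).
Hypothesis hF : filtration F.
Variable V : process R T.
Hypothesis hV : brownian_motion P F V.
Variables (sg a z : R) (Z : process R T).
Hypothesis hZ : geometric_brownian_motion P F V sg a z Z.

Lemma pos_threshold (A B : R) : 0 < A -> 0 < B ->
  exists2 x0, 0 < x0 & forall x, x <= x0 -> A * x <= B.
Proof.
move=> A0 B0; exists (B / A); first by rewrite divr_gt0.
by move=> x; rewrite ler_pdivlMr// mulrC.
Qed.

(** The inverse of the explicit solution started at 1. *)
Definition discount : process R T := exp_process V (- sg) (- (a - sg ^+ 2 / 2)).

Lemma discount0 w : discount 0 w = 1.
Proof. by have [_ _ V0 _ _] := hV; rewrite /discount /exp_process V0 !mulr0 addr0 expR0. Qed.

Lemma discount_step s D w :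
  discount (s + D) w = discount s w *
    expR (- sg * increment V s (s + D) w - (a - sg ^+ 2 / 2) * D).
Proof. by rewrite /discount /exp_process -expRD /increment; congr expR; ring. Qed.

(** Summation by parts.  Only the first sum would be there if the Euler sum were
    equal to [Z] at the grid points; the second one carries the difference. *)
Lemma euler_identity t N k w : let D := t / N.+1%:R in let u := unif t N in
  discount (u k) w * euler V t sg a z Z N k w - z =
  \sum_(i < k) discount (u i) w * Z (u i) w *
     (expR (- sg * increment V (u i) (u i.+1) w - (a - sg ^+ 2 / 2) * D) *
        (1 + a * D + sg * increment V (u i) (u i.+1) w) - 1)
  - \sum_(i < k) discount (u i) w * (Z (u i) w - euler V t sg a z Z N i w) *
     (expR (- sg * increment V (u i) (u i.+1) w - (a - sg ^+ 2 / 2) * D) - 1).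
Proof.
move=> D u; elim: k => [|k IH].
  by rewrite !big_ord0 /u /unif mul0r discount0 /euler big_ord0; ring.
rewrite !big_ord_recr/= [X in _ = X](_ : _ = discount (u k) w * euler V t sg a z Z N k w - z +
  discount (u k) w * Z (u k) w *
     (expR (- sg * increment V (u k) (u k.+1) w - (a - sg ^+ 2 / 2) * D) *
        (1 + a * D + sg * increment V (u k) (u k.+1) w) - 1)
  - discount (u k) w * (Z (u k) w - euler V t sg a z Z N k w) *
     (expR (- sg * increment V (u k) (u k.+1) w - (a - sg ^+ 2 / 2) * D) - 1)); last first.
  by rewrite IH; ring.
have -> : discount (u k.+1) w = discount (u k) w *
    expR (- sg * increment V (u k) (u k.+1) w - (a - sg ^+ 2 / 2) * D).
  by rewrite {1}/u unifS discount_step -unifS.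
have -> : euler V t sg a z Z N k.+1 w = euler V t sg a z Z N k w +
   Z (u k) w * (sg * increment V (u k) (u k.+1) w + a * D).
  by rewrite /euler big_ord_recr/= addrA.
ring.
Qed.

(** With [n] steps of length [D = t / n], the noise of the first sum of
    [euler_identity] has variance of order [n * D ^+ 2], which tends to 0.  That of
    the second sum has only [n * D = t], but its coefficients contain the Euler
    error, which is made small first. *)
Lemma discounted_close t (e r : R) : 0 < t -> 0 < e -> 0 < r ->
  small P [set w | e <= `|discount t w * Z t w - z|] r.
Proof.
move=> t0 e0 r0; have [aZ cZ _] := hZ.
have aE : adapted F discount by exact: (adapted_exp_process hF hV).
have cE : continuous_paths discount by exact: (continuous_exp_process hV).
have r50 : 0 < r / 5 by rewrite divr_gt0.
have [K1 K10 hK1] := path_tight P hF aE cE t0 r50.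
have [K2 K20 hK2] := path_tight P hF (adaptedM hF aE aZ) (continuous_pathsM cE cZ) t0 r50.
have [C [D0 [C0 D00 hstep]]] := step_noise sg a.
have [K [K0 hK1' hK2']] : exists K, [/\ 0 < K, K1 <= K & K2 <= K].
  by exists (K1 + K2); rewrite addr_gt0 ?lerDl ?lerDr// !ltW.
have [e' e'0 e'E] : exists2 e' : R, 0 < e' & 8 * e' = e by exists (e / 8); [rewrite divr_gt0|field].
(* [eta] bounds the Euler error at the grid points and does not depend on the mesh. *)
have [eta [eta0 h1 h2 h3]] : exists eta, [/\ 0 < eta, K * eta <= e', C * t * K * eta <= e' &
    C * t * K ^+ 2 * eta ^+ 2 / e' ^+ 2 <= r / 5].
  have [x1 x10 hx1] := pos_threshold K0 e'0.
  have [x2 x20 hx2] := pos_threshold (mulr_gt0 (mulr_gt0 C0 t0) K0) e'0.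
  have [x3 x30 hx3] : exists2 x0, 0 < x0 & forall x, x <= x0 -> C * t * K ^+ 2 / e' ^+ 2 * x <= r / 5.
    by apply: pos_threshold => //; rewrite divr_gt0 ?mulr_gt0 ?exprn_gt0.
  exists (Num.min 1 (Num.min x1 (Num.min x2 x3))).
  set m := Num.min _ _; have m0 : 0 < m by rewrite !lt_min ltr01 x10 x20 x30.
  have : m <= m by []; rewrite {2}/m !le_min => /and4P[m1 mx1 mx2 mx3].
  split => //; [exact: hx1|exact: hx2|].
  apply: le_trans (hx3 m mx3); rewrite mulrAC; apply: ler_wpM2l; last by rewrite expr2 ger_pMl.
  by rewrite ltW// divr_gt0 ?mulr_gt0 ?exprn_gt0.
have [D1 [D10 D11 h4 h5]] : exists D1, [/\ 0 < D1, D1 <= D0 , C * t * D1 * K <= e' &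
    K ^+ 2 * C * t * D1 / e' ^+ 2 <= r / 5].
  have [x2 x20 hx2] := pos_threshold (mulr_gt0 (mulr_gt0 C0 t0) K0) e'0.
  have [x3 x30 hx3] : exists2 x0, 0 < x0 & forall x, x <= x0 -> K ^+ 2 * C * t / e' ^+ 2 * x <= r / 5.
    by apply: pos_threshold => //; rewrite divr_gt0 ?mulr_gt0 ?exprn_gt0.
  exists (Num.min D0 (Num.min x2 x3)).
  set m := Num.min _ _; have m0 : 0 < m by rewrite !lt_min D00 x20 x30.
  have : m <= m by []; rewrite {2}/m !le_min => /and3P[m1 mx2 mx3].
  split => //; first by rewrite mulrAC; exact: hx2.
  by rewrite mulrAC; exact: hx3.
have [N0 hN0] := euler_close hF hV t0 hZ eta0 r50.
have [N NN0 ND] : exists2 N, (N0 <= N)%N & t / N.+1%:R <= D1.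
  exists (maxn N0 (Num.trunc (t / D1))); first by rewrite leq_maxl.
  rewrite ler_pdivrMr// mulrC -ler_pdivrMr// ltW//.
  by apply: lt_le_trans (truncnS_gt _) _; rewrite ler_nat ltnS leq_maxr.
have Dp := unif_mesh t0 N.
have [cb1 cb2] := hstep _ Dp (le_trans ND D11).
have nD : N.+1%:R * (t / N.+1%:R) = t by rewrite mulrC divfK// pnatr_eq0.
set D := t / N.+1%:R in Dp cb1 cb2 nD ND.
have u0 k := unif_ge0 t0 N k.
have uD i : unif t N i.+1 - unif t N i = D by rewrite unifS addrC addKr.
have mE i : measurable_wrt (F (unif t N i)) (discount (unif t N i)) by exact: aE.
have mEZ i : measurable_wrt (F (unif t N i)) (fun w => discount (unif t N i) w * Z (unif t N i) w).
  exact: (adaptedM hF aE aZ).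
have sgi i := filtration_sigma hF (u0 i).
have meu i : measurable_wrt (F (unif t N i)) (fun w => euler V t sg a z Z N i w).
  apply: (measurable_wrtD (sgi i)); first exact: (measurable_wrt_cst (sgi i)).
  apply: (measurable_wrt_sum (sgi i)) => -[j ji]; have ji' := unif_mono t0 N (ltnW ji).
  apply: (measurable_wrtM (sgi i)).
    by apply: (measurable_wrt_le hF (u0 j) ji'); exact: aZ.
  apply: (measurable_wrtD (sgi i)); last exact: (measurable_wrt_cst (sgi i)).
  apply: (measurable_wrtM (sgi i)); first exact: (measurable_wrt_cst (sgi i)).
  have [aV _ _ _ _] := hV.
  apply: (measurable_wrtB (sgi i)).
    by apply: (measurable_wrt_le hF (u0 j.+1) (unif_mono t0 N ji)); exact: aV.
  by apply: (measurable_wrt_le hF (u0 j) ji'); exact: aV.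
have mEe i : measurable_wrt (F (unif t N i))
    (fun w => discount (unif t N i) w * (Z (unif t N i) w - euler V t sg a z Z N i w)).
  apply: (measurable_wrtM (sgi i)) (mE i) _.
  by apply: (measurable_wrtB (sgi i)) (meu i); exact: aZ.
have CD0 : 0 <= C * D by rewrite ltW// mulr_gt0.
have CD20 : 0 <= C * D ^+ 2 by rewrite ltW// mulr_gt0// exprn_gt0.
have Ke0 : 0 < K * eta by rewrite mulr_gt0.
have n2 := noise_bound hF hV N.+1 (u0 0%N) Dp uD mEZ CD20 CD20 K0 e'0 cb2.
have n1 := noise_bound hF hV N.+1 (u0 0%N) Dp uD mEe CD0 CD0 Ke0 e'0 cb1.
have {}n2 := small_le _ n2.
have {}n1 := small_le _ n1.
apply: small_le (_ : r / 5 + (r / 5 + (r / 5 + (r / 5 + r / 5))) <= _) _; first by lra.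
apply: small_sub (smallU hK1 (smallU hK2 (smallU (hN0 N NN0) (smallU (n2 (r / 5) _) (n1 (r / 5) _))))); last 2 first.
- apply: le_trans h5; rewrite ler_wpM2r ?invr_ge0 ?exprn_ge0 ?(ltW e'0)//.
  rewrite [leLHS](_ : _ = K ^+ 2 * C * (N.+1%:R * D) * D); last by ring.
  by rewrite nD ler_wpM2l// !mulr_ge0// ltW.
- apply: le_trans h3; rewrite ler_wpM2r ?invr_ge0 ?exprn_ge0 ?(ltW e'0)//.
  rewrite [leLHS](_ : _ = C * (N.+1%:R * D) * K ^+ 2 * eta ^+ 2); last by ring.
  by rewrite nD.
move=> w /= hw.
have [b1|b1] := pselect (exists2 u, 0 <= u <= t & K1 < `|discount u w|); first by left.
have [b2|b2] := pselect (exists2 u, 0 <= u <= t & K2 < `|discount u w * Z u w|); first by right; left.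
have [b3|b3] := pselect (exists2 k, (k <= N.+1)%N & eta <= `|Z (unif t N k) w - euler V t sg a z Z N k w|).
  by right; right; left.
right; right; right.
have g1 k : (k <= N.+1)%N -> `|discount (unif t N k) w| <= K.
  move=> kN; apply: le_trans hK1'; rewrite leNgt; apply/negP => h; apply: b1; exists (unif t N k) => //.
  by rewrite u0 unif_le.
have g2 k : (k <= N.+1)%N -> `|discount (unif t N k) w * Z (unif t N k) w| <= K.
  move=> kN; apply: le_trans hK2'; rewrite leNgt; apply/negP => h; apply: b2; exists (unif t N k) => //.
  by rewrite u0 unif_le.
have g3 k : (k <= N.+1)%N -> `|Z (unif t N k) w - euler V t sg a z Z N k w| <= eta.
  move=> kN; rewrite leNgt; apply/negP => h; apply: b3; exists k => //; exact: ltW.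
apply: contrapT => /not_orP[c2 c1].
move: hw; apply/negP; rewrite -ltNge.
have E : discount t w * Z t w - z =
   discount (unif t N N.+1) w * (Z (unif t N N.+1) w - euler V t sg a z Z N N.+1 w) +
   (discount (unif t N N.+1) w * euler V t sg a z Z N N.+1 w - z).
  by rewrite unif_last; ring.
rewrite E euler_identity -/D.
set S2 := \sum_(i < _) _ in c2 *; set S1 := \sum_(i < _) _ in c1 *.
have q2 : `|S2| < e' + N.+1%:R * (C * D ^+ 2) * K.
  rewrite ltNge; apply/negP => h; apply: c2; split => // i iN; exact: g2 (ltnW iN).
have q1 : `|S1| < e' + N.+1%:R * (C * D) * (K * eta).
  rewrite ltNge; apply/negP => h; apply: c1; split => // i iN.
  by rewrite normrM ler_pM// ?g1 ?g3// ltnW.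
have q3 : `|discount (unif t N N.+1) w * (Z (unif t N N.+1) w - euler V t sg a z Z N N.+1 w)| <= e'.
  by apply: le_trans h1; rewrite normrM ler_pM// ?g1 ?g3.
have q4 : N.+1%:R * (C * D ^+ 2) * K <= e'.
  apply: le_trans h4; rewrite [leLHS](_ : _ = C * (N.+1%:R * D) * K * D); last by ring.
  by rewrite nD [leRHS]mulrAC ler_wpM2l// !mulr_ge0// ltW.
have q5 : N.+1%:R * (C * D) * (K * eta) <= e'.
  by apply: le_trans h2; rewrite -[in leRHS]nD le_eqVlt; apply/orP; left; apply/eqP; ring.
apply: le_lt_trans (ler_normD _ _) _.
have := ler_normB S2 S1; rewrite -e'E; move: q1 q2 q3 q4 q5 e'0; clear; lra.
Qed.

Lemma discounted_ae t : 0 < t -> P.-negligible [set w | discount t w * Z t w <> z].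
Proof.
move=> t0.
have h n : P.-negligible [set w | n.+1%:R^-1 <= `|discount t w * Z t w - z|].
  by apply: small_negligible => r r0; apply: discounted_close.
apply: negligibleS (negligible_bigcup h) => w /= hw.
have q : 0 < `|discount t w * Z t w - z| by rewrite normr_gt0 subr_eq0; apply/eqP.
exists (Num.trunc (`|discount t w * Z t w - z|^-1)) => //=.
by rewrite invf_ple ?posrE// ltW// truncnS_gt.
Qed.

(** The equation determines the process: its discounted value is almost surely
    equal to [z] at each positive rational time, hence at all times by continuity. *)
Lemma gbm_explicit : {ae P, forall w, forall t, 0 <= t ->
  Z t w = z * expR (sg * V t w + (a - sg ^+ 2 / 2) * t)}.
Proof.
have [aZ cZ _] := hZ.
have h n k := @discounted_ae (k.+1%:R / n.+1%:R) (divr_gt0 (ltr0Sn R k) (ltr0Sn R n)).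
apply: negligibleS (negligible_bigcup (fun n => negligible_bigcup (h n))) => w /= hw.
apply: contrapT => hno; apply: hw => t t0.
have Gt : discount t w * Z t w = z.
  apply: contrapT => /eqP; rewrite -subr_eq0 -normr_gt0 => e0.
  have cG := continuous_pathsM (continuous_exp_process hV (al := - sg) (be := - (a - sg ^+ 2 / 2))) cZ.
  have [del del0 hdel] := path_eps cG w t0 e0.
  apply: hno; pose n := Num.trunc del^-1; exists n => //; exists (Num.trunc (t * n.+1%:R)) => //= E.
  have t1 : 0 <= t * n.+1%:R by rewrite mulr_ge0.
  have /andP[k1 k2] := truncn_itv t1.
  have nd : n.+1%:R^-1 < del by rewrite invf_plt ?posrE// truncnS_gt.
  move: k1 k2 E; set k := Num.trunc _; rewrite -ler_pdivrMr// -ltr_pdivlMr// => k1 k2 E.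
  have := hdel (k.+1%:R / n.+1%:R) (divr_ge0 (ler0n _ _) (ler0n _ _)).
  have kE : k.+1%:R / n.+1%:R = k%:R / n.+1%:R + n.+1%:R^-1 :> R by rewrite -natr1; field.
  rewrite gtr0_norm ?subr_gt0//.
  have -> : k.+1%:R / n.+1%:R - t < del.
    by rewrite kE ltrBlDl; apply: ler_ltD.
  by move=> /(_ isT); rewrite -/(discount _ w) -/(discount _ w) E distrC ltxx.
rewrite -Gt mulrC mulrA /discount /exp_process -expRD.
rewrite (_ : _ + _ = 0) ?expR0 ?mul1r//; ring.
Qed.

End identification.

(** * The coupling time and exponential rates *)

Section coupling_event.
Context {R : realType} {d : measure_display} {T : measurableType d}.
Context (P : probability T R) (F : R -> set_system T).
Hypothesis hF : filtration F.
Variables X Y : process R T.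
Hypotheses (aX : adapted F X) (cX : continuous_paths X).
Hypotheses (aY : adapted F Y) (cY : continuous_paths Y).

Let G : process R T := fun t w => X t w - Y t w.

Let cG : continuous_paths G.
Proof. by move=> w x; apply: cvgB; [exact: cX|exact: cY]. Qed.

(** The meeting times form a closed set. *)
Lemma coupling_time_gtP (t : R) w : 0 <= t ->
  (t%:E < coupling_time X Y w)%E <-> (forall s, 0 <= s <= t -> X s w <> Y s w).
Proof.
move=> t0; split=> [h s /andP[s0 st] E|h].
  have : (coupling_time X Y w <= s%:E)%E by apply: ereal_inf_lbound; exists s.
  by rewrite leNgt (le_lt_trans _ h)// lee_fin.
have Gt : 0 < `|G t w|.
  by rewrite normr_gt0 subr_eq0; apply/eqP; apply: h; rewrite t0 lexx.
have [del del0 hdel] := path_eps cG w t0 Gt.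
apply: (@lt_le_trans _ _ (t + del)%:E); first by rewrite lte_fin ltrDl.
apply: le_ereal_inf_tmp => _ [s [s0 E] <-]; rewrite lee_fin leNgt; apply/negP => sd.
have [st|st] := leP s t; first by apply: (h s) => //; rewrite s0.
have := hdel s s0; rewrite gtr0_norm ?subr_gt0// ltrBlDl sd => /(_ isT).
by rewrite {1}/G E subrr sub0r normrN ltxx.
Qed.

(** The distance of two paths that do not meet on the compact [[0, t]] is bounded
    below, and by continuity this can be tested on the grid points. *)
Lemma measurable_coupling_time_gt (t : R) : 0 < t ->
  measurable [set w | (t%:E < coupling_time X Y w)%E].
Proof.
move=> t0; have t0' := ltW t0.
rewrite (_ : [set w | _] = \bigcup_n \bigcap_N \bigcap_k
    [set w | (k <= N.+1)%N ==> (n.+1%:R^-1 <= `|G (unif t N k) w|)]).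
  apply: bigcupT_measurable => n; apply: bigcapT_measurable => N; apply: bigcapT_measurable => k.
  case: (k <= N.+1)%N => /=; last by rewrite (_ : mkset _ = setT) //; apply/seteqP; split.
  have mG : measurable_fun setT (fun w => `|G (unif t N k) w|).
    have u0 := unif_ge0 t0 N k.
    apply: measurableT_comp => //; apply: measurable_funB.
      by apply: (measurable_wrt_fun hF u0); exact: aX.
    by apply: (measurable_wrt_fun hF u0); exact: aY.
  rewrite -[X in measurable X]setTI.
  exact: (measurable_fun_ler (measurable_cst _) mG measurableT (Y := [set true])).
apply/seteqP; split => w /=; rewrite coupling_time_gtP//.
  move=> h.
  have sub : [set` `[0, t]] `<=` [set` `[0 : R, +oo[] by move=> u /=; rewrite !in_itv/= => /andP[-> _].
  have cN : {within `[0, t], continuous (fun u => `|G u w|)}.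
    by move=> x; apply: cvg_norm; apply: (continuous_subspaceW sub (@cG w)).
  have [c + hc] := EVT_min t0' cN; rewrite in_itv/= => ct.
  have Gc : 0 < `|G c w| by rewrite normr_gt0 subr_eq0; apply/eqP; exact: h.
  exists (Num.trunc (`|G c w|^-1)) => // N _ k _ /=; apply/implyP => kN.
  apply: (@le_trans _ _ `|G c w|).
    by rewrite invf_ple ?posrE// ltW// truncnS_gt.
  by apply: hc; rewrite in_itv/= unif_ge0//= unif_le.
move=> [n _ hn] s /andP[s0 st] E.
have n0 : 0 < n.+1%:R^-1 :> R by [].
have [del del0 hdel] := path_eps cG w s0 n0.
have [N [k [kN hk]]] : exists N k, (k <= N.+1)%N /\ `|unif t N k - s| < del.
  have st' : 0 <= s <= t by rewrite s0.
  by have [N hN] := grid_approx t0 st' del0; have [k kN hk] := hN N (leqnn N); exists N, k.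
have := hdel _ (unif_ge0 t0 N k) hk.
have := hn N I k I; rewrite /= kN/= => h1.
by rewrite {2}/G E subrr subr0 ltNge h1.
Qed.

End coupling_event.

Section rates.
Context {R : realType}.
Local Open Scope ereal_scope.

Lemma lne_exp_bound (C k t : R) : (0 < C)%R -> (0 < t)%R ->
  (t^-1)%:E * lne (C * expR (- k * t))%:E = (ln C / t - k)%:E.
Proof.
move=> C0 t0; rewrite lne_EFin ?mulr_gt0 ?expR_gt0// lnM ?posrE ?expR_gt0// expRK -EFinM.
by congr EFin; field; rewrite gt_eqF.
Qed.

Lemma scaled_lne_le (t : R) (x y : \bar R) : (0 < t)%R -> 0 <= x -> x <= y ->
  (t^-1)%:E * lne x <= (t^-1)%:E * lne y.
Proof.
move=> t0 x0 xy; rewrite lee_pmul2l ?lte_fin ?invr_gt0//.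
by rewrite lee_lne// in_itv/= ?x0 ?(le_trans x0 xy) ?leey.
Qed.

Lemma ln_div_small (C e t : R) : (0 < e)%R -> (`|ln C| / e < t)%R -> (`|ln C / t| <= e)%R.
Proof.
move=> e0 h; have t0 : (0 < t)%R by apply: le_lt_trans h; rewrite divr_ge0// ltW.
rewrite normrM normfV (gtr0_norm t0) ler_pdivrMr//.
by rewrite mulrC -ler_pdivrMr// ltW.
Qed.

Lemma exponential_rate_le (f : R -> \bar R) (C k e : R) : (0 < C)%R -> (0 < e)%R ->
  (forall t, (0 < t)%R -> 0 <= f t /\ f t <= (C * expR (- k * t))%:E) ->
  exponential_rate f <= (- k + e)%:E.
Proof.
move=> C0 e0 h; rewrite /exponential_rate limf_einfE.
apply: ge_ereal_sup => _ [A [M [_ hM]] <-].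
pose t : R := (`|M| + `|ln C| / e + 1)%R.
have q0 : (0 <= `|ln C| / e)%R by rewrite divr_ge0// ltW.
have t1 : (`|ln C| / e < t)%R by rewrite /t; have := normr_ge0 M; lra.
have t0 : (0 < t)%R by exact: le_lt_trans t1.
have Mt : (M < t)%R by rewrite /t; have := ler_norm M; lra.
apply: ge_ereal_inf; exists ((t^-1)%:E * lne (f t)).
  by exists t => //; exact: hM.
have [f0 fC] := h t t0.
apply: le_trans (scaled_lne_le t0 f0 fC) _; rewrite lne_exp_bound// lee_fin addrC lerD2l.
by have := ln_div_small e0 t1; rewrite ler_norml => /andP[].
Qed.

Lemma exponential_rate_ge (f : R -> \bar R) (C k e : R) : (0 < C)%R -> (0 < e)%R ->
  (forall t, (0 < t)%R -> (C * expR (- k * t))%:E <= f t) ->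
  (- k - e)%:E <= exponential_rate f.
Proof.
move=> C0 e0 h; rewrite /exponential_rate limf_einfE.
apply: le_ereal_sup_tmp; exists (ereal_inf [set (t^-1)%:E * lne (f t) | t in [set t | (`|ln C| / e < t)%R]]).
  exists [set t | (`|ln C| / e < t)%R] => //.
  by exists (`|ln C| / e)%R; split => //; exact: num_real.
apply: le_ereal_inf_tmp => _ [t /= t1 <-].
have t0 : (0 < t)%R by apply: le_lt_trans t1; rewrite divr_ge0// ltW.
have C1 : (0 <= (C * expR (- k * t))%:E)%E by rewrite lee_fin ltW// mulr_gt0// expR_gt0.
apply: le_trans _ (scaled_lne_le t0 C1 (h t t0)); rewrite lne_exp_bound// lee_fin addrC lerD2r.
by have := ln_div_small e0 t1; rewrite ler_norml => /andP[].
Qed.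

Lemma exponential_rate_mono (f g : R -> \bar R) :
  (forall t, (0 < t)%R -> 0 <= f t /\ f t <= g t) ->
  exponential_rate f <= exponential_rate g.
Proof.
move=> h; rewrite /exponential_rate !limf_einfE.
apply: ge_ereal_sup => _ [A [M [Mr hM]] <-].
apply: le_ereal_sup_tmp; exists (ereal_inf [set (t^-1)%:E * lne (g t) | t in A `&` [set t | (0 < t)%R]]).
  exists (A `&` [set t | (0 < t)%R]) => //; exists (Num.max M 0)%R; split; first exact: num_real.
  by move=> t; rewrite gt_max => /andP[Mt t0]; split => //; exact: hM.
apply: le_ereal_inf_tmp => _ [t [At t0] <-]; apply: ge_ereal_inf.
exists ((t^-1)%:E * lne (f t)); first by exists t.
by have [f0 fg] := h t t0; exact: scaled_lne_le.
Qed.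
End rates.

(** * Gaussian tails and blocks of a Brownian path *)

Section normal_tails.
Context {R : realType}.

(** The exponential Markov inequality with parameter [l]; the factor [g] allows
    for volatilities of either sign. *)
Lemma normal_tail_le (s g l c : R) : 0 < s -> 0 <= l ->
  (normal_prob 0 s [set y : R | (c <= g * y)%R] <=
   (expR ((l * g) ^+ 2 * s ^+ 2 / 2 - l * c))%:E)%E.
Proof.
move=> s0 l0.
have mS : measurable [set y : R | (c <= g * y)%R].
  rewrite -[X in measurable X]setTI.
  apply: (measurable_fun_ler (measurable_cst c) (_ : measurable_fun setT (fun y : R => g * y)) measurableT (Y := [set true])) => //.
  exact: measurable_funM.
have -> : normal_prob 0 s [set y : R | (c <= g * y)%R] = (\int[normal_prob 0 s]_y (\1_[set y : R | (c <= g * y)%R] y)%:E)%E.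
  by rewrite integral_indic// setIT.
apply: (@le_trans _ _ (\int[normal_prob 0 s]_y ((expR (- (l * c)))%:E * (expR (l * g * y))%:E))%E).
  apply: ge0_le_integral => //.
  - by apply/measurable_EFinP; exact: measurable_indic.
  - apply/measurable_EFinP; apply: measurable_funM => //; apply: measurableT_comp => //.
  - move=> y _; rewrite -EFinM lee_fin -expRD indicE.
    have [/set_mem /= h|_] := boolP (y \in _); last exact: expR_ge0.
    by rewrite -expR0 ler_expR -mulrA addrC -mulrBr mulr_ge0// subr_ge0.
rewrite ge0_integralZl//.
- by rewrite normal_mgfE// -EFinM lee_fin -expRD addrC.
- apply/measurable_EFinP; apply: measurableT_comp => //; exact: measurable_funM.
Qed.

Lemma normal_pdf_anti (s x y : R) : 0 < s -> 0 <= x -> x <= y ->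
  normal_pdf 0 s y <= normal_pdf 0 s x.
Proof.
move=> s0 x0 xy; rewrite !normal_pdfE ?gt_eqF//.
rewrite ler_wpM2l ?normal_peak_ge0// /normal_fun ler_expR !subr0.
rewrite ler_wpM2r ?invr_ge0 ?mulrn_wge0 ?sqr_ge0// lerN2.
by rewrite ler_pXn2r ?nnegrE// (le_trans x0).
Qed.

(** The density decreases on the right half-line. *)
Lemma normal_tail_ge (s b v : R) : 0 < s -> 0 <= b -> 0 < v ->
  ((v * normal_pdf 0 s (b + v))%:E <= normal_prob 0 s [set y : R | (b <= y)%R])%E.
Proof.
move=> s0 b0 v0.
have -> : (v * normal_pdf 0 s (b + v))%:E =
    (\int[lebesgue_measure]_(y in `[b, (b + v)%R]) (normal_pdf 0 s (b + v))%:E)%E.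
  rewrite integral_cst//= lebesgue_measure_itv /= lte_fin ltrDl v0 -EFinB -EFinM.
  by congr EFin; ring.
rewrite /normal_prob.
apply: (@le_trans _ _ (\int[lebesgue_measure]_(y in `[b, (b + v)%R]) (normal_pdf 0 s y)%:E)%E).
  apply: ge0_le_integral => //.
  - by move=> y _; rewrite lee_fin normal_pdf_ge0.
  - by apply/measurable_EFinP; apply: measurable_funTS; exact: measurable_normal_pdf.
  - move=> y /=; rewrite in_itv/= => /andP[h1 h2]; rewrite lee_fin.
    by apply: normal_pdf_anti => //; exact: le_trans h1.
apply: ge0_subset_integral => //.
- rewrite (_ : [set y : R | _] = `[b, +oo[%classic) //.
  by apply/seteqP; split => y /=; rewrite in_itv/= andbT.
- by apply/measurable_EFinP; apply: measurable_funTS; exact: measurable_normal_pdf.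
- by move=> y _; rewrite lee_fin normal_pdf_ge0.
- by move=> y /=; rewrite in_itv/= => /andP[].
Qed.

End normal_tails.

Section blocks.
Context {R : realType} {d : measure_display} {T : measurableType d}.
Context (P : probability T R) (F : R -> set_system T).
Hypothesis hF : filtration F.
Variable V : process R T.
Hypothesis hV : brownian_motion P F V.

Lemma filtration_I s A B : 0 <= s -> F s A -> F s B -> F s (A `&` B).
Proof.
move=> s0; have sg := filtration_sigma hF s0.
rewrite -(sigma_algebra_id sg) => mA mB.
exact: (@measurableI _ (g_sigma_algebraType (F s)) A B mA mB).
Qed.

Lemma filtration_D s A B : 0 <= s -> F s A -> F s B -> F s (A `\` B).
Proof.
move=> s0; have sg := filtration_sigma hF s0.
rewrite -(sigma_algebra_id sg) => mA mB.
exact: (@measurableD _ (g_sigma_algebraType (F s)) A B mA mB).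
Qed.

Lemma filtration_bigcap s (A : nat -> set T) : 0 <= s -> (forall i, F s (A i)) ->
  F s (\bigcap_i A i).
Proof.
move=> s0; have sg := filtration_sigma hF s0.
rewrite -(sigma_algebra_id sg) => mA.
exact: (@bigcapT_measurable _ (g_sigma_algebraType (F s)) A mA).
Qed.

Lemma filtrationT s : 0 <= s -> F s setT.
Proof.
move=> s0; have sg := filtration_sigma hF s0.
rewrite -(sigma_algebra_id sg).
exact: (@measurableT _ (g_sigma_algebraType (F s))).
Qed.

Lemma increment_wrt s u v : 0 <= u -> u <= v -> v <= s ->
  measurable_wrt (F s) (increment V u v).
Proof.
move=> u0 uv vs; have [aV _ _ _ _] := hV.
have v0 := le_trans u0 uv; have s0 := le_trans v0 vs.
apply: (measurable_wrtB (filtration_sigma hF s0)).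
  by apply: (measurable_wrt_le hF v0 vs); exact: aV.
by apply: (measurable_wrt_le hF u0 (le_trans uv vs)); exact: aV.
Qed.

Lemma measurable_ge (c : R) : measurable [set y : R | (c <= y)%R].
Proof.
rewrite (_ : mkset _ = `[c, +oo[%classic) //.
by apply/seteqP; split => y /=; rewrite in_itv/= andbT.
Qed.

Lemma filtration_ge s u v (c : R) : 0 <= u -> u <= v -> v <= s ->
  F s [set w | c <= increment V u v w].
Proof. by move=> u0 uv vs; exact: (increment_wrt u0 uv vs (measurable_ge c)). Qed.

Lemma filtration_measurable s A : 0 <= s -> F s A -> measurable A.
Proof. by have [_ h _] := hF => s0; exact: h. Qed.

Local Open Scope ereal_scope.

(** A substitute for the reflection principle.  At the first grid time at which
    the path is below [- a] it has still to climb [a + b] before [e], and its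
    future is independent of the past.  The induction consumes the first grid time
    and moves [A] to the event that it was not a passage time. *)
Lemma passage (e a b s0 : R) n (u : nat -> R) A : (0 <= s0)%R -> (0 < a + b)%R -> (s0 < e)%R ->
  (s0 <= u 0%N)%R -> (forall i, (u i <= u i.+1)%R) -> (forall i, (i < n)%N -> (u i <= e)%R) ->
  F (u 0%N) A ->
  P (A `&` [set w | exists2 k, (k < n)%N & (increment V s0 (u k) w <= - a)%R]
       `&` [set w | (b <= increment V s0 e w)%R]) <=
  P A * (expR (- (a + b) ^+ 2 / (2 * (e - s0))))%:E.
Proof.
move=> s00 ab s0e; elim: n u A => [|n IH] u A su umono ue FA.
  rewrite (_ : _ `&` _ = set0) ?measure0 ?mule_ge0//.
  by apply/seteqP; split => // w [[_ [k]]]; rewrite ltn0.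
set q := (expR _)%:E.
have q0 : 0 <= q by rewrite lee_fin expR_ge0.
have u00 := le_trans s00 su.
have ue0 := ue 0%N isT.
pose C := [set w | (a <= - increment V s0 (u 0%N) w)%R].
have FC : F (u 0%N) C.
  rewrite (_ : C = increment V s0 (u 0%N) @^-1` `]-oo, (- a)%R]); last first.
    by apply/seteqP; split => w; rewrite /C /= in_itv/= lerNr.
  exact: increment_wrt.
have FA1 := filtration_I u00 FA FC; have FA2 := filtration_D u00 FA FC.
have mA1 := filtration_measurable u00 FA1; have mA2 := filtration_measurable u00 FA2.
have s0e' := ltW s0e.
have mge c s v : (0 <= s)%R -> (s <= v)%R -> measurable [set w | (c <= increment V s v w)%R].
  move=> h1 h2; have h3 := le_trans h1 h2.
  by apply: (filtration_measurable h3); exact: filtration_ge.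
pose E2 := (A `\` C) `&` [set w | exists2 k, (k < n)%N & (increment V s0 (u k.+1) w <= - a)%R]
       `&` [set w | (b <= increment V s0 e w)%R].
pose E1 := (A `&` C) `&` [set w | (b <= increment V s0 e w)%R].
have mE1 : measurable E1 by apply: measurableI => //; exact: mge.
have mex (v : nat -> R) m : (forall i, s0 <= v i)%R ->
   measurable [set w | exists2 k, (k < m)%N & (increment V s0 (v k) w <= - a)%R].
  move=> hv; rewrite (_ : mkset _ = \bigcup_(k in [set k | (k < m)%N]) [set w | (increment V s0 (v k) w <= - a)%R]) //.
  apply: bigcup_measurable => k _.
  have vk : (0 <= v k)%R by exact: le_trans (hv k).
  apply: (filtration_measurable vk).
  rewrite (_ : mkset _ = increment V s0 (v k) @^-1` `]-oo, (- a)%R]); first exact: increment_wrt.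
  by apply/seteqP; split => w; rewrite /= in_itv/=.
have su' i : (s0 <= u i)%R by elim: i => // i /le_trans; apply.
have mE2 : measurable E2 by do 2?[apply: measurableI => //]; [exact: mex|exact: mge].
have mA := filtration_measurable u00 FA.
apply: (@le_trans _ _ (P (E1 `|` E2))).
  apply: le_measure; rewrite ?inE//.
  - by do 2?[apply: measurableI => //]; [exact: mex|exact: mge].
  - exact: measurableU.
  move=> w [[Aw [k kn hk]] hb].
  have [Cw|Cw] := pselect (C w); first by left.
  right; split => //; split => //; case: k kn hk => [_ h|k kn hk]; last by exists k.
  by exfalso; apply: Cw; rewrite /C /= lerNr.
apply: (le_trans (measureU2 _ mE1 mE2)).
have PA : P A = P (A `&` C) + P (A `\` C).
  by rewrite [LHS](measureDI P mA (filtration_measurable u00 FC)) addeC.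
rewrite PA ge0_muleDl//.
apply: leeD; last first.
  have u1 := umono 0%N.
  apply: (IH (fun i => u i.+1)) => //.
  - by move=> i; exact: (ue i.+1).
  - by have [_ _ h] := hF; apply: (h (u 0%N)).
have [ee|ue1] := eqVneq (u 0%N) e.
  rewrite (_ : E1 = set0) ?measure0 ?mule_ge0//.
  apply/seteqP; split => // w [[_ Cw] /= hb]; move: Cw; rewrite /C /= ee; lra.
have {}ue1 : (u 0%N < e)%R by rewrite lt_neqAle ue1.
have [_ _ _ indV normV] := hV.
apply: (@le_trans _ _ (P ((A `&` C) `&` increment V (u 0%N) e @^-1` [set y | (a + b <= y)%R]))).
  apply: le_measure; rewrite ?inE//.
    by apply: measurableI => //; exact: mge.
  move=> w [[Aw Cw] hb]; split => //; move: Cw hb; rewrite /C /= /increment; lra.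
rewrite (indV _ _ u00 ue1 _ _ FA1 (measurable_ge _)) lee_wpmul2l//.
rewrite (normV _ _ u00 ue1 _ (measurable_ge _)).
have h0 : (0 < e - u 0%N)%R by rewrite subr_gt0.
have sq : (0 < Num.sqrt (e - u 0%N))%R by rewrite sqrtr_gt0.
have l0 : (0 <= (a + b) / (e - u 0%N))%R by rewrite divr_ge0// ltW.
have := normal_tail_le 1 (a + b) sq l0.
rewrite (_ : [set y : R | (a + b <= 1 * y)%R] = [set y | (a + b <= y)%R]); last first.
  by apply/seteqP; split => y /=; rewrite mul1r.
move=> /le_trans; apply; rewrite lee_fin ler_expR (sqr_sqrtr (ltW h0)).
have h1 : (0 < e - s0)%R by rewrite subr_gt0.
rewrite [leLHS](_ : _ = - ((a + b) ^+ 2 / 2) * (e - u 0%N)^-1)%R; last by field; rewrite gt_eqF.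
rewrite [leRHS](_ : _ = - ((a + b) ^+ 2 / 2) * (e - s0)^-1)%R; last by field; rewrite gt_eqF.
rewrite !mulNr lerN2 ler_wpM2l// ?divr_ge0 ?sqr_ge0//.
by rewrite lef_pV2 ?posrE// lerD2l lerN2.
Qed.

(** Dyadic times make this event measurable and decreasing in [m]. *)
Definition dyadic_above (s h a : R) m : set T := [set w | forall k, (k <= 2 ^ m)%N ->
  (- a < increment V s (s + k%:R * (h / (2 ^ m)%:R)) w)%R].

(** A climb by [b] without a fall below [- a]; by continuity the dyadic times
    control the whole path. *)
Definition block (s h a b : R) : set T :=
  [set w | (b <= increment V s (s + h) w)%R] `&` \bigcap_m dyadic_above s h a m.

Lemma dyadic_le (s h : R) m k : (0 <= h)%R -> (k <= 2 ^ m)%N ->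
  (s <= s + k%:R * (h / (2 ^ m)%:R) <= s + h)%R.
Proof.
move=> h0 km; have m0 : (0 < (2 ^ m)%:R :> R)%R by rewrite ltr0n expn_gt0.
rewrite lerDl lerD2l mulr_ge0 ?divr_ge0 ?(ltW m0)//=.
rewrite mulrA ler_pdivrMr// mulrC ler_wpM2l// ler_nat//.
Qed.

Lemma dyadic_above_in (s h a : R) m : (0 <= s)%R -> (0 <= h)%R -> F (s + h) (dyadic_above s h a m).
Proof.
move=> s0 h0; have sh0 : (0 <= s + h)%R by exact: addr_ge0.
rewrite (_ : dyadic_above s h a m = \bigcap_k (if (k <= 2 ^ m)%N then
   increment V s (s + k%:R * (h / (2 ^ m)%:R)) @^-1` `](- a)%R, +oo[%classic else setT)).
  apply: filtration_bigcap => // k; case: ifP => km; last exact: filtrationT.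
  by have /andP[h1 h2] := dyadic_le s h0 km; exact: increment_wrt.
apply/seteqP; split => w hw.
  by move=> k _; case: ifP => km //=; rewrite in_itv/= andbT; exact: hw.
by move=> k km; have := hw k I; rewrite km /= in_itv/= andbT.
Qed.

Lemma block_in (s h a b : R) : (0 <= s)%R -> (0 <= h)%R -> F (s + h) (block s h a b).
Proof.
move=> s0 h0; have sh0 : (0 <= s + h)%R by exact: addr_ge0.
apply: filtration_I => //; first by apply: filtration_ge => //; rewrite lerDl.
by apply: filtration_bigcap => // m; exact: dyadic_above_in.
Qed.

Lemma dyadic_above_decr (s h a : R) m : dyadic_above s h a m.+1 `<=` dyadic_above s h a m.
Proof.
move=> w hw k km; have := hw k.*2; rewrite expnS mul2n leq_double => /(_ km).
suff -> : (k.*2%:R * (h / (2 ^ m).*2%:R) = k%:R * (h / (2 ^ m)%:R) :> R)%R by [].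
have m0 : ((2 ^ m)%:R != 0 :> R)%R by rewrite pnatr_eq0 -lt0n expn_gt0.
by rewrite -!muln2 !natrM; field; rewrite m0.
Qed.

Lemma block_path (s h a b : R) w u : (0 <= s)%R -> (0 < h)%R -> block s h a b w ->
  (s <= u <= s + h)%R -> (- a <= increment V s u w)%R.
Proof.
move=> s0 h0 [_ hg] /andP[su ush]; rewrite leNgt; apply/negP => hlt.
have [_ cV _ _ _] := hV.
have e0 : (0 < - a - increment V s u w)%R by rewrite subr_gt0.
have [del del0 hdel] := path_eps cV w (le_trans s0 su) e0.
have us : (0 <= u - s <= h)%R by rewrite subr_ge0 su lerBlDl.
have [N0 hN] := grid_approx h0 us del0.
have N0le : (N0 <= (2 ^ N0).-1)%N by rewrite -ltnS prednK ?expn_gt0// ltn_expl.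
have [k + hk] := hN _ N0le; rewrite prednK ?expn_gt0// in hk * => km.
have := hg N0 I k km; set v := (_ * _)%R in hk * => hv.
have v0 : (0 <= v)%R by rewrite mulr_ge0// divr_ge0// ltW.
have := hdel (s + v)%R (addr_ge0 s0 v0).
rewrite (_ : s + v - u = v - (u - s))%R ?hk; last by ring.
move=> /(_ isT); move: hv; rewrite /increment ltr_norml; lra.
Qed.

(** The complement of [dyadic_above] is a passage event, at every level [m]; the
    bound of [passage] is independent of [m]. *)
Lemma block_prob (s h a b p : R) A : (0 <= s)%R -> (0 < h)%R -> (0 < a + b)%R -> F s A ->
  (p + expR (- (a + b) ^+ 2 / (2 * h)))%:E <= normal_prob 0 (Num.sqrt h) [set y : R | (b <= y)%R] ->
  P A * p%:E <= P (A `&` block s h a b).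
Proof.
move=> s0 h0 ab FA hp; have h0' := ltW h0; have ssh : (s < s + h)%R by rewrite ltrDl.
have sh0 := addr_ge0 s0 h0'.
have mA := filtration_measurable s0 FA.
have mg m := filtration_measurable sh0 (dyadic_above_in a m s0 h0').
have mb : measurable [set w | (b <= increment V s (s + h) w)%R].
  by apply: (filtration_measurable sh0); apply: filtration_ge => //; exact: ltW.
pose B := A `&` [set w | (b <= increment V s (s + h) w)%R].
have mB : measurable B by exact: measurableI.
have lvl m : P A * p%:E <= P (B `&` dyadic_above s h a m).
  have mBg : measurable (B `&` dyadic_above s h a m) by exact: measurableI.
  set q := expR _ in hp.
  have hB : P A * (p + q)%:E <= P B.
    have [_ _ _ indV normV] := hV.
    rewrite /B (indV _ _ s0 ssh _ _ FA (measurable_ge b)) (normV _ _ s0 ssh _ (measurable_ge b)).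
    have -> : (s + h - s = h)%R by ring.
    exact: lee_wpmul2l.
  have m0 : ((2 ^ m)%:R != 0 :> R)%R by rewrite pnatr_eq0 -lt0n expn_gt0.
  have m0' : (0 < (2 ^ m)%:R :> R)%R by rewrite ltr0n expn_gt0.
  pose u (k : nat) : R := (s + k%:R * (h / (2 ^ m)%:R))%R.
  have uu : u 0%N = s by rewrite /u mul0r addr0.
  have hpass := @passage (s + h) a b s (2 ^ m).+1 u A s0 ab ssh.
  rewrite uu in hpass.
  have {}hpass := hpass (lexx _) _ _ FA.
  have umono i : (u i <= u i.+1)%R.
    by rewrite /u lerD2l ler_wpM2r ?divr_ge0 ?(ltW m0')// ler_nat.
  have ule i : (i < (2 ^ m).+1)%N -> (u i <= s + h)%R.
    by rewrite ltnS => im; have /andP[] := dyadic_le s h0' im.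
  have {}hpass := hpass umono ule.
  rewrite (_ : s + h - s = h)%R in hpass; last by ring.
  rewrite -/q in hpass.
  set Bad := _ `&` _ `&` _ in hpass.
  have mBad : measurable Bad.
    rewrite (_ : Bad = B `\` dyadic_above s h a m); first exact: measurableD.
    apply/seteqP; split => w.
      move=> [[Aw [k km hk]] hb]; split => // hg; have := hg k km; rewrite ltNge => /negP; exact.
    move=> [[Aw hb] hg]; split => //; split => //; apply: contrapT => hno; apply: hg => k km.
    by rewrite ltNge; apply/negP => hk; apply: hno; exists k.
  have hsub : P B <= P (B `&` dyadic_above s h a m) + P Bad.
    apply: (@le_trans _ _ (P (B `&` dyadic_above s h a m `|` Bad))); last exact: measureU2.
    apply: le_measure; rewrite ?inE//; first exact: measurableU.
    move=> w Bw; have [g|hg] := pselect (dyadic_above s h a m w); first by left.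
    right; case: Bw => Aw hb; split => //; split => //; apply: contrapT => hno; apply: hg => k km.
    by rewrite ltNge; apply/negP => hk; apply: hno; exists k.
  have : P A * p%:E + P A * q%:E <= P (B `&` dyadic_above s h a m) + P A * q%:E.
    rewrite -muleDr//; last exact: fin_num_measure.
    rewrite -EFinD; apply: (le_trans hB); apply: (le_trans hsub).
    by rewrite leeD2l.
  rewrite leeD2rE// fin_numM//; exact: fin_num_measure.
have -> : A `&` block s h a b = \bigcap_m (B `&` dyadic_above s h a m).
  apply/seteqP; split => w.
    by move=> [Aw [hb hg]] m _; split => //; exact: hg.
  move=> hw; have [[Aw hb] _] := hw 0%N I; split => //; split => // m _.
  by have [] := hw m I.
have mBg m : measurable (B `&` dyadic_above s h a m) by exact: measurableI.
have cvg := @nonincreasing_cvg_mu _ _ _ P (fun m => B `&` dyadic_above s h a m) _ mBg (bigcapT_measurable mBg).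
have Plt : P (B `&` dyadic_above s h a 0) < +oo by rewrite ltey_eq fin_num_measure.
have noninc : {homo (fun m : nat => B `&` dyadic_above s h a m) : n m / (n <= m)%N >-> (m <= n)%O}.
  apply/nonincreasing_seqP => m; rewrite subsetEset; apply: setIS; exact: dyadic_above_decr.
have {}cvg := cvg Plt noninc.
rewrite -(cvg_lim _ cvg)//; apply: lime_ge; first by apply/cvg_ex; eexists; exact: cvg.
by apply: nearW => m; exact: lvl.
Qed.

End blocks.

(** * Survival of a Brownian motion above a line *)

Section block_parameters.
Context {R : realType}.

Lemma normal_pdf_sqrt (h x : R) : 0 < h ->
  normal_pdf 0 (Num.sqrt h) x = normal_peak (Num.sqrt h) * expR (- x ^+ 2 / (2 * h)).
Proof.
move=> h0; rewrite normal_pdfE ?gt_eqF ?sqrtr_gt0// /normal_fun subr0 sqr_sqrtr ?ltW//.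
by congr (_ * expR (_ / _)); ring.
Qed.

Lemma normal_peak_sqrt_gt0 (h : R) : 0 < h -> 0 < normal_peak (Num.sqrt h).
Proof. by move=> h0; rewrite normal_peak_gt0// gt_eqF// sqrtr_gt0. Qed.

(** From [expR (- v) <= v^-1] for positive [v]. *)
Lemma passage_small (h b g : R) : 0 < h -> 0 <= b -> 0 < g ->
  exists2 a, 0 < a & expR (- (a + b) ^+ 2 / (2 * h)) <= g.
Proof.
move=> h0 b0 g0; have q0 : 0 < 2 * h / g by rewrite divr_gt0 ?mulr_gt0.
exists (1 + 2 * h / g); first by rewrite addr_gt0.
set a := 1 + _; have a1 : 1 <= a by rewrite /a lerDl ltW.
have a0 : 0 < a by lra.
have h1 : g^-1 <= (a + b) ^+ 2 / (2 * h).
  rewrite ler_pdivlMr ?mulr_gt0// mulrC.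
  apply: (@le_trans _ _ a); first by rewrite /a lerDr.
  apply: (@le_trans _ _ (a + b)); first by rewrite lerDl.
  by rewrite expr2 ler_peMl//; lra.
rewrite mulNr expRN -[leRHS]invrK lef_pV2 ?posrE ?expR_gt0 ?invr_gt0//.
by apply: (le_trans h1); have := expR_ge1Dx ((a + b) ^+ 2 / (2 * h)); lra.
Qed.

(** The exponents [(b + a / 2) ^+ 2] of the lower bound and [(a + b) ^+ 2] of the
    passage bound differ by a term that grows linearly in [b], so a large [b] makes
    the block possible even if [a] and [h] are tiny. *)
Lemma first_block_param (h a B : R) : 0 < h -> 0 < a -> exists b p,
  [/\ 0 <= b, B <= b, 0 < p &
  ((p + expR (- (a + b) ^+ 2 / (2 * h)))%:E <= normal_prob 0 (Num.sqrt h) [set y : R | (b <= y)%R])%E].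
Proof.
move=> h0 a0; set k := normal_peak (Num.sqrt h).
have k0 : 0 < k := normal_peak_sqrt_gt0 h0.
have [b [b0 Bb hb]] : exists b, [/\ 0 <= b, B <= b & 2 / (a * k) <= a * b / (2 * h)].
  have q0 : 0 < 4 * h / (a * a * k) by rewrite divr_gt0 ?mulr_gt0.
  exists (`|B| + 4 * h / (a * a * k)); split.
  - by rewrite addr_ge0// ltW.
  - by rewrite (le_trans (ler_norm B))// lerDl ltW.
  apply: (@le_trans _ _ (a * (4 * h / (a * a * k)) / (2 * h))).
    by rewrite le_eqVlt; apply/orP; left; apply/eqP; field; rewrite !gt_eqF.
  by rewrite ler_wpM2r ?invr_ge0 ?mulr_ge0 ?(ltW h0)// ler_wpM2l ?(ltW a0)// lerDr.
have a20 : 0 < a / 2 by rewrite divr_gt0.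
have s0 : 0 < Num.sqrt h by rewrite sqrtr_gt0.
have tail := normal_tail_ge s0 b0 a20.
rewrite normal_pdf_sqrt// -/k in tail.
exists b, (a / 2 * (k * expR (- (b + a / 2) ^+ 2 / (2 * h))) - expR (- (a + b) ^+ 2 / (2 * h))).
split => //; last by rewrite subrK.
rewrite subr_gt0.
have -> : - (b + a / 2) ^+ 2 / (2 * h) = - (a + b) ^+ 2 / (2 * h) + (a * b / (2 * h) + 3 * a ^+ 2 / (8 * h)).
  by field; rewrite gt_eqF.
rewrite expRD [ltRHS](_ : _ = expR (- (a + b) ^+ 2 / (2 * h)) *
  (a / 2 * k * expR (a * b / (2 * h) + 3 * a ^+ 2 / (8 * h)))); last by ring.
rewrite ltr_pMr ?expR_gt0//.
have e1 : 2 / (a * k) < expR (a * b / (2 * h) + 3 * a ^+ 2 / (8 * h)).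
  apply: (le_lt_trans hb); have q : 0 <= 3 * a ^+ 2 / (8 * h) by rewrite divr_ge0 ?mulr_ge0 ?sqr_ge0 ?ltW.
  by have := expR_ge1Dx (a * b / (2 * h) + 3 * a ^+ 2 / (8 * h)); lra.
have ak : 0 < a * k by rewrite mulr_gt0.
by move: e1; rewrite ltr_pdivrMr//; lra.
Qed.

(** Climbing [be * h] in time [h] has a probability of order
    [expR (- be ^+ 2 * h / 2)] up to factors polynomial in [h] and a constant; a
    long block absorbs these in the margin [kap - be ^+ 2 / 2].  The depth [a] is
    chosen last, to make passages negligible. *)
Lemma main_block_param (be kap : R) : 0 < be -> be ^+ 2 / 2 < kap -> exists h a p,
  [/\ 0 < h, 0 < a, expR (- kap * h) <= p &
  ((p + expR (- (a + be * h) ^+ 2 / (2 * h)))%:E <=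
     normal_prob 0 (Num.sqrt h) [set y : R | (be * h <= y)%R])%E].
Proof.
move=> be0 hk; have [g g0 gE] : exists2 g, 0 < g & kap = be ^+ 2 / 2 + g.
  by exists (kap - be ^+ 2 / 2); [rewrite subr_gt0|ring].
set M := expR (be + 1); have M0 : 0 < M by exact: expR_gt0.
(* With this [h], [expR (g * h) >= (g * h / 2) ^+ 2] beats the factor [16 * h * M]. *)
have [h [h0 h1 h2]] : exists h, [/\ 0 < h, 1 <= h & 64 * M <= g ^+ 2 * h].
  have q0 : 0 < 64 * M / g ^+ 2 by rewrite divr_gt0 ?mulr_gt0 ?exprn_gt0.
  exists (1 + 64 * M / g ^+ 2); split; [by rewrite addr_gt0|by rewrite lerDl ltW|].
  rewrite mulrDr mulr1 (_ : g ^+ 2 * (64 * M / g ^+ 2) = 64 * M) ?lerDr ?sqr_ge0//.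
  by field; rewrite gt_eqF.
have s0 : 0 < Num.sqrt h by rewrite sqrtr_gt0.
have b0 : 0 <= be * h by rewrite mulr_ge0// ltW.
have tail := normal_tail_ge s0 b0 (ltr01 : 0 < 1 :> R).
rewrite mul1r normal_pdf_sqrt// in tail.
set pk := normal_peak _ in tail; set ex := expR _ in tail.
have pk0 : 0 < pk := normal_peak_sqrt_gt0 h0.
have ex0 : 0 < ex by exact: expR_gt0.
have p0 : 0 < pk * ex / 2 by rewrite divr_gt0 ?mulr_gt0.
have [a a0 ha] := passage_small h0 b0 p0.
exists h, a, (pk * ex / 2); split => //; last first.
  apply: le_trans tail; rewrite lee_fin; lra.
have hpk : (8 * h)^-1 <= pk.
  rewrite /pk /normal_peak sqr_sqrtr ?(ltW h0)// lef_pV2 ?posrE ?mulr_gt0// ?sqrtr_gt0 ?mulrn_wgt0 ?mulr_gt0 ?pi_gt0//.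
  rewrite -(@ger0_norm _ (8 * h)) ?mulr_ge0 ?(ltW h0)// -sqrtr_sqr ler_wsqrtr//.
  have := @pihalf_lt2 R; have := @pi_ge2 R; move: (@pi R) => c c1 c2.
  rewrite -mulr_natr exprMn; nra.
have hex : expR (- (be ^+ 2 / 2 * h)) / M <= ex.
  rewrite /ex /M -expRB ler_expR.
  rewrite (_ : - (be * h + 1) ^+ 2 / (2 * h) = - (be ^+ 2 / 2 * h) - (be + (2 * h)^-1)); last first.
    by field; rewrite gt_eqF.
  rewrite lerD2l lerN2 lerD2l invf_le1 ?mulr_gt0//; lra.
have hg : 16 * h * M <= expR (g * h).
  have e1 := expR_ge1Dx (g * h / 2).
  have gh : 0 <= g * h / 2 by rewrite divr_ge0 ?mulr_ge0// ltW.
  apply: (@le_trans _ _ ((g * h / 2) ^+ 2)); last first.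
    rewrite [in leRHS](_ : g * h = g * h / 2 + g * h / 2); last by field.
    rewrite expRD -expr2 ler_pXn2r ?nnegrE ?expR_ge0//; lra.
  rewrite (_ : (g * h / 2) ^+ 2 = (g ^+ 2 * h) * (h / 4)); last by field.
  rewrite (_ : 16 * h * M = 64 * M * (h / 4)); last by field.
  by rewrite ler_wpM2r// divr_ge0// ltW.
apply: (@le_trans _ _ ((8 * h)^-1 * (expR (- (be ^+ 2 / 2 * h)) / M) / 2)); last first.
  rewrite ler_wpM2r// ler_pM//; first by rewrite invr_ge0 mulr_ge0// ltW.
  by rewrite divr_ge0 ?expR_ge0// ltW.
rewrite (_ : - kap * h = - (be ^+ 2 / 2 * h) - g * h); last by rewrite gE; ring.
rewrite expRB.
rewrite (_ : (8 * h)^-1 * _ / 2 = expR (- (be ^+ 2 / 2 * h)) / (16 * h * M)); last first.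
  by field; rewrite !gt_eqF.
by rewrite ler_wpM2l ?expR_ge0// lef_pV2 ?posrE ?mulr_gt0 ?expR_gt0.
Qed.

End block_parameters.

Section survival.
Context {R : realType} {d : measure_display} {T : measurableType d}.
Context (P : probability T R) (F : R -> set_system T).
Hypothesis hF : filtration F.
Variable V : process R T.
Hypothesis hV : brownian_motion P F V.

Section chain.
Variables (h0 a0 b0 p0 h a b p : R).
Hypotheses (h00 : 0 < h0) (hp : 0 < h) (ab0 : 0 < a0 + b0) (ab : 0 < a + b) (pp : 0 <= p).
Hypothesis tail0 : ((p0 + expR (- (a0 + b0) ^+ 2 / (2 * h0)))%:E <=
  normal_prob 0 (Num.sqrt h0) [set y : R | (b0 <= y)%R])%E.
Hypothesis tail : ((p + expR (- (a + b) ^+ 2 / (2 * h)))%:E <=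
  normal_prob 0 (Num.sqrt h) [set y : R | (b <= y)%R])%E.

(** After a first block that gains height, each block follows the line of slope
    [b / h]. *)
Fixpoint chain n : set T :=
  if n is m.+1 then chain m `&` block V (h0 + m%:R * h) h a b else block V 0 h0 a0 b0.

Let st (n : nat) : R := h0 + n%:R * h.

Let st0 n : 0 <= st n.
Proof. by rewrite /st addr_ge0 ?mulr_ge0// ?(ltW h00) ?(ltW hp). Qed.

Let stS n : st n.+1 = st n + h.
Proof. by rewrite /st -natr1; ring. Qed.

Lemma chain_in n : F (st n) (chain n).
Proof.
elim: n => [|n IH] /=.
  by rewrite /st mul0r addr0 -[h0 in F h0]add0r; apply: (block_in hF hV) => //; exact: ltW.
rewrite stS; have s1 : 0 <= st n + h by rewrite (addr_ge0 (st0 n))// ltW.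
apply: (filtration_I hF s1); last exact: (block_in hF hV _ _ (st0 n) (ltW hp)).
by have [_ _ hh] := hF; apply: (hh (st n)) => //; rewrite lerDl ltW.
Qed.

Lemma chain_prob n : ((p0 * p ^+ n)%:E <= P (chain n))%E.
Proof.
elim: n => [|n IH] /=.
  rewrite expr0 mulr1.
  have := block_prob hF hV (lexx 0) h00 ab0 (filtrationT hF (lexx 0)) tail0.
  by rewrite setTI probability_setT mul1e.
have := block_prob hF hV (st0 n) hp ab (chain_in n) tail.
apply: le_trans; rewrite exprSr mulrA EFinM.
by apply: lee_wpmul2r => //; rewrite lee_fin.
Qed.

Variables (be del : R).
Hypotheses (be0 : 0 < be) (del0 : 0 < del) (ha0 : a0 + be * h0 < del) (hb : b = be * h)
  (hb0 : a + be * h + be * h0 <= b0).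

Lemma chain_end n w : chain n w -> b0 + n%:R * b <= V (st n) w.
Proof.
have [_ _ V0 _ _] := hV.
elim: n => [|n IH].
  by rewrite /= /st !mul0r !addr0 => -[+ _]; rewrite /increment/= add0r V0 subr0.
move=> [/IH h1 [h2 _]]; move: h2; rewrite /increment /= -/(st n) -stS -natr1; lra.
Qed.

(** The height [b0] gained in the first block pays for the depth [a] of an
    excursion and for the rise of the line during one block. *)
Lemma chain_path n (w : T) (u : R) : chain n w -> 0 <= u <= st n -> be * u - del < V u w.
Proof.
have [_ _ V0 _ _] := hV.
elim: n => [|n IH] hc /andP[u0 un].
  move: hc => /= hc; rewrite /st mul0r addr0 in un.
  have := @block_path _ _ _ _ _ _ hV 0 h0 a0 b0 w u (lexx _) h00 hc.
  rewrite add0r u0 un => /(_ isT); rewrite /increment V0 subr0.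
  have : be * u <= be * h0 by rewrite ler_wpM2l// ltW.
  move: (V u w) (be * u) (be * h0) ha0 => x y z h1 h2 h3.
  lra.
have [hc' hbl] := hc; have [us|us] := leP u (st n); first by apply: IH; rewrite ?u0.
have h1 := chain_end hc'.
have := @block_path _ _ _ _ _ _ hV (st n) h a b w u (st0 n) hp hbl.
rewrite (ltW us) -stS un => /(_ isT); rewrite /increment.
have : be * u <= be * st n.+1 by rewrite ler_wpM2l// ltW.
have nb : n%:R * b = be * (n%:R * h) by rewrite hb; ring.
rewrite nb in h1; have -> : be * st n.+1 = be * (n%:R * h) + be * h + be * h0.
  by rewrite /st -natr1; ring.
move: (V u w) (V (st n) w) (be * u) (be * h) (be * h0) (be * (n%:R * h)) hb0 h1 del0.
by move=> *; lra.
Qed.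

End chain.

(** The first block is short and shallow enough to stay above the line, which
    starts at [- del]; then the number of blocks is [t / h] up to 1, and each costs
    at most a factor [expR (kap * h)]. *)
Lemma drifted_survival (be del kap : R) : 0 < be -> 0 < del -> be ^+ 2 / 2 < kap ->
  exists2 C, 0 < C & forall t, 0 < t -> exists A, [/\ measurable A,
    ((C * expR (- kap * t))%:E <= P A)%E &
    forall w u, A w -> 0 <= u <= t -> be * u - del < V u w].
Proof.
move=> be0 del0 hk; have k0 : 0 < kap by apply: le_lt_trans hk; rewrite divr_ge0 ?sqr_ge0.
have [h [a [p [h0 a0 hp tail]]]] := main_block_param be0 hk.
have p0 : 0 < p by apply: lt_le_trans hp; exact: expR_gt0.
(* During the first block the path falls by at most [del / 4], and the line rises
   by [del / 4]. *)
have d40 : 0 < del / 4 by rewrite divr_gt0.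
have dh0 : 0 < del / (4 * be) by rewrite divr_gt0 ?mulr_gt0.
have bh0 : 0 < be * h by rewrite mulr_gt0.
have [b0 [q [b00 bB q0 tail0]]] := first_block_param (a + be * h + be * (del / (4 * be))) dh0 d40.
have ab0 : 0 < del / 4 + b0 by lra.
have ab : 0 < a + be * h by exact: addr_gt0.
exists (q * expR (- kap * h)); first by rewrite mulr_gt0// expR_gt0.
move=> t t0; pose n := (Num.trunc (t / h)).+1.
have th : 0 <= t / h by rewrite divr_ge0 ?ltW.
have /andP[n1 n2] := truncn_itv th.
exists (chain (del / (4 * be)) (del / 4) b0 h a (be * h) n); split.
- have := chain_in (del / 4) b0 a (be * h) dh0 h0 n.
  apply: (filtration_measurable hF).
  by rewrite (addr_ge0 (ltW dh0))// mulr_ge0// ltW.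
- apply: le_trans (chain_prob dh0 h0 ab0 ab (ltW p0) tail0 tail n).
  rewrite lee_fin -mulrA ler_wpM2l ?(ltW q0)//.
  apply: (@le_trans _ _ (expR (- kap * h) ^+ n)); last first.
    by rewrite ler_pXn2r ?nnegrE ?expR_ge0 ?(ltW p0).
  rewrite -expRM_natl -expRD ler_expR /n -natr1.
  move: n1; rewrite ler_pdivlMr// => n1.
  have : kap * ((Num.trunc (t / h))%:R * h) <= kap * t by rewrite ler_wpM2l// ltW.
  move: (Num.trunc _)%:R => m; lra.
- move=> w u hc /andP[u0 ut]; apply: (chain_path _ h0 be0 del0 _ _ bB hc).
  + by [].
  + rewrite (_ : be * (del / (4 * be)) = del / 4); first by lra.
    by field; rewrite gt_eqF.
  + by [].
  + rewrite u0 (le_trans ut)// ler_wpDl ?(ltW dh0)//.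
    by rewrite -ler_pdivrMr// ltW.
Qed.

End survival.

Section symmetry.
Context {R : realType}.

Lemma normal_prob_opp (s : R) (E : set R) : 0 < s -> measurable E ->
  normal_prob 0 s (-%R @^-1` E) = normal_prob 0 s E.
Proof.
move=> s0 mE; rewrite /normal_prob.
have -> : (\int[lebesgue_measure]_(x in E) (normal_pdf 0 s x)%:E =
   \int[pushforward lebesgue_measure (-%R : _ -> measurableTypeR R)]_(x in E) (normal_pdf 0 s x)%:E)%E.
  by apply: eq_measure_integral => //= A mA AS; exact/esym/lebesgue_measureN.
rewrite ge0_integral_pushforward.
- apply: eq_integral => x _; rewrite /comp; congr EFin.
  by rewrite !normal_pdfE ?gt_eqF// /normal_fun !subr0 sqrrN.
- exact: oppr_measurable.
- exact: mE.
- by apply/measurable_EFinP; apply: measurable_funTS; exact: measurable_normal_pdf.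
- by move=> x _; rewrite lee_fin normal_pdf_ge0.
Qed.

Lemma brownian_motion_opp {d : measure_display} {T : measurableType d}
  (P : probability T R) (F : R -> set_system T) (V : process R T) :
  filtration F -> brownian_motion P F V -> brownian_motion P F (fun t w => - V t w).
Proof.
move=> hF [aV cV V0 indV normV].
have mN (E : set R) : measurable E -> measurable (-%R @^-1` E).
  by move=> mE; rewrite -[X in measurable X]setTI; exact: (@oppr_measurable R setT).
have iN s t E : increment (fun t w => - V t w) s t @^-1` E = increment V s t @^-1` (-%R @^-1` E).
  by apply/seteqP; split => w; rewrite /= /increment opprB addrC opprK.
split.
- by move=> t t0 A mA; exact: (aV t t0 _ (mN A mA)).
- by move=> w x; apply: cvgN; exact: cV.
- by move=> w; rewrite V0 oppr0.
- by move=> s t s0 st A E FA mE; rewrite iN; apply: indV => //; exact: mN.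
- move=> s t s0 st E mE; rewrite iN normV//; last exact: mN.
  by rewrite normal_prob_opp// sqrtr_gt0 subr_gt0.
Qed.

End symmetry.

(** * Tails of the coupling time and the theorem *)

Section tails.
Context {R : realType} {d : measure_display} {T : measurableType d}.
Context (P : probability T R) (F : R -> set_system T).
Hypothesis hF : filtration F.
Variables (B : process R T) (a1 a2 sigma1 sigma2 x y : R).
Hypothesis hB : brownian_motion P F B.
Hypotheses (y0 : 0 < y) (yx : y < x).
Variables (X : process R T) (V Z : process R T).
Hypothesis hV : brownian_motion P F V.
Hypothesis hX : geometric_brownian_motion P F B sigma1 a1 x X.
Hypothesis hZ : geometric_brownian_motion P F V sigma2 a2 y Z.

Let mu := a2 - a1 + sigma1 ^+ 2 / 2 - sigma2 ^+ 2 / 2.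

(** [ln (X t w) - ln (Z t w)], by the explicit forms of the two processes. *)
Definition log_gap (t : R) (w : T) : R :=
  ln x - ln y + (sigma1 * B t w - sigma2 * V t w) - mu * t.

Lemma log_gapP : {ae P, forall w, forall t, 0 <= t -> (X t w = Z t w <-> log_gap t w = 0)}.
Proof.
have x0 := lt_trans y0 yx.
apply: filterS2 (gbm_explicit hF hB hX) (gbm_explicit hF hV hZ) => w hx hz t t0.
rewrite hx// hz// -[X in X * expR _]lnK ?posrE// -[X in _ = X * _]lnK ?posrE// -!expRD.
rewrite /log_gap /mu; split => [/expR_inj|h]; first by lra.
by congr expR; lra.
Qed.

Lemma log_gap0 w : 0 < log_gap 0 w.
Proof.
have [_ _ B0 _ _] := hB; have [_ _ V0 _ _] := hV.
rewrite /log_gap B0 V0 !mulr0 !subr0 addr0 subr_gt0 ltr_ln ?posrE//.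
exact: lt_trans yx.
Qed.

Lemma continuous_log_gap : continuous_paths log_gap.
Proof.
have [_ cB _ _ _] := hB; have [_ cV _ _ _] := hV.
move=> w u; apply: cvgB; last first.
  have : {within `[(0 : R), +oo[, continuous (fun y : R => mu * y)}.
    by apply: continuous_subspaceT => v; exact: mulrl_continuous.
  by apply.
apply: cvgD; first exact: cvg_cst.
by apply: cvgB; apply: cvgM; [exact: cvg_cst|exact: cB|exact: cvg_cst|exact: cV].
Qed.

Lemma log_gap_pos (t : R) w : 0 <= t ->
  (forall s, 0 <= s <= t -> log_gap s w <> 0) -> 0 < log_gap t w.
Proof.
move=> t0 h; rewrite ltNge; apply/negP => ht.
have sub : [set` `[0, t]] `<=` [set` `[0 : R, +oo[] by move=> u /=; rewrite !in_itv/= => /andP[-> _].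
have cw : {within `[0, t], continuous (fun u => log_gap u w)}.
  exact: (continuous_subspaceW sub (@continuous_log_gap w)).
have [|c + hc] := IVT t0 cw (v := 0).
  by rewrite ge_min ht orbT le_max ltW ?log_gap0.
by rewrite in_itv/= => /h /(_ hc).
Qed.

Let aX : adapted F X. Proof. by have [] := hX. Qed.
Let cX : continuous_paths X. Proof. by have [] := hX. Qed.
Let aZ : adapted F Z. Proof. by have [] := hZ. Qed.
Let cZ : continuous_paths Z. Proof. by have [] := hZ. Qed.

Lemma le_probability_ae (A C : set T) : measurable A -> measurable C ->
  {ae P, forall w, A w -> C w} -> (P A <= P C)%E.
Proof.
move=> mA mC [N [mN PN hN]].
apply: (@le_trans _ _ (P (C `|` N))).
  apply: le_measure; rewrite ?inE//; first exact: measurableU.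
  move=> w Aw; have [Cw|nC] := pselect (C w); [by left|right].
  by apply: hN => /= h; apply: nC; exact: h.
by apply: le_trans (measureU2 _ mC mN) _; rewrite [X in (_ + X)%E]PN adde0.
Qed.

Lemma tail_ge (t : R) A : 0 < t -> measurable A ->
  (forall w u, A w -> 0 <= u <= t -> 0 < log_gap u w) ->
  (P A <= tail_probability P X Z t)%E.
Proof.
move=> t0 mA hA; apply: le_probability_ae => //.
  exact: (measurable_coupling_time_gt hF aX cX aZ cZ t0).
apply: filterS log_gapP => w hw Aw; apply/(coupling_time_gtP cX cZ w (ltW t0)) => s /andP[s0 st].
move/(hw s s0) => E; have := hA w s Aw; by rewrite s0 st E ltxx => /(_ isT).
Qed.

Lemma tail_le (t : R) : 0 < t ->
  (tail_probability P X Z t <= P [set w | (0 <= log_gap t w)%R])%E.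
Proof.
move=> t0; have t0' := ltW t0; apply: le_probability_ae.
- exact: (measurable_coupling_time_gt hF aX cX aZ cZ t0).
- have [aB _ _ _ _] := hB; have [aV _ _ _ _] := hV.
  have sg := filtration_sigma hF t0'.
  have : measurable_wrt (F t) (log_gap t).
    apply: (measurable_wrtB sg); last exact: (measurable_wrt_cst sg).
    apply: (measurable_wrtD sg); first exact: (measurable_wrt_cst sg).
    by apply: (measurable_wrtB sg); apply: (measurable_wrtM sg);
      [exact: (measurable_wrt_cst sg)|exact: aB|exact: (measurable_wrt_cst sg)|exact: aV].
  by move=> /(_ _ (measurable_ge 0)); exact: (filtration_measurable hF t0').
- apply: filterS log_gapP => w hw /(coupling_time_gtP cX cZ w t0') h /=.
  by apply/ltW/log_gap_pos => // s /andP[s0 st] E; apply: (h s); rewrite ?s0 ?st//; apply/hw.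
Qed.

End tails.

Section rates.
Context {R : realType} {d : measure_display} {T : measurableType d}.
Context (P : probability T R) (F : R -> set_system T).
Hypothesis hF : filtration F.
Variables (B : process R T) (a1 a2 sigma1 sigma2 x y : R).
Hypothesis hB : brownian_motion P F B.
Hypotheses (y0 : 0 < y) (yx : y < x).
Variables (X Z : process R T).
Hypothesis hX : geometric_brownian_motion P F B sigma1 a1 x X.
Let mu := a2 - a1 + sigma1 ^+ 2 / 2 - sigma2 ^+ 2 / 2.
Hypothesis mu0 : 0 < mu.

(** The gap must be positive at time [t]; its Brownian part has variance
    [(sigma1 - sigma2) ^+ 2 * t], and [la] is the parameter of the exponential
    Markov inequality. *)
Lemma synchronous_rate (la : R) : 0 <= la -> 
  geometric_brownian_motion P F B sigma2 a2 y Z ->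
  forall e, 0 < e ->
  (exponential_rate (tail_probability P X Z) <=
    (- (la * mu - la ^+ 2 * (sigma1 - sigma2) ^+ 2 / 2) + e)%:E)%E.
Proof.
move=> la0 hZ e e0.
apply: (@exponential_rate_le _ _ (expR (la * (ln x - ln y)))) => //; first exact: expR_gt0.
move=> t t0; split; first exact: measure_ge0.
apply: le_trans (tail_le hF hB y0 yx hB hX hZ t0) _.
have [_ _ B0 _ normB] := hB.
rewrite (_ : mkset _ = increment B 0 t @^-1` [set v : R | (mu * t - (ln x - ln y) <= (sigma1 - sigma2) * v)%R]); last first.
  apply/seteqP; split => w; rewrite /= /log_gap /increment B0 -/mu; lra.
rewrite normB//; last first.
  rewrite -[X in measurable X]setTI.
  apply: (measurable_fun_ler (measurable_cst _) (_ : measurable_fun setT (fun y : R => (sigma1 - sigma2) * y)) measurableT (Y := [set true])) => //.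
  exact: measurable_funM.
rewrite subr0.
have st0 : 0 < Num.sqrt t by rewrite sqrtr_gt0.
apply: le_trans (normal_tail_le _ _ st0 la0) _.
rewrite lee_fin -expRD ler_expR sqr_sqrtr ?(ltW t0)//.
by rewrite le_eqVlt; apply/orP; left; apply/eqP; field.
Qed.

(** The Brownian part of the gap is [sigma1 + sigma2] times [B]; by symmetry only
    the absolute value of this factor matters, and it rescales the gap to a
    Brownian motion above a line of slope [be]. *)
Lemma mirror_rate (be : R) : sigma1 + sigma2 != 0 -> be = mu / `|sigma1 + sigma2| ->
  geometric_brownian_motion P F (fun t w => - B t w) sigma2 a2 y Z ->
  forall kap e, be ^+ 2 / 2 < kap -> 0 < e ->
  ((- kap - e)%:E <= exponential_rate (tail_probability P X Z))%E.
Proof.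
move=> s0 beE hZ kap e hk e0; have hNB := brownian_motion_opp hF hB.
have as0 : 0 < `|sigma1 + sigma2| by rewrite normr_gt0.
have [W hW WE] : exists2 W : process R T, brownian_motion P F W &
    forall t w, `|sigma1 + sigma2| * W t w = (sigma1 + sigma2) * B t w.
  have [h|h] := leP 0 (sigma1 + sigma2); first by exists B => // t w; rewrite ger0_norm.
  by exists (fun t w => - B t w) => // t w; rewrite ltr0_norm// mulrNN.
have be0 : 0 < be by rewrite beE divr_gt0.
have d0 : 0 < (ln x - ln y) / `|sigma1 + sigma2|.
  rewrite divr_gt0// subr_gt0 ltr_ln ?posrE//; exact: lt_trans yx.
have [C C0 hC] := drifted_survival hF hW be0 d0 hk.
apply: (@exponential_rate_ge _ _ C) => // t t0.
have [A [mA PA hA]] := hC t t0; apply: (le_trans PA).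
apply: (tail_ge hF hB y0 yx hNB hX hZ t0 mA) => w u Aw hu.
have := hA w u Aw hu; rewrite -(ltr_pM2l as0) WE mulrBr.
have -> : `|sigma1 + sigma2| * (be * u) = mu * u by rewrite beE; field; rewrite gt_eqF.
have -> : `|sigma1 + sigma2| * ((ln x - ln y) / `|sigma1 + sigma2|) = ln x - ln y.
  by field; rewrite gt_eqF.
rewrite /log_gap -/mu; lra.
Qed.

End rates.

Theorem theorem9 (R : realType) (d : measure_display) (T : measurableType d)
    (P : probability T R) (F : R -> set_system T) (B : process R T)
    (a1 a2 sigma1 sigma2 : R) :
  filtration F ->
  brownian_motion P F B ->
  0 < sigma1 * sigma2 ->
  let mu := a2 - a1 + sigma1 ^+ 2 / 2 - sigma2 ^+ 2 / 2 in
  0 < mu ->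
  forall (x y : R), y < x -> 0 < y ->
  forall (X : process R T) (Y : process R T -> process R T),
    geometric_brownian_motion P F B sigma1 a1 x X ->
    (forall V, brownian_motion P F V ->
       geometric_brownian_motion P F V sigma2 a2 y (Y V)) ->
    ~ efficient P F X Y Tplus (fun t w => - B t w) /\
    ~ efficient P F X Y Tminus B.
Proof.
move=> hF hB ss mu mu0 x y yx y0 X Y hX hY.
have hNB := brownian_motion_opp hF hB.
have key : (exponential_rate (tail_probability P X (Y B)) <
    exponential_rate (tail_probability P X (Y (fun t w => (- B t w)%R))))%E.
  have s2 : (sigma1 - sigma2) ^+ 2 < (sigma1 + sigma2) ^+ 2.
    have -> : (sigma1 + sigma2) ^+ 2 = (sigma1 - sigma2) ^+ 2 + 4 * (sigma1 * sigma2) by ring.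
    by rewrite ltrDl mulr_gt0.
  have sp : 0 < (sigma1 + sigma2) ^+ 2 by exact: le_lt_trans (sqr_ge0 _) s2.
  have sn : sigma1 + sigma2 != 0 by rewrite -(sqrf_eq0 (sigma1 + sigma2)) gt_eqF.
  have beE : (mu / `|sigma1 + sigma2|) ^+ 2 / 2 = mu ^+ 2 / (2 * (sigma1 + sigma2) ^+ 2).
    rewrite expr_div_n -normrX ger0_norm ?sqr_ge0//; field; exact: sn.
  (* The optimal parameter for the mirror volatility; it is enough here. *)
  pose la := mu / (sigma1 + sigma2) ^+ 2; have la0 : 0 <= la by rewrite divr_ge0 ?ltW.
  (* [4 * g] separates the exponents; each of the two estimates loses at most [2 * g]. *)
  have [g g0 gE] : exists2 g, 0 < g &
      la * mu - la ^+ 2 * (sigma1 - sigma2) ^+ 2 / 2 = (mu / `|sigma1 + sigma2|) ^+ 2 / 2 + 4 * g.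
    exists (mu ^+ 2 / (2 * ((sigma1 + sigma2) ^+ 2) ^+ 2) * ((sigma1 + sigma2) ^+ 2 - (sigma1 - sigma2) ^+ 2) / 4).
      by rewrite divr_gt0// mulr_gt0 ?subr_gt0// divr_gt0 ?exprn_gt0// mulr_gt0// exprn_gt0.
    by rewrite beE /la; field; exact: sn.
  have up := synchronous_rate hF hB y0 yx hX la0 (hY _ hB) g0.
  have hk : (mu / `|sigma1 + sigma2|) ^+ 2 / 2 < (mu / `|sigma1 + sigma2|) ^+ 2 / 2 + g by rewrite ltrDl.
  have lo := mirror_rate hF hB y0 yx hX mu0 sn erefl (hY _ hNB) hk g0.
  apply: le_lt_trans up _; apply: lt_le_trans _ lo.
  rewrite -/mu gE lte_fin; lra.
split=> /= h.
- move: key; rewrite ltNge => /negP; apply; apply: (le_trans h).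
  apply: exponential_rate_mono => t t0; split.
    by apply: le_ereal_inf_tmp => _ [V hV <-]; exact: measure_ge0.
  by apply: ereal_inf_lbound; exists B.
- move: key; rewrite ltNge => /negP; apply; move: h; rewrite /efficient /= leeN2 => h; apply: le_trans _ h.
  apply: exponential_rate_mono => t t0; split; first exact: measure_ge0.
  rewrite leeNr; apply: ereal_inf_lbound; by exists (fun t w => - B t w).
Qed.
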